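(* Let $\eta$ satisfy (A1) and (A2). Then for $\eta$-a.e. environment $\omega$ and every initial height distribution $\pi$ (possibly depending measurably on $\omega$), $T_n/n$ satisfies a weak large deviation principle under $P_\omega^\pi$ with rate function $J_\eta$: for every open $G\subset\mathbb R$, $$\liminf_{n\to\infty}\frac1n\log P^\pi_\omega(T_n/n\in G)\ge-\inf_{t\in G}J_\eta(t),$$ and for every compact $F\subset\mathbb R$, $$\limsup_{n\to\infty}\frac1n\log P^\pi_\omega(T_n/n\in F)\le-\inf_{t\in F}J_\eta(t).$$
   Context: Setting. Fix an integer $d\ge1$ and write $[d]=\{1,\dots,d\}$. Let $\Sigma$ be the set of triples $(q,r,p)$ of $d\times d$ matrices with nonnegative real entries such that $(q+r+p)\mathbf 1=\mathbf 1$, where $\mathbf 1$ is the all-ones column vector. Let $\Omega=\Sigma^{\mathbb Z}$ (Borel σ-algebra), with elements $\omega=(\omega_n)_{n\in\mathbb Z}$, $\omega_n=(q_n,r_n,p_n)$, and shift $(\theta\omega)_k=\omega_{k+1}$. For $\omega\in\Omega$ and $(x,i)\in\mathbb Z\times[d]$, $P^{(x,i)}_\omega$ is the law of the Markov chain $\xi_n=(X_n,Y_n)$ on $\mathbb Z\times[d]$ with $\xi_0=(x,i)$ which, from $(k,i)$, jumps to $(k-1,j)$, $(k,j)$, $(k+1,j)$ with probabilities $q_k(i,j)$, $r_k(i,j)$, $p_k(i,j)$ respectively; $E^{(x,i)}_\omega$ is its expectation. For a probability vector $\pi$ on $[d]$ (allowed to depend measurably on $\omega$), $P^\pi_\omega=\sum_i\pi(i)P^{(0,i)}_\omega$.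 For a probability measure $\eta$ on $\Omega$, the averaged law is $\mathbb P^\pi=\int P^\pi_\omega\,\eta(d\omega)$. Let $T_x=\inf\{n\ge0:X_n=x\}$. For $\kappa>0$, $\Sigma_\kappa$ is the set of $(q,r,p)\in\Sigma$ with $\sum_jq(i,j)\ge\kappa$ and $\sum_jp(i,j)\ge\kappa$ for all $i$, and $((I-r)^{-1}q)(i,j)\ge\kappa$, $((I-r)^{-1}p)(i,j)\ge\kappa$ for all $i,j$; $\Omega_\kappa=\Sigma_\kappa^{\mathbb Z}$. Assumption (A1): $\eta$ is stationary and ergodic under $\theta$. Assumption (A2): there is $\kappa>0$ with $\eta(\Omega_\kappa)=1$. Moment generating matrices. For $\omega$, $\lambda\in\mathbb R$, $k\in\mathbb Z$, let $\Phi_k(\lambda)$ be the $d\times d$ matrix with entries $\Phi_k(\lambda)(i,j)=E^{(k,i)}_\omega[e^{\lambda T_{k+1}}\mathbf 1\{T_{k+1}<\infty,\,Y_{T_{k+1}}=j\}]\in[0,\infty]$, and $\Phi_{[m,n]}(\lambda)=\Phi_m(\lambda)\Phi_{m+1}(\lambda)\cdots\Phi_n(\lambda)$ for $m\le n$. Let $\lambda_{crit}(\eta)=\sup\{\lambda:\eta(\max_i\sum_j\Phi_0(\lambda)(i,j)<\infty)=1\}$. For $\lambda\le\lambda_{crit}(\eta)$, $\mu_0(\lambda)$ denotes the (row) probability vector $\lim_{m\to-\infty}e_i\Phi_{[m,-1]}(\lambda)/(e_i\Phi_{[m,-1]}(\lambda)\mathbf 1)$, which under (A1),(A2) exists $\eta$-a.s.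 and does not depend on $i\in[d]$ ($e_i$ the standard basis row vectors). Define $\Lambda_\eta(\lambda)=E_\eta[\log(\mu_0(\lambda)\Phi_0(\lambda)\mathbf 1)]$ for $\lambda\le\lambda_{crit}(\eta)$ and $\Lambda_\eta(\lambda)=+\infty$ for $\lambda>\lambda_{crit}(\eta)$, and $J_\eta(t)=\sup_{\lambda\in\mathbb R}\{\lambda t-\Lambda_\eta(\lambda)\}$. *)

(* Defs.v *)
From HB Require Import structures.
From mathcomp Require Import all_boot all_order all_algebra.
From mathcomp Require Import all_classical all_reals all_analysis.
Set Implicit Arguments. Unset Strict Implicit. Unset Printing Implicit Defensive.
Import Order.TTheory GRing.Theory Num.Theory.
Import numFieldNormedType.Exports.
Local Open Scope classical_set_scope.
Local Open Scope ring_scope.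

Section Defs.
Variables (R : realType) (d : nat).

(* Raw environment: omega k c i j is entry (i,j) of q_k (c=0), r_k (c=1), p_k (c=2). *)
Definition env_raw := int -> 'I_3 -> 'I_d -> 'I_d -> R.
HB.instance Definition _ := gen_eqMixin env_raw.
HB.instance Definition _ := gen_choiceMixin env_raw.
HB.instance Definition _ := isPointed.Build env_raw (fun _ _ _ _ => 0).

Definition env_cyl : set (set env_raw) :=
  [set A | exists k c i j (B : set R), measurable B /\
           A = [set w | B (w k c i j)]].

Definition env : measurableType _ := g_sigma_algebraType env_cyl.

Definition qq (w : env) (k : int) : 'M[R]_d := \matrix_(i, j) w k 0%R i j.
Definition rr (w : env) (k : int) : 'M[R]_d := \matrix_(i, j) w k 1%R i j.
Definition pp (w : env) (k : int) : 'M[R]_d := \matrix_(i, j) w k 2%R i j.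

Definition shift (w : env) : env := fun k => w (k + 1)%R.

Definition stationary (eta : probability env R) : Prop :=
  forall A : set env, measurable A -> eta (shift @^-1` A) = eta A.

Definition ergodic (eta : probability env R) : Prop :=
  forall A : set env, measurable A -> shift @^-1` A = A ->
    eta A = 0%E \/ eta A = 1%E.

Definition in_Sigma (q r p : 'M[R]_d) : Prop :=
  (forall i j, 0 <= q i j /\ 0 <= r i j /\ 0 <= p i j) /\
  (forall i, \sum_(j < d) (q i j + r i j + p i j) = 1).

Definition in_Sigma_kappa (kappa : R) (q r p : 'M[R]_d) : Prop :=
  in_Sigma q r p /\
  (forall i, \sum_(j < d) q i j >= kappa /\ \sum_(j < d) p i j >= kappa) /\
  (forall i j, (invmx (1%:M - r) *m q) i j >= kappa /\
               (invmx (1%:M - r) *m p) i j >= kappa).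

Definition Omega_kappa (kappa : R) : set env :=
  [set w | forall k, in_Sigma_kappa kappa (qq w k) (rr w k) (pp w k)].

(* hit w n m x i j = P_w^{(x,i)}(T_n = m, Y_{T_n} = j), via first-step
   decomposition of the Markov chain with the given transition kernel. *)
Fixpoint hit (w : env) (n : int) (m : nat) (x : int) (i j : 'I_d) {struct m} : R :=
  match m with
  | 0%N => if x == n then (i == j)%:R else 0
  | m'.+1 => if x == n then 0 else
      \sum_(l < d) (qq w x i l * hit w n m' (x - 1) l j
                   + rr w x i l * hit w n m' x l j
                   + pp w x i l * hit w n m' (x + 1) l j)
  end.

(* Phi_k(lambda)(i,j) = E^{(k,i)}[e^{lambda T_{k+1}} 1{T_{k+1}<oo, Y=j}] in [0,+oo] *)
Definition Phi (w : env) (lam : R) (k : int) (i j : 'I_d) : \bar R :=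
  (\sum_(m <oo) (expR (lam * m%:R) * hit w (k + 1) m k i j)%:E)%E.

Definition Phimx (w : env) (lam : R) (k : int) : 'M[R]_d :=
  \matrix_(i, j) fine (Phi w lam k i j).

Fixpoint Phiprod (w : env) (lam : R) (n : nat) : 'M[R]_d :=
  match n with
  | 0%N => 1%:M
  | n'.+1 => Phimx w lam (- (n'.+1)%:Z) *m Phiprod w lam n'
  end.

(* mu_0(lambda): the a.s. limit (independent of the row i) of normalised rows. *)
Definition mu0 (w : env) (lam : R) (j : 'I_d) : R :=
  match [pick i : 'I_d] with
  | Some i => limn ((fun n => Phiprod w lam n.+1 i j /
                             \sum_(l < d) Phiprod w lam n.+1 i l) : R^nat)
  | None => 0
  end.

Local Open Scope ereal_scope.

Definition elog (x : \bar R) : \bar R :=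
  match x with
  | r%:E => if (0 < r)%R then (ln r)%:E else -oo
  | +oo => +oo
  | -oo => -oo
  end.

Definition lambda_crit (eta : probability env R) : \bar R :=
  ereal_sup [set lam%:E | lam in
    [set lam : R | eta [set w | \big[maxe/-oo]_(i < d) (\sum_(j < d) Phi w lam 0 i j)
                                 < +oo] = 1]].

Definition Lambda (eta : probability env R) (lam : R) : \bar R :=
  if lam%:E <= lambda_crit eta then
    \int[eta]_w elog (\sum_(i < d) (mu0 w lam i)%:E * \sum_(j < d) Phi w lam 0 i j)
  else +oo.

Definition J (eta : probability env R) (t : R) : \bar R :=
  ereal_sup [set (lam * t)%:E - Lambda eta lam | lam in [set: R]].

Definition probT (w : env) (pi : 'I_d -> R) (n : nat) (G : set R) : \bar R :=
  \sum_(i < d) (pi i)%:E *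
    \sum_(m <oo | (m%:R / n%:R)%R \in G) (\sum_(j < d) hit w n%:Z m 0 i j)%:E.

Definition prob_vector (pi : 'I_d -> R) : Prop :=
  (forall i, (0 <= pi i)%R) /\ (\sum_(i < d) pi i = 1)%R.

End Defs.

(* Main.v *)
(* A walk going from level 0 to level n crosses the levels one at a time, so the
   generating function of T_n is a product of n generating matrices.  Uniform
   ellipticity bounds the entries of these matrices between positive constants,
   products of such matrices contract directions, and Birkhoff's theorem for the
   resulting stationary directions gives the exponential growth rate; below
   lambda_crit this rate is Lambda.

   Upper bound: Chernoff's inequality with countably many rational parameters
   lambda, and compactness.

   Lower bound: truncate each crossing time at K.  The truncated rates LK K are
   finite everywhere, midpoint convex with slopes in [1, K], and increase with K to
   Lambda (to infinity above lambda_crit).  A compactness argument gives, for t > 1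
   and a > J(t), a K whose truncated rate function at t is below a.  Differentiability
   of LK K is not available, so instead of a single tilt at the maximiser lambda_0
   the walk is tilted by two parameters lambda_1 <= lambda_0 <= lambda_2, over two
   consecutive blocks of levels; these are chosen where a discretised slope of LK K
   is almost constant, so that the passage times concentrate, with speeds on both
   sides of t, and the block lengths are adjusted to average to t. *)
Require Import Defs.
From HB Require Import structures.
From mathcomp Require Import all_boot all_order all_algebra.
From mathcomp Require Import all_classical all_reals all_analysis.
From mathcomp Require Import measurable_realfun.
From mathcomp Require Import ring lra zify.
Import Order.TTheory GRing.Theory Num.Theory.
Import numFieldNormedType.Exports.
Local Open Scope classical_set_scope.
Local Open Scope ring_scope.
Set Implicit Arguments.
Unset Strict Implicit.
Unset Printing Implicit Defensive.

(** * Birkhoff's theorem for bounded functions *)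

(** The environment enters only through almost sure growth statements whose errors are uniform in
    the starting height; this uniformity makes every [pi], even one depending on the environment,
    harmless. Relations between the deterministic rates are read off from a single environment in
    which the relevant growth statements hold together. No tilted measure is built. The law of a
    truncated crossing time is kept as the coefficients of a polynomial: evaluating at exp lambda is
    tilting, selecting coefficients is conditioning, evaluating at 1 is the original probability.
    Truncation answers an obstacle at lambda_crit. The maximiser of lambda t - Lambda(lambda) may
    sit there, where Lambda jumps to infinity, and a tilt at that point need not produce the speed
    t. Truncated matrices are finite for every lambda, so the maximiser can be approached from both
    sides, and truncation only lowers probabilities, which a lower bound allows. The price is that
    the truncated rates must grow to infinity beyond lambda_crit, although there some entry of Phi
    is infinite only with positive probability. *)

Definition asymp_linear (R : realType) (u : nat -> R) (m : R) :=
  forall e : R, 0 < e -> exists D : R, forall n, `|u n - n%:R * m| <= e * n%:R + D.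

Definition bmeas d (T : measurableType d) (R : realType) (f : T -> R) :=
  measurable_fun setT f /\ exists M : R, forall x, `|f x| <= M.

Section Birkhoff.
Context d (T : measurableType d) (R : realType) (P : probability T R) (th : T -> T).

Lemma bmeas_int (f : T -> R) : bmeas f -> P.-integrable setT (EFin \o f).
Proof.
move=> [mf [M bM]]; apply: measurable_bounded_integrable => //.
  by rewrite (le_lt_trans (@probability_le1 _ _ _ P _ measurableT))// ltry.
exists M; split; first exact: num_real.
by move=> N MN x _; apply: (le_trans (bM x)); apply: ltW.
Qed.

Lemma bmeas_cst (c : R) : bmeas (fun _ : T => c).
Proof. by split; [exact: measurable_cst|exists `|c|]. Qed.

Lemma bmeasD (f g : T -> R) : bmeas f -> bmeas g -> bmeas (fun x => f x + g x).
Proof.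
move=> [mf [M bM]] [mg [N bN]]; split; first exact: measurable_funD.
by exists (M + N) => x; rewrite (le_trans (ler_normD _ _))// lerD.
Qed.

Lemma bmeasN (f : T -> R) : bmeas f -> bmeas (fun x => - f x).
Proof.
move=> [mf [M bM]]; split; first exact: measurable_funN.
by exists M => x; rewrite normrN.
Qed.

Lemma bmeas_max (f g : T -> R) : bmeas f -> bmeas g ->
  bmeas (fun x => Num.max (f x) (g x)).
Proof.
move=> [mf [M bM]] [mg [N bN]]; split; first exact: measurable_maxr.
exists (M + N) => x; have := bM x; have := bN x.
have := normr_ge0 (f x); have := normr_ge0 (g x).
by case: (leP (f x) (g x)); lra.
Qed.

Lemma bmeas_sum (I : Type) (s : seq I) (h : I -> T -> R) :
  (forall i, bmeas (h i)) -> bmeas (fun x => \sum_(i <- s) h i x).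
Proof.
move=> bh; elim: s => [|i s IH].
  by under eq_fun do rewrite big_nil; exact: bmeas_cst.
by under eq_fun do rewrite big_cons; exact: bmeasD.
Qed.

Hypothesis mth : measurable_fun setT th.
Hypothesis inv : forall A, measurable A -> P (th @^-1` A) = P A.

Lemma bmeas_comp (f : T -> R) : bmeas f -> bmeas (fun x => f (th x)).
Proof.
move=> [mf [M bM]]; split; last by exists M => x.
exact: (measurableT_comp mf mth).
Qed.

Lemma bmeas_iter (f : T -> R) k : bmeas f -> bmeas (fun x => f (iter k th x)).
Proof.
move=> bf; elim: k => [//|k IH].
by under eq_fun do rewrite iterSr; exact: (bmeas_comp IH).
Qed.

Lemma Rintegral_comp (f : T -> R) : bmeas f ->
  \int[P]_x (f (th x)) = \int[P]_x (f x).
Proof.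
move=> bf; rewrite /Rintegral; congr fine.
have mf : measurable_fun setT (EFin \o f) by apply/measurable_EFinP; case: bf.
have := @integral_pushforward _ _ _ _ R th mth P setT (EFin \o f) mf _ measurableT.
rewrite preimage_setT => <-; last exact/bmeas_int/bmeas_comp.
by apply: eq_measure_integral => A mA _; rewrite -[RHS]inv.
Qed.

Lemma RintegralDb (f g : T -> R) : bmeas f -> bmeas g ->
  \int[P]_x (f x + g x) = \int[P]_x (f x) + \int[P]_x (g x).
Proof. by move=> bf bg; rewrite RintegralD//; exact: bmeas_int. Qed.

Lemma RintegralNb (f : T -> R) : bmeas f -> \int[P]_x (- f x) = - (\int[P]_x (f x)).
Proof.
move=> bf; under eq_Rintegral do rewrite -mulN1r.
by rewrite RintegralZl ?mulN1r//; exact: bmeas_int.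
Qed.

Lemma Rintegral_cstb (c : R) : \int[P]_(x in setT) c = c.
Proof.
rewrite Rintegral_cst//.
by have := probability_setT P => /= ->; rewrite mulr1.
Qed.

Lemma le_Rintegralb (f g : T -> R) : bmeas f -> bmeas g ->
  (forall x, f x <= g x) -> \int[P]_x (f x) <= \int[P]_x (g x).
Proof. by move=> bf bg fg; apply: le_Rintegral => //; exact: bmeas_int. Qed.

Definition birkhoff_sum (f : T -> R) n x := \sum_(k < n) f (iter k th x).

Lemma birkhoff_sumS f n x :
  birkhoff_sum f n.+1 x = f x + birkhoff_sum f n (th x).
Proof.
rewrite /birkhoff_sum big_ord_recl; congr (_ + _).
by apply: eq_bigr => i _; rewrite /bump /= -iterSr.
Qed.

(** The maximum of the Birkhoff sums of lengths 1 to [n.+1], in the recursive form that Garsia's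
    argument for the maximal inequality uses. *)
Fixpoint running_max (h : T -> R) n x : R :=
  if n is n'.+1 then h x + Num.max 0 (running_max h n' (th x)) else h x.

Lemma bmeas_running_max h n : bmeas h -> bmeas (running_max h n).
Proof.
move=> bh; elim: n => [//|n IH] /=.
apply: bmeasD => //; apply: bmeas_max; first exact: bmeas_cst.
exact: (bmeas_comp IH).
Qed.

Lemma birkhoff_sum_le_max h n k x :
  (k <= n)%N -> birkhoff_sum h k.+1 x <= running_max h n x.
Proof.
elim: n k x => [|n IH] k x.
  by rewrite leqn0 => /eqP ->; rewrite birkhoff_sumS /birkhoff_sum big_ord0 addr0.
case: k => [_|k kn]; rewrite birkhoff_sumS /=.
  by rewrite /birkhoff_sum big_ord0 lerD2l le_max lexx.
by rewrite lerD2l le_max IH ?orbT.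
Qed.

Lemma running_max_leS h n x : running_max h n x <= running_max h n.+1 x.
Proof.
elim: n x => [|n IH] x; first by rewrite /= lerDl le_max lexx.
rewrite [in leRHS]/= [in leLHS]/= lerD2l ge_max le_max lexx/=.
by rewrite le_max; apply/orP; right; exact: IH.
Qed.

Lemma running_max_ge h n x : h x <= running_max h n x.
Proof. by elim: n => [//|n IH]; exact: (le_trans IH (running_max_leS _ _ _)). Qed.

(** With M_n the running maximum, M_(n+1) = h + M_n o th + max(0, - M_n o th). Integrating, the
    invariance of P and M_n <= M_(n+1) leave only h and the negative part. *)
Lemma running_max_neg_int h n : bmeas h ->
  - (\int[P]_x (h x)) <= \int[P]_x Num.max 0 (- running_max h n (th x)).
Proof.
move=> bh; have bM := bmeas_running_max n bh.
have bM' := bmeas_running_max n.+1 bh.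
have bN : bmeas (fun x => Num.max 0 (- running_max h n (th x))).
  by apply: bmeas_max; [exact: bmeas_cst|apply: bmeasN; exact: bmeas_comp].
have E x : running_max h n.+1 x =
    h x + Num.max 0 (- running_max h n (th x)) + running_max h n (th x).
  rewrite /= -addrA; congr (_ + _).
  by case: (leP 0 (running_max h n (th x))) => ?;
     case: (leP 0 (- running_max h n (th x))) => ?; lra.
have : \int[P]_x running_max h n x <= \int[P]_x running_max h n.+1 x.
  by apply: le_Rintegralb => // x; exact: running_max_leS.
under [leRHS]eq_Rintegral do rewrite E.
rewrite RintegralDb; [|exact: bmeasD|exact: bmeas_comp].
rewrite RintegralDb// (Rintegral_comp bM); lra.
Qed.

Hypothesis erg : forall A, measurable A -> th @^-1` A = A -> P A = 0%E \/ P A = 1%E.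

(** The set of points with unbounded sums is invariant, hence null or full. If it were full, the
    negative parts in [running_max_neg_int] would tend to 0 boundedly, forcing the integral of [h]
    to be nonnegative. *)
Lemma birkhoff_sum_bounded_above h : bmeas h -> \int[P]_x h x < 0 ->
  {ae P, forall x, exists C : R, forall n, birkhoff_sum h n x <= C}.
Proof.
move=> bh hneg.
pose B := [set x | forall C : nat, exists n, C%:R < birkhoff_sum h n x].
have mB : measurable B.
  rewrite (_ : B = \bigcap_C \bigcup_n [set x | C%:R < birkhoff_sum h n x]); last first.
    by apply/seteqP; split => x /= H C; [move=> _|]; have := H C;
      [move=> [n]; exists n|move=> /(_ I)[n _]; exists n].
  apply: bigcap_measurable => [|C _]; first by exists 0%N.
  apply: bigcup_measurable => n _.
  rewrite -[X in measurable X]setTI.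
  apply: (@measurable_fun_ltr _ _ _ setT (cst C%:R) (birkhoff_sum h n)) => //.
  by have [] : bmeas (birkhoff_sum h n) by apply: bmeas_sum => i; exact: bmeas_iter.
have [Mh bMh] : exists M : nat, forall x, `|h x| <= M%:R.
  case: bh => _ [M bM]; exists (Num.truncn M).+1 => x.
  by apply: (le_trans (bM x)); exact/ltW/truncnS_gt.
(* The sums at [x] and at [th x] differ by the single term [h x], so exceeding [C + Mh] at one point
   gives a sum exceeding [C] at the other. *)
have thB : th @^-1` B = B.
  apply/seteqP; split => x /= H C.
    have [n Hn] := H (C + Mh)%N; exists n.+1; rewrite birkhoff_sumS.
    by move: Hn; rewrite natrD; have := bMh x; rewrite ler_norml => /andP[]; lra.
  have [n Hn] := H (C + Mh)%N; case: n Hn => [|n].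
    by rewrite /birkhoff_sum big_ord0 ltrn0.
  rewrite birkhoff_sumS natrD => Hn; exists n.
  by move: Hn; have := bMh x; rewrite ler_norml => /andP[]; lra.
have [PB|PB] := erg mB thB.
  exists B; split => // x /= H C; apply: contrapT => HC; apply: H.
  exists C%:R => n; rewrite leNgt; apply/negP => Hn; apply: HC; by exists n.
exfalso.
(* On [B] the running maxima are eventually positive, so these functions are eventually 0; they are
   dominated by [Mh] because [running_max] is at least [h]. *)
pose N n x := Num.max 0 (- running_max h n (th x)).
have bN n : bmeas (N n).
  apply: bmeas_max; [exact: bmeas_cst|apply: bmeasN; apply: bmeas_comp].
  exact: bmeas_running_max.
have aeB : {ae P, forall x, B x}.
  exists (~` B); split => //; first exact: measurableC.
  by rewrite probability_setC// PB subee.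
have [_ _ cvgN] : [/\ P.-integrable setT (cst 0%E),
   [sequence (\int[P]_(x in setT) `|(N n x)%:E - 0|)%E]_n @ \oo --> 0%E &
   [sequence (\int[P]_(x in setT) (N n x)%:E)%E]_n @ \oo --> (\int[P]_(x in setT) 0)%E].
  apply: (@dominated_convergence _ _ _ P setT measurableT (fun n x => (N n x)%:E)
    (cst 0%E) (cst Mh%:R%:E)).
  - by move=> n; apply/measurable_EFinP; case: (bN n).
  - exact: measurable_cst.
  - apply: filterS aeB => x Bx _.
    have : B (th x) by rewrite -[B (th x)]/((th @^-1` B) x) thB.
    move=> /(_ 0%N)[n Hn].
    case: n Hn => [|n Hn]; first by rewrite /birkhoff_sum big_ord0 ltxx.
    apply: cvg_near_cst; exists n => // k /= nk.
    have := birkhoff_sum_le_max h (th x) nk => Hk.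
    by apply/eqP; rewrite eqe /N max_l// oppr_le0 (le_trans _ Hk)// ltW.
  - apply: (@bmeas_int (fun=> Mh%:R)); exact: bmeas_cst.
  - apply: aeW => x n _; rewrite lee_fin /N ger0_norm ?le_max ?lexx//.
    rewrite ge_max ler0n/=; have := running_max_ge h n (th x); have := bMh (th x).
    by rewrite ler_norml => /andP[]; lra.
rewrite integral0 in cvgN.
have /fine_cvgP[_ /cvgrPdist_lt] := cvgN.
move=> /(_ (- (\int[P]_x (h x)))).
rewrite oppr_gt0 => /(_ hneg)[k _ /(_ k (leqnn k))].
rewrite /= sub0r normrN => H.
have := running_max_neg_int k bh; rewrite leNgt => /negP; apply.
by apply: le_lt_trans H; rewrite ler_norm.
Qed.

(** Subtracting the mean plus [1/(k+1)] makes the integral negative, so the corrected sums are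
    bounded above; countably many [k] cover every [e]. *)
Lemma birkhoff_le f : bmeas f -> {ae P, forall x, forall e : R, 0 < e ->
  exists D : R, forall n, birkhoff_sum f n x - n%:R * \int[P]_x f x <= e * n%:R + D}.
Proof.
move=> bf; set m := \int[P]_x f x.
have : {ae P, forall x, forall k : nat, exists C : R, forall n,
    birkhoff_sum (fun x => f x + (- m - k.+1%:R^-1)) n x <= C}.
  apply: ae_foralln => k; apply: birkhoff_sum_bounded_above.
    by apply: bmeasD => //; exact: bmeas_cst.
  rewrite RintegralDb//; last exact: bmeas_cst.
  rewrite Rintegral_cstb -/m.
  by rewrite addrA subrr sub0r oppr_lt0 invr_gt0.
apply: filterS => x H e e0.
have [k ke] : exists k : nat, k.+1%:R^-1 < e.
  have [k _ Hk] := @near_infty_natSinv_lt R (PosNum e0).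
  by exists k; exact: (Hk k (leqnn _)).
have [C HC] := H k; exists C => n; have := HC n.
rewrite /birkhoff_sum big_split/= sumr_const card_ord -[(- m - _) *+ n]mulr_natl.
have : n%:R * k.+1%:R^-1 <= n%:R * e by rewrite ler_wpM2l// ltW.
move: (k.+1%:R^-1) => a; rewrite -/m mulrDr !mulrN; lra.
Qed.

Theorem birkhoff f : bmeas f ->
  {ae P, forall x, asymp_linear (birkhoff_sum f ^~ x) (\int[P]_x f x)}.
Proof.
move=> bf; apply: filterS2 (birkhoff_le bf) (birkhoff_le (bmeasN bf)) => x H1 H2 e e0.
have [D1 HD1] := H1 e e0; have [D2 HD2] := H2 e e0.
exists (Num.max D1 D2) => n; have := HD1 n; have := HD2 n.
rewrite RintegralNb// {1}/birkhoff_sum sumrN -/(birkhoff_sum f n x).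
have M1 : D1 <= Num.max D1 D2 by rewrite le_max lexx.
have M2 : D2 <= Num.max D1 D2 by rewrite le_max lexx orbT.
rewrite ler_norml; move=> *; apply/andP; split; lra.
Qed.

End Birkhoff.

(** * Products of positive matrices *)

Definition rowsum (R : nmodType) (d : nat) (M : 'M[R]_d) (i : 'I_d) : R :=
  \sum_(j < d) M i j.

(** New factors enter on the left: with [B k] the matrix of level -(k+1), these are the products
    over a growing past. *)
Fixpoint bprod (R : nzSemiRingType) d (B : nat -> 'M[R]_d) n : 'M[R]_d :=
  if n is n'.+1 then B n' *m bprod B n' else 1%:M.

Fixpoint fprod (R : nzSemiRingType) d (B : nat -> 'M[R]_d) a n : 'M[R]_d :=
  if n is n'.+1 then B a *m fprod B a.+1 n' else 1%:M.

Lemma rowsum_mulmx (R : nzSemiRingType) d (M N : 'M[R]_d) i :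
  rowsum (M *m N) i = \sum_(l < d) M i l * rowsum N l.
Proof.
rewrite /rowsum; under eq_bigr do rewrite mxE.
by rewrite exchange_big /=; apply: eq_bigr => l _; rewrite mulr_sumr.
Qed.

Lemma rowsum1 (R : nzSemiRingType) d i : rowsum (1%:M : 'M[R]_d) i = 1.
Proof.
rewrite /rowsum (bigD1 i)//= mxE eqxx big1 ?addr0// => j ji.
by rewrite mxE eq_sym (negPf ji).
Qed.

Lemma fprodD (R : nzSemiRingType) d (B : nat -> 'M[R]_d) a n m :
  fprod B a (n + m) = fprod B a n *m fprod B (a + n) m.
Proof.
elim: n a => [|n IH] a /=; first by rewrite mul1mx addn0.
by rewrite IH mulmxA addSnnS.
Qed.

Lemma fprod_shift (R : nzSemiRingType) d (B B' : nat -> 'M[R]_d) b a n :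
  (forall k, B' k = B (b + k)%N) -> fprod B' a n = fprod B (b + a) n.
Proof. by move=> H; elim: n a => [//|n IH] a /=; rewrite IH H addnS. Qed.

Lemma eq_fprod (R : nzSemiRingType) d (B B' : nat -> 'M[R]_d) a n :
  (forall k, B' k = B k) -> fprod B' a n = fprod B a n.
Proof. by move=> H; rewrite (@fprod_shift _ _ B B' 0)// add0n. Qed.

(** Moving the origin one level to the right adds one factor at the right end of the past product;
    this gives the equivariance [left_dir_th]. *)
Lemma bprodSr (R : nzSemiRingType) d (B B' : nat -> 'M[R]_d) n :
  (forall k, B' k.+1 = B k) -> bprod B' n.+1 = bprod B n *m B' 0%N.
Proof.
move=> H; elim: n => [|n IH]; first by rewrite /= mulmx1 mul1mx.
by rewrite -[LHS]/(B' n.+1 *m bprod B' n.+1) IH mulmxA H.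
Qed.

Lemma cvg_sumr (R : realType) (I : finType) (f : I -> nat -> R) (l : I -> R) :
  (forall i, f i @ \oo --> l i) -> (fun n => \sum_i f i n) @ \oo --> \sum_i l i.
Proof.
move=> h; elim: (index_enum I) => [|i s IH].
  by under eq_fun do rewrite big_nil; rewrite big_nil; exact: cvg_cst.
by under eq_fun do rewrite big_cons; rewrite big_cons; exact: cvgD.
Qed.

(** * Repeated averaging with weights bounded below *)

Section Averaging.
Context (R : realType) (I : finType).
Variables (i0 : I) (delta : R) (x : nat -> I -> R) (W : nat -> I -> I -> R).
Hypothesis delta0 : 0 < delta.
Hypothesis W_ge : forall n i l, delta <= W n i l.
Hypothesis W1 : forall n i, \sum_l W n i l = 1.
Hypothesis xS : forall n i, x n.+1 i = \sum_l W n i l * x n l.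

Let D0 := \sum_l `|x 0 l|.

(** Endpoints of an interval containing every [x n i]. Each average puts weight at least [delta] on
    the common index [i0], which pulls both endpoints towards [x n i0] and shrinks the width by the
    factor [1 - delta]. *)
Fixpoint avg_lb n : R :=
  if n is n'.+1 then avg_lb n' + delta * (x n' i0 - avg_lb n') else - D0.
Fixpoint avg_ub n : R :=
  if n is n'.+1 then avg_ub n' - delta * (avg_ub n' - x n' i0) else D0.

Lemma avg_bounds n i : avg_lb n <= x n i <= avg_ub n.
Proof.
elim: n i => [|n IH] i /=.
  by rewrite -ler_norml /D0 (bigD1 i)//= lerDl sumr_ge0.
have E a : x n.+1 i - a = \sum_l W n i l * (x n l - a).
  rewrite xS; under [RHS]eq_bigr do rewrite mulrBr.
  by rewrite sumrB -mulr_suml W1 mul1r.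
apply/andP; split.
  rewrite -subr_ge0 opprD addrA E subr_ge0 (bigD1 i0)//=.
  rewrite -[leLHS]addr0 lerD//.
    by rewrite ler_wpM2r// subr_ge0; case/andP: (IH i0).
  apply: sumr_ge0 => l _; apply: mulr_ge0; first exact: (le_trans (ltW delta0)).
  by rewrite subr_ge0; case/andP: (IH l).
rewrite -lerBlDl -mulrN opprB E (bigD1 i0)//= -[leRHS]addr0 lerD//.
  by rewrite ler_wnM2r// subr_le0; case/andP: (IH i0).
apply: sumr_le0 => l _; apply: mulr_ge0_le0; first exact: (le_trans (ltW delta0)).
by rewrite subr_le0; case/andP: (IH l).
Qed.

Lemma avg_width n : avg_ub n - avg_lb n = (1 - delta) ^+ n * (D0 + D0).
Proof.
elim: n => [|n IH] /=; first by rewrite expr0 mul1r opprK.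
by rewrite exprS -mulrA -IH; ring.
Qed.

Lemma avg_cvg : exists l : R, forall i, x ^~ i @ \oo --> l.
Proof.
have delta1 : delta <= 1.
  rewrite -(W1 0 i0) (bigD1 i0)//= (le_trans (W_ge 0 i0 i0))// lerDl.
  by apply: sumr_ge0 => l _; apply: (le_trans (ltW delta0)).
have lb_le n : avg_lb n <= avg_lb n.+1.
  rewrite /= lerDl mulr_ge0 ?(ltW delta0)// subr_ge0; by case/andP: (avg_bounds n i0).
have ub_le n : avg_ub n.+1 <= avg_ub n.
  rewrite /= lerBlDr lerDl mulr_ge0 ?(ltW delta0)// subr_ge0; by case/andP: (avg_bounds n i0).
have ub0 n : avg_ub n <= avg_ub 0 by elim: n => [//|n]; apply: le_trans.
have cl : cvgn avg_lb.
  apply: nondecreasing_is_cvgn; first by apply/nondecreasing_seqP.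
  exists (avg_ub 0) => _ [n _ <-]; have /andP[h1 h2] := avg_bounds n i0.
  exact: (le_trans h1 (le_trans h2 (ub0 n))).
exists (limn avg_lb) => i.
apply: (@squeeze_cvgr _ _ _ _ avg_lb (fun n => avg_lb n + (1 - delta) ^+ n * (D0 + D0))).
- apply: nearW => n; have := avg_bounds n i.
  by rewrite -(avg_width n) addrC subrK.
- exact: cl.
- rewrite -[X in _ --> X]addr0; apply: cvgD; first exact: cl.
  rewrite -(mul0r (D0 + D0)); apply: cvgMr_tmp; apply: cvg_expr.
  by rewrite ger0_norm ?subr_ge0// ltrBlDr ltrDl.
Qed.

End Averaging.

Definition mx_between (R : numDomainType) d (c C : R) (M : 'M[R]_d) :=
  forall i j, c <= M i j <= C.

(** * Contraction and comparison of rows *)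

Section PositiveMatrices.
Context (R : realType) (d : nat) (i0 : 'I_d) (c C : R).
Hypothesis c0 : 0 < c.

Lemma mx_between_ge0 M (i j : 'I_d) : mx_between c C M -> 0 <= M i j.
Proof. by move=> /(_ i j)/andP[h _]; apply: (le_trans (ltW c0)). Qed.

Lemma mx_between_leC (M : 'M[R]_d) : mx_between c C M -> c <= C.
Proof. by move=> /(_ i0 i0)/andP[]; apply: le_trans. Qed.

Lemma sum_mx_between (M : 'M[R]_d) (v : 'I_d -> R) i : mx_between c C M ->
  (forall l, 0 <= v l) ->
  c * \sum_l v l <= \sum_l M i l * v l <= C * \sum_l v l.
Proof.
move=> bM v0; rewrite !mulr_sumr; apply/andP; split; apply: ler_sum => l _;
  by rewrite ler_wpM2r//; case/andP: (bM i l).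
Qed.

Lemma sum_mx_between_gt0 (M : 'M[R]_d) (v : 'I_d -> R) i : mx_between c C M ->
  (forall l, 0 < v l) -> 0 < \sum_l M i l * v l.
Proof.
move=> bM v0; have vl l : 0 <= v l by exact: ltW.
have /andP[h _] := sum_mx_between i bM vl; apply: lt_le_trans h.
rewrite mulr_gt0// (bigD1 i0)//= ltr_pwDl// sumr_ge0//.
Qed.

Lemma bprod_rowsum_gt0 (B : nat -> 'M[R]_d) n i : (forall k, mx_between c C (B k)) ->
  0 < rowsum (bprod B n) i.
Proof.
move=> hB; elim: n i => [|n IH] i; first by rewrite rowsum1.
by rewrite rowsum_mulmx; apply: sum_mx_between_gt0.
Qed.

Lemma bprod_ge0 (B : nat -> 'M[R]_d) n i j : (forall k, mx_between c C (B k)) ->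
  0 <= bprod B n i j.
Proof.
move=> hB; elim: n i => [|n IH] i; first by rewrite mxE ler0n.
by rewrite mxE sumr_ge0// => l _; rewrite mulr_ge0// mx_between_ge0.
Qed.

(** Multiplying by a new factor on the left replaces the normalised rows by weighted averages of the
    previous ones, with weights bounded below, so all rows converge to a common limit. *)
Lemma bprod_ratio_cvg (B : nat -> 'M[R]_d) j : (forall k, mx_between c C (B k)) ->
  exists l : R, forall i,
    (fun n => bprod B n.+1 i j / rowsum (bprod B n.+1) i) @ \oo --> l.
Proof.
move=> hB; have cC := mx_between_leC (hB 0%N).
have C0 := lt_le_trans c0 cC.
pose s n i := rowsum (bprod B n) i.
have s0 n i : 0 < s n i by exact: bprod_rowsum_gt0.
(* In [W], the entry is at least [c], and [s n.+2 i] is at most [C] times the sum of the [s n.+1 m],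
   each of which is at most [C / c] times [s n.+1 l]. *)
pose delta : R := c / (C * (d%:R * (C / c))).
have d0 : 0 < d%:R :> R by rewrite ltr0n; case: (d) i0 => [[]|].
pose W n i l := B n.+1 i l * s n.+1 l / s n.+2 i.
have sS n i : s n.+1 i = \sum_l B n i l * s n l by rewrite /s /= rowsum_mulmx.
have scomp n i l : s n.+1 i <= C / c * s n.+1 l.
  have sl m : 0 <= s n m by exact: ltW.
  have /andP[_ h2] := sum_mx_between i (hB n) sl.
  have /andP[h1 _] := sum_mx_between l (hB n) sl.
  rewrite !sS (le_trans h2)// -mulrA ler_wpM2l ?(ltW C0)//.
  by rewrite ler_pdivlMl.
apply: (@avg_cvg R 'I_d i0 delta (fun n i => bprod B n.+1 i j / rowsum (bprod B n.+1) i) W).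
- by rewrite !(divr_gt0, mulr_gt0).
- move=> n i l; rewrite /W ler_pdivlMr//.
  have sl m : 0 <= s n.+1 m by exact: ltW.
  have /andP[_ h2] := sum_mx_between i (hB n.+1) sl.
  have h3 : \sum_m s n.+1 m <= d%:R * (C / c) * s n.+1 l.
    rewrite -mulrA; apply: (le_trans (ler_sum _ (fun m _ => scomp n m l))).
    by rewrite sumr_const card_ord -[leLHS]mulr_natl.
  apply: (@le_trans _ _ (c * s n.+1 l)); last first.
    by rewrite ler_wpM2r//; case/andP: (hB n.+1 i l).
  rewrite sS (le_trans (ler_wpM2l _ h2))//; first by rewrite ltW// !(divr_gt0, mulr_gt0).
  rewrite (le_trans (ler_wpM2l _ (ler_wpM2l _ h3)))//; try by rewrite ltW// !(divr_gt0, mulr_gt0).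
  by rewrite le_eqVlt; apply/orP; left; apply/eqP; rewrite /delta; field; rewrite !gt_eqF.
- move=> n i; rewrite /W -mulr_suml -sS divff// gt_eqF//.
- move=> n i; rewrite [bprod B n.+2]/= mxE /W mulr_suml; apply: eq_bigr => l _.
  have := s0 n.+1 l; have := s0 n.+2 i; rewrite /s => a1 a2.
  by rewrite -/(bprod B n.+2); field; rewrite !gt_eqF.
Qed.

Lemma fprod_rowsum_gt0 (B : nat -> 'M[R]_d) a n i : (forall k, mx_between c C (B k)) ->
  0 < rowsum (fprod B a n) i.
Proof.
move=> hB; elim: n a i => [|n IH] a i; first by rewrite rowsum1.
by rewrite rowsum_mulmx; apply: sum_mx_between_gt0.
Qed.

Lemma fprod_ge0 (B : nat -> 'M[R]_d) a n i j : (forall k, mx_between c C (B k)) ->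
  0 <= fprod B a n i j.
Proof.
move=> hB; elim: n a i => [|n IH] a i; first by rewrite mxE ler0n.
by rewrite mxE sumr_ge0// => l _; rewrite mulr_ge0// mx_between_ge0.
Qed.

(** Both rows of the first factor, with entries in [[c, C]], are applied to the same nonnegative
    vector. *)
Lemma fprod_rowsum_comp (B : nat -> 'M[R]_d) a n i j :
  (forall k, mx_between c C (B k)) ->
  rowsum (fprod B a n) i <= C / c * rowsum (fprod B a n) j.
Proof.
move=> hB; have cC := mx_between_leC (hB 0%N).
have C0 := lt_le_trans c0 cC.
case: n => [|n]; first by rewrite !rowsum1 mulr1 ler_pdivlMr// mul1r.
have sl m : 0 <= rowsum (fprod B a.+1 n) m by exact/ltW/fprod_rowsum_gt0.
have /andP[_ h2] := sum_mx_between i (hB a) sl.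
have /andP[h1 _] := sum_mx_between j (hB a) sl.
rewrite /= !rowsum_mulmx (le_trans h2)// -mulrA ler_wpM2l ?(ltW C0)//.
by rewrite ler_pdivlMl.
Qed.

(** Row sums are multiplicative up to the constant [C / c]; this transfers growth from products
    starting at 0 to arbitrary blocks of levels. *)
Lemma fprod_rowsum_split (B : nat -> 'M[R]_d) a n m i j :
  (forall k, mx_between c C (B k)) ->
  c / C * (rowsum (fprod B a n) i * rowsum (fprod B (a + n) m) j)
  <= rowsum (fprod B a (n + m)) i
  <= C / c * (rowsum (fprod B a n) i * rowsum (fprod B (a + n) m) j).
Proof.
move=> hB; have cC := mx_between_leC (hB 0%N).
have C0 := lt_le_trans c0 cC.
rewrite fprodD rowsum_mulmx {1 4}/rowsum !mulr_suml !mulr_sumr.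
apply/andP; split; apply: ler_sum => l _; rewrite [leLHS]mulrCA || rewrite [leRHS]mulrCA;
  rewrite ler_wpM2l ?fprod_ge0//.
  by rewrite -ler_pdivlMl ?divr_gt0// invf_div; exact: fprod_rowsum_comp.
exact: fprod_rowsum_comp.
Qed.

End PositiveMatrices.

(** * Growth of positive matrix cocycles *)

Section Cocycle.
Context (dd : measure_display) (T : measurableType dd) (R : realType).
Context (P : probability T R) (th : T -> T) (d : nat) (i0 : 'I_d).
Hypothesis mth : measurable_fun setT th.
Hypothesis inv : forall A, measurable A -> P (th @^-1` A) = P A.
Hypothesis erg : forall A, measurable A -> th @^-1` A = A -> P A = 0%E \/ P A = 1%E.
Variables (A : int -> T -> 'M[R]_d) (c C : R).
Hypothesis c0 : 0 < c.
Hypothesis mA : forall k i j, measurable_fun setT (fun w => A k w i j).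
Hypothesis A_th : forall k w, A k (th w) = A (k + 1) w.
Hypothesis bA : forall k w, mx_between c C (A k w).

Definition past w (n : nat) := A (- n.+1%:Z) w.
Definition future w (n : nat) := A n%:Z w.

(** The stationary left direction of the cocycle. For the matrices Phi it is mu_0(lambda), by
    [left_dir_mu0]; the reference row [i0] does not matter, by [left_dir_cvg]. *)
Definition left_dir w j : R :=
  limn (fun n => bprod (past w) n.+1 i0 j / rowsum (bprod (past w) n.+1) i0).

Let hpast w k : mx_between c C (past w k). Proof. exact: bA. Qed.
Let hfuture w k : mx_between c C (future w k). Proof. exact: bA. Qed.

Let past_gt0 w n i : 0 < rowsum (bprod (past w) n) i.
Proof. exact: (bprod_rowsum_gt0 i0 c0 n i (hpast w)). Qed.

Let future_gt0 w n i : 0 < rowsum (fprod (future w) 0 n) i.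
Proof. exact: (fprod_rowsum_gt0 i0 c0 0 n i (hfuture w)). Qed.

Let future_comp w n i j :
  rowsum (fprod (future w) 0 n) i <= C / c * rowsum (fprod (future w) 0 n) j.
Proof. exact: (fprod_rowsum_comp i0 c0 0 n i j (hfuture w)). Qed.

Lemma left_dir_cvg w i j :
  (fun n => bprod (past w) n.+1 i j / rowsum (bprod (past w) n.+1) i) @ \oo
    --> left_dir w j.
Proof.
have [l hl] := bprod_ratio_cvg i0 c0 j (hpast w).
by rewrite /left_dir (cvg_lim _ (hl i0)).
Qed.

Lemma left_dir_ge0 w j : 0 <= left_dir w j.
Proof.
rewrite /left_dir; apply: limr_ge; first by apply/cvg_ex; exists (left_dir w j); exact: left_dir_cvg.
apply: nearW => n; apply: divr_ge0; first exact: (bprod_ge0 c0 _ _ _ (hpast w)).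
exact/ltW/past_gt0.
Qed.

Lemma left_dir_sum1 w : \sum_j left_dir w j = 1.
Proof.
have h : (fun n => \sum_j (bprod (past w) n.+1 i0 j / rowsum (bprod (past w) n.+1) i0))
    @ \oo --> \sum_j left_dir w j.
  by apply: cvg_sumr => j; exact: left_dir_cvg.
apply: (cvg_unique _ h); first exact: Rhausdorff.
apply: cvg_near_cst; apply: nearW => n; apply/eqP.
by rewrite -mulr_suml divff// gt_eqF// past_gt0.
Qed.

Lemma left_dir_mean w (v : 'I_d -> R) (a b : R) : (forall i, a <= v i <= b) ->
  a <= \sum_i left_dir w i * v i <= b.
Proof.
move=> h; rewrite -[X in X <= _]mul1r -[X in _ <= _ <= X]mul1r -(left_dir_sum1 w) !mulr_suml.
by apply/andP; split; apply: ler_sum => i _; rewrite ler_wpM2l ?left_dir_ge0//;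
  case/andP: (h i).
Qed.

Let dpos : 0 < d%:R :> R. Proof. by rewrite ltr0n; case: (d) i0 => [[]|]. Qed.

(** The factor by which the mass of the stationary direction grows when level 0 is crossed. *)
Definition growth w : R := \sum_i left_dir w i * rowsum (A 0 w) i.

Lemma growth_between w : d%:R * c <= growth w <= d%:R * C.
Proof.
have h i : d%:R * c <= rowsum (A 0 w) i <= d%:R * C.
  rewrite /rowsum; apply/andP; split; rewrite mulr_natl -[X in _ *+ X]card_ord -sumr_const;
  by apply: ler_sum => j _; case/andP: (bA 0 w i j).
exact: left_dir_mean.
Qed.

Lemma growth_gt0 w : 0 < growth w.
Proof.
by have /andP[h _] := growth_between w; apply: lt_le_trans h; rewrite mulr_gt0.
Qed.

(** Both sides are limits of one sequence, since passing to [th w] appends the factor [A 0 w] to the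
    past products. *)
Lemma left_dir_th w j :
  \sum_i left_dir w i * A 0 w i j = growth w * left_dir (th w) j.
Proof.
have E k : past (th w) k.+1 = past w k.
  by rewrite /past A_th; congr (A _ w); rewrite -[k.+2]addn1 PoszD opprD addrNK.
have E0 : past (th w) 0 = A 0 w by rewrite /past A_th.
pose p n i := bprod (past w) n.+1 i0 i.
pose s n := rowsum (bprod (past w) n.+1) i0.
have s0 n : 0 < s n by exact: past_gt0.
have s0' n : 0 < rowsum (bprod (past (th w)) n.+2) i0 by exact: past_gt0.
have c1 : (fun n => \sum_i p n i / s n * A 0 w i j) @ \oo -->
    \sum_i left_dir w i * A 0 w i j.
  by apply: cvg_sumr => i; apply: cvgMr_tmp; exact: left_dir_cvg.
have c2 : (fun n => (\sum_i p n i / s n * rowsum (A 0 w) i) *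
    (bprod (past (th w)) n.+2 i0 j / rowsum (bprod (past (th w)) n.+2) i0)) @ \oo -->
    growth w * left_dir (th w) j.
  apply: cvgM; first by apply: cvg_sumr => i; apply: cvgMr_tmp; exact: left_dir_cvg.
  have := @left_dir_cvg (th w) i0 j.
  by rewrite -(cvg_shiftS (fun n => bprod (past (th w)) n.+1 i0 j / rowsum (bprod (past (th w)) n.+1) i0)).
apply: (cvg_unique _ c1); first exact: Rhausdorff.
apply: cvg_trans c2; apply: near_eq_cvg; apply: nearW => n.
have e1 : (\sum_i p n i / s n * rowsum (A 0 w) i) =
    rowsum (bprod (past (th w)) n.+2) i0 / s n.
  rewrite (bprodSr _ E) E0 rowsum_mulmx mulr_suml; apply: eq_bigr => i _.
  by rewrite mulrAC.
have e2 : (\sum_i p n i / s n * A 0 w i j) = bprod (past (th w)) n.+2 i0 j / s n.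
  rewrite (bprodSr _ E) E0 mxE mulr_suml; apply: eq_bigr => i _.
  by rewrite mulrAC.
rewrite e1 e2; have := s0 n; have := s0' n => a1 a2.
by field; rewrite !gt_eqF.
Qed.

Lemma future_th w a n : fprod (future (th w)) a n = fprod (future w) a.+1 n.
Proof.
rewrite (@fprod_shift _ _ (future w) _ 1) ?add1n// => k.
by rewrite /future A_th -PoszD addnC.
Qed.

(** Equivariance telescopes. Started from the stationary direction, the growth is exactly
    multiplicative, so its logarithm is a Birkhoff sum. *)
Lemma left_dir_rowsum w n : \sum_i left_dir w i * rowsum (fprod (future w) 0 n) i =
  \prod_(k < n) growth (iter k th w).
Proof.
elim: n w => [|n IH] w.
  rewrite big_ord0; under eq_bigr do rewrite rowsum1 mulr1; exact: left_dir_sum1.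
rewrite big_ord_recl /=.
have -> : \prod_(i < n) growth (th (iter i th w)) = \prod_(i < n) growth (iter i th (th w)).
  by apply: eq_bigr => i _; rewrite -iterS iterSr.
rewrite -IH mulr_sumr.
under eq_bigr do rewrite rowsum_mulmx mulr_sumr.
rewrite exchange_big /=; apply: eq_bigr => l _.
rewrite future_th mulrA -left_dir_th// mulr_suml; apply: eq_bigr => i _.
by rewrite mulrA.
Qed.

Lemma measurable_bprod_past n i j : measurable_fun setT (fun w => bprod (past w) n i j).
Proof.
elim: n i j => [|n IH] i j; first exact: measurable_cst.
under eq_fun do rewrite /= mxE.
by apply: measurable_sum => l; apply: measurable_funM => //; exact: mA.
Qed.

Lemma measurable_left_dir j : measurable_fun setT (left_dir ^~ j).
Proof.
apply: (@measurable_fun_cvg _ _ _ setT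
  (fun n w => bprod (past w) n.+1 i0 j / rowsum (bprod (past w) n.+1) i0)); last first.
  by move=> w _; exact: left_dir_cvg.
move=> n; apply: measurable_funM; first exact: measurable_bprod_past.
have e w : (rowsum (bprod (past w) n.+1) i0)^-1 =
    expR (- ln (rowsum (bprod (past w) n.+1) i0)).
  by rewrite expRN lnK// posrE past_gt0.
under eq_fun do rewrite e.
apply: measurableT_comp; first exact: measurable_expR.
apply: measurable_funN; apply: measurableT_comp; first exact: measurable_ln.
by apply: measurable_sum => l; exact: measurable_bprod_past.
Qed.

Lemma bmeas_ln_growth : bmeas (fun w => ln (growth w)).
Proof.
split.
  apply: measurableT_comp; first exact: measurable_ln.
  apply: measurable_sum => i; apply: measurable_funM; first exact: measurable_left_dir.
  by apply: measurable_sum => j.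
exists (`|ln (d%:R * c)| + `|ln (d%:R * C)|) => w.
have /andP[h1 h2] := growth_between w; have g0 := growth_gt0 w.
have l1 : ln (d%:R * c) <= ln (growth w) by rewrite ler_ln ?posrE// mulr_gt0.
have l2 : ln (growth w) <= ln (d%:R * C).
  by rewrite ler_ln ?posrE// (lt_le_trans g0).
have := ler_norm (ln (d%:R * C)); have := ler_norm (- ln (d%:R * c)).
rewrite normrN; have := normr_ge0 (ln (d%:R * c)); have := normr_ge0 (ln (d%:R * C)).
move: l1 l2; set x := ln _; set y := ln _; set z := ln _.
by move=> *; rewrite ler_norml; apply/andP; split; lra.
Qed.

(* Locked: unification must not look into the integral. *)
Definition lyap : R := locked (\int[P]_w (ln (growth w))).

Lemma lyapE : lyap = \int[P]_w (ln (growth w)).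
Proof. by rewrite /lyap -lock. Qed.

(** The exponential of the Birkhoff sum is a weighted mean of the row sums, and each row sum is
    within the factor [C / c] of every other. *)
Lemma ln_rowsum_birkhoff w n i :
  `|ln (rowsum (fprod (future w) 0 n) i) -
    birkhoff_sum th (fun w => ln (growth w)) n w| <= ln (C / c).
Proof.
have cC : c <= C by exact: (mx_between_leC i0 (bA 0 w)).
have C0 := lt_le_trans c0 cC.
have -> : birkhoff_sum th (fun w => ln (growth w)) n w =
    ln (\prod_(k < n) growth (iter k th w)).
  rewrite /birkhoff_sum; elim: n => [|n IH]; first by rewrite !big_ord0 ln1.
  rewrite !big_ord_recr/= lnM ?IH// posrE ?growth_gt0//.
  by apply: prodr_gt0 => k _; exact: growth_gt0.
rewrite -left_dir_rowsum; set S := \sum_(_ < _) _; set s := rowsum _ i.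
have s0 j : 0 < rowsum (fprod (future w) 0 n) j by exact: future_gt0.
have Cc0 : 0 < C / c by rewrite divr_gt0.
have S0 : 0 < S.
  by rewrite /S left_dir_rowsum; apply: prodr_gt0 => k _; exact: growth_gt0.
have h j : (C / c)^-1 * s <= rowsum (fprod (future w) 0 n) j <= C / c * s.
  by rewrite future_comp andbT ler_pdivrMl// future_comp.
have /andP[] := left_dir_mean w h; rewrite -/S ler_pdivrMl// => h2 h1.
have s1 : 0 < s by exact: s0.
have l1 : ln S <= ln (C / c) + ln s by rewrite -lnM// ler_ln// posrE mulr_gt0.
have l2 : ln s <= ln (C / c) + ln S by rewrite -lnM// ler_ln// posrE mulr_gt0.
by rewrite ler_norml; apply/andP; split; lra.
Qed.

Theorem lyap_asymp : {ae P, forall w, forall e : R, 0 < e -> exists D : R, forall n i,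
  `|ln (rowsum (fprod (future w) 0 n) i) - n%:R * lyap| <= e * n%:R + D}.
Proof.
apply: filterS (birkhoff mth inv erg bmeas_ln_growth) => w H e e0.
have [D HD] := H e e0; exists (ln (C / c) + D) => n i.
have := HD n; have := ln_rowsum_birkhoff w n i; rewrite -lyapE.
set a := ln _; set b := birkhoff_sum _ _ _ _.
have -> : a - n%:R * lyap = (a - b) + (b - n%:R * lyap) by rewrite addrA subrK.
move=> h1 h2; apply: (le_trans (ler_normD _ _)).
by rewrite addrCA lerD.
Qed.

End Cocycle.

(** * First-passage probabilities and truncated generating functions *)

Section Hitting.
Context (R : realType) (d : nat).
Implicit Types (w : env R d) (n x k : int) (m K : nat).

Definition hitM w n m x : 'M[R]_d := \matrix_(i, j) hit w n m x i j.

Lemma hitM0 w n x : hitM w n 0 x = if x == n then 1%:M else 0.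
Proof. by apply/matrixP => i j; rewrite mxE /=; case: eqP => _; rewrite mxE. Qed.

Lemma hitMS w n m x : hitM w n m.+1 x = if x == n then 0 else
  qq w x *m hitM w n m (x - 1) + rr w x *m hitM w n m x + pp w x *m hitM w n m (x + 1).
Proof.
apply/matrixP => i j; rewrite mxE /=; case: eqP => _; rewrite !mxE// -!big_split/=.
by apply: eq_bigr => l _; rewrite !mxE.
Qed.

Lemma hitM_at w n m : hitM w n m n = if m == 0%N then 1%:M else 0.
Proof. by case: m => [|m]; rewrite ?hitM0 ?hitMS eqxx. Qed.

(* The walk is nearest-neighbour, so it has to visit y on its way from x to n. *)
Lemma hitM_markov w m x y n : x <= y -> y <= n ->
  hitM w n m x = \sum_(s < m.+1) hitM w y s x *m hitM w n (m - s) y.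
Proof.
move=> + yn; elim: m x => [|m IH] x xy.
  rewrite big_ord1 subn0 !hitM0; case: (eqVneq x y) => [->|xy'] /=.
    by rewrite mul1mx.
  by rewrite mul0mx; case: eqP => // xn; lia.
rewrite big_ord_recl subn0 hitM0; case: (eqVneq x y) => [->|xy'] /=.
  rewrite mul1mx big1 ?addr0// => s _.
  by rewrite hitM_at/= mul0mx.
rewrite mul0mx add0r hitMS; case: eqP => [xn|_]; first by lia.
rewrite (IH (x - 1)) ?(IH x) ?(IH (x + 1)); try lia.
rewrite !mulmx_sumr -!big_split/=; apply: eq_bigr => s _.
by rewrite hitMS (negPf xy') !mulmxDl !mulmxA subSS.
Qed.

Lemma hit_markov w m x y n i j : x <= y -> y <= n ->
  hit w n m x i j = \sum_(s < m.+1) \sum_(l < d) hit w y s x i l * hit w n (m - s) y l j.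
Proof.
move=> xy yn; have := congr1 (fun M : 'M[R]_d => M i j) (hitM_markov w m xy yn).
rewrite mxE summxE => ->; apply: eq_bigr => s _; rewrite mxE.
by apply: eq_bigr => l _; rewrite !mxE.
Qed.

Definition mgf_trunc K (z : R) w k : 'M[R]_d :=
  \matrix_(i, j) \sum_(m < K.+1) z ^+ m * hit w (k + 1) m k i j.

(** [mgf_trunc] as a polynomial in [z]. Coefficients of products of these matrices are probabilities
    of paths all of whose crossings take at most [K] steps. *)
Definition pgf K w (k : nat) : 'M[{poly R}]_d :=
  \matrix_(i, j) \poly_(m < K.+1) hit w (k%:Z + 1) m k%:Z i j.

Section Positive.
Variables (w : env R d) (hS : forall k, in_Sigma (qq w k) (rr w k) (pp w k)).

Let q0 k i j : 0 <= qq w k i j. Proof. by case: (hS k) => /(_ i j)[]. Qed.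
Let r0 k i j : 0 <= rr w k i j. Proof. by case: (hS k) => /(_ i j)[_ []]. Qed.
Let p0 k i j : 0 <= pp w k i j. Proof. by case: (hS k) => /(_ i j)[_ []]. Qed.

Lemma hit_ge0 n m x i j : 0 <= hit w n m x i j.
Proof.
elim: m x i => [|m IH] x i /=; first by case: eqP => _; rewrite ?ler0n.
case: eqP => // _; apply: sumr_ge0 => l _.
by rewrite !addr_ge0 // mulr_ge0.
Qed.

(** First passages at distinct times are disjoint events; in terms of the recursion, a first-step
    induction in which the three transition rows add up to 1. *)
Lemma hit_sum_le1 n M x i : \sum_(m < M) \sum_(j < d) hit w n m x i j <= 1.
Proof.
elim: M x i => [|M IH] x i; first by rewrite big_ord0.
rewrite big_ord_recl /=; case: (eqVneq x n) => [_|_].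
  rewrite [X in _ + X]big1 ?addr0; last by move=> m _; rewrite big1.
  by rewrite (bigD1 i)//= eqxx big1 ?addr0// => j ji; rewrite eq_sym (negPf ji).
rewrite big1_eq add0r.
have -> : \sum_(m < M) \sum_(j < d) \sum_(l < d)
   (qq w x i l * hit w n m (x - 1) l j + rr w x i l * hit w n m x l j +
    pp w x i l * hit w n m (x + 1) l j) =
  \sum_(l < d) (qq w x i l * \sum_(m < M) \sum_(j < d) hit w n m (x - 1) l j +
    rr w x i l * \sum_(m < M) \sum_(j < d) hit w n m x l j +
    pp w x i l * \sum_(m < M) \sum_(j < d) hit w n m (x + 1) l j).
  under eq_bigr do rewrite exchange_big/=.
  rewrite exchange_big/=; apply: eq_bigr => l _.
  rewrite !mulr_sumr -!big_split/=; apply: eq_bigr => m _.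
  by rewrite !mulr_sumr -!big_split.
rewrite -(proj2 (hS x) i); apply: ler_sum => l _.
by rewrite !lerD// -[leRHS]mulr1 ler_wpM2l.
Qed.

Lemma hit_le1 n m x i j : hit w n m x i j <= 1.
Proof.
have := hit_sum_le1 n m.+1 x i; apply: le_trans.
rewrite (bigD1 (ord_max : 'I_m.+1))//= (bigD1 j)//= -addrA lerDl.
by rewrite addr_ge0// sumr_ge0// => *; rewrite ?sumr_ge0// => *; exact: hit_ge0.
Qed.

Lemma pgf_ge0 K (k : nat) i j m : 0 <= (pgf K w k i j)`_m.
Proof. by rewrite mxE coef_poly; case: ifP => // _; exact: hit_ge0. Qed.

Lemma fprod_pgf_coef_ge0 K (a n : nat) i j m : 0 <= (fprod (pgf K w) a n i j)`_m.
Proof.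
elim: n a i m => [|n IH] a i m /=.
  by rewrite mxE; case: (i == j); rewrite ?mulr1n ?mulr0n ?coef1 ?coef0 ?ler0n.
rewrite mxE coef_sum sumr_ge0// => l _; rewrite coefM sumr_ge0// => s _.
by rewrite mulr_ge0// pgf_ge0.
Qed.

(** Truncation only discards paths, namely those with some crossing longer than [K]. *)
Lemma fprod_pgf_coef_le K (a n : nat) i j m :
  (fprod (pgf K w) a n i j)`_m <= hit w (a%:Z + n%:Z) m a%:Z i j.
Proof.
elim: n a i m => [|n IH] a i m.
  rewrite addr0 /= mxE; case: m => [|m] /=; rewrite eqxx.
    by case: (i == j); rewrite ?mulr1n ?mulr0n ?coef1 ?coef0.
  by case: (i == j); rewrite ?mulr1n ?mulr0n ?coef1 ?coef0.
rewrite /= mxE coef_sum (@hit_markov w m _ (a%:Z + 1)); try lia.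
under eq_bigr do rewrite coefM.
rewrite exchange_big/=; apply: ler_sum => s _; apply: ler_sum => l _.
apply: ler_pM; [exact: pgf_ge0|exact: fprod_pgf_coef_ge0| |].
  by rewrite mxE coef_poly; case: ifP => // _; exact: hit_ge0.
apply: (le_trans (IH _ _ _)); rewrite le_eqVlt; apply/orP; left; apply/eqP.
by congr (hit w _ _ _ _ _); lia.
Qed.

(** If the total time is at most [K], so is every single crossing time, and no path is discarded. *)
Lemma fprod_pgf_coef_eq K (a n : nat) i j m : (m <= K)%N ->
  (fprod (pgf K w) a n i j)`_m = hit w (a%:Z + n%:Z) m a%:Z i j.
Proof.
elim: n a i m => [|n IH] a i m mK.
  rewrite addr0 /= mxE; case: m mK => [|m] mK /=; rewrite eqxx.
    by case: (i == j); rewrite ?mulr1n ?mulr0n ?coef1 ?coef0.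
  by case: (i == j); rewrite ?mulr1n ?mulr0n ?coef1 ?coef0.
rewrite /= mxE coef_sum (@hit_markov w m _ (a%:Z + 1)); try lia.
under eq_bigr do rewrite coefM.
rewrite exchange_big/=; apply: eq_bigr => s _; apply: eq_bigr => l _.
rewrite IH; last by rewrite (leq_trans (leq_subr _ _)).
rewrite mxE coef_poly ltnS (leq_trans _ mK); last by rewrite -ltnS.
by congr (_ * hit w _ _ _ _ _); lia.
Qed.

Lemma horner_fprod_pgf K (a n : nat) i j (z : R) :
  (fprod (pgf K w) a n i j).[z] = fprod (fun k : nat => mgf_trunc K z w k%:Z) a n i j.
Proof.
elim: n a i => [|n IH] a i /=.
  by rewrite !mxE; case: (i == j); rewrite ?mulr1n ?mulr0n ?hornerC.
rewrite !mxE horner_sum; apply: eq_bigr => l _; rewrite hornerM IH !mxE.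
by rewrite horner_poly; congr (_ * _); apply: eq_bigr => m _; rewrite mulrC.
Qed.

End Positive.
End Hitting.

(** * Consequences of uniform ellipticity *)

Section Substochastic.
Context (R : realType) (d : nat) (i0 : 'I_d) (r : 'M[R]_d) (delta : R).
Hypothesis delta0 : 0 < delta.
Hypothesis r0 : forall i j, 0 <= r i j.
Hypothesis r1 : forall i, \sum_j r i j <= 1 - delta.

(* Evaluate the inequality at an index where v is minimal. *)
Lemma minimum_principle (v : 'I_d -> R) :
  (forall i, \sum_j r i j * v j <= v i) -> forall i, 0 <= v i.
Proof.
move=> hv i; pose m := [arg min_(k < i0) v k]%O.
have hm k : v m <= v k by rewrite /m; case: arg_minP => // a _; exact.
apply: (le_trans _ (hm i)); rewrite leNgt; apply/negP => m0.
have h1 : v m * \sum_j r m j <= v m.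
  apply: le_trans (hv m); rewrite mulr_sumr; apply: ler_sum => j _.
  by rewrite mulrC ler_wpM2l.
have h2 : v m * (1 - delta) <= v m * \sum_j r m j by rewrite ler_wnM2l// ltW.
have := le_trans h2 h1; rewrite mulrBr mulr1 gerDl oppr_le0.
by rewrite nmulr_rge0// leNgt delta0.
Qed.

(** For a kernel vector [v], the minimum principle applies to both [v] and [- v], so [v = 0]. *)
Lemma substochastic_unit : 1%:M - r \in unitmx.
Proof.
rewrite unitmxE unitfE; apply/negP => /eqP det0.
have : \det (1%:M - r)^T == 0 by rewrite det_tr det0.
move=> /det0P[v v0 hv].
have e i : v 0 i = \sum_j r i j * v 0 j.
  have := congr1 (fun M : 'rV[R]_d => M 0 i) hv.
  rewrite !mxE; under eq_bigr do rewrite !mxE mulrBr.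
  rewrite sumrB (bigD1 i)//= eqxx mulr1 big1 ?addr0; last first.
    by move=> j ji; rewrite eq_sym (negPf ji) mulr0.
  by move=> /eqP; rewrite subr_eq0 => /eqP ->; apply: eq_bigr => j _; rewrite mulrC.
have p1 := @minimum_principle (fun i => v 0 i) _.
have p2 := @minimum_principle (fun i => - v 0 i) _.
move/eqP: v0; apply; apply/rowP => i; rewrite [RHS]mxE.
apply/eqP; rewrite eq_le p1 ?andbT; last by move=> k; rewrite -e.
rewrite -oppr_ge0 p2// => k; under eq_bigr do rewrite mulrN.
by rewrite sumrN -e.
Qed.

Lemma substochastic_solve_ge0 (X : 'M[R]_d) :
  (forall i j, 0 <= ((1%:M - r) *m X) i j) -> forall i j, 0 <= X i j.
Proof.
move=> h i j; apply: (@minimum_principle (fun i => X i j)) => k.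
by have := h k j; rewrite mulmxBl mul1mx !mxE subr_ge0.
Qed.

End Substochastic.

Section Omega.
Context (R : realType) (d : nat) (i0 : 'I_d) (kappa : R) (w : env R d).
Implicit Types (z : R) (k : int) (K : nat) (i j : 'I_d).
Hypothesis kappa0 : 0 < kappa.
Hypothesis hw : Omega_kappa kappa w.

Lemma Omega_Sigma k : in_Sigma (qq w k) (rr w k) (pp w k).
Proof. by case: (hw k). Qed.

Local Notation hit_ge0 := (hit_ge0 Omega_Sigma).

Let q0 k i j : 0 <= qq w k i j. Proof. by case: (Omega_Sigma k) => /(_ i j)[]. Qed.
Let r0 k i j : 0 <= rr w k i j. Proof. by case: (Omega_Sigma k) => /(_ i j)[_ []]. Qed.
Let p0 k i j : 0 <= pp w k i j. Proof. by case: (Omega_Sigma k) => /(_ i j)[_ []]. Qed.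

Lemma Omega_sum k i :
  \sum_j qq w k i j + \sum_j rr w k i j + \sum_j pp w k i j = 1.
Proof. by rewrite -!big_split/=; case: (Omega_Sigma k) => _. Qed.

Lemma Omega_pp k i : kappa <= \sum_j pp w k i j.
Proof. by case: (hw k) => _ [/(_ i)[]]. Qed.

Lemma Omega_rr k i : \sum_j rr w k i j <= 1 - (kappa + kappa).
Proof.
have := Omega_sum k i; case: (hw k) => _ [/(_ i)[]] + + _; lra.
Qed.

Lemma kappa_half : kappa + kappa <= 1.
Proof.
have := Omega_rr 0 i0.
have : 0 <= \sum_j rr w 0 i0 j by apply: sumr_ge0.
lra.
Qed.

Let kk0 : 0 < kappa + kappa. Proof. by rewrite addr_gt0. Qed.

Lemma mgf_trunc0 z k i j : mgf_trunc 0 z w k i j = 0.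
Proof.
rewrite mxE big_ord1 expr0 mul1r /=; case: eqP => // e.
by exfalso; lia.
Qed.

(** First-step decomposition. After a step down two levels remain to be climbed, so the last sum is
    not the generating function of a single crossing. *)
Lemma mgf_truncS K z k i j : mgf_trunc K.+1 z w k i j =
  z * (pp w k i j + \sum_l rr w k i l * mgf_trunc K z w k l j +
    \sum_l qq w k i l * \sum_(m < K.+1) z ^+ m * hit w (k + 1) m (k - 1) l j).
Proof.
have kn : (k == k + 1) = false by apply/eqP; lia.
rewrite mxE big_ord_recl /= kn mulr0 add0r.
have step m : z ^+ (bump 0 m) * (\sum_(l < d) (qq w k i l * hit w (k + 1) m (k - 1) l j +
     rr w k i l * hit w (k + 1) m k l j +
     pp w k i l * hit w (k + 1) m (k + 1) l j)) =
  z * (\sum_l pp w k i l * (z ^+ m * hit w (k + 1) m (k + 1) l j) +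
     \sum_l rr w k i l * (z ^+ m * hit w (k + 1) m k l j) +
     \sum_l qq w k i l * (z ^+ m * hit w (k + 1) m (k - 1) l j)).
  rewrite /bump leq0n add1n exprS -mulrA; congr (_ * _).
  rewrite -!big_split/= mulr_sumr; apply: eq_bigr => l _; ring.
under eq_bigr do rewrite step.
rewrite -mulr_sumr !big_split/=; congr (_ * (_ + _ + _)).
- rewrite exchange_big/= (bigD1 j)//= [X in _ + X]big1 ?addr0; last first.
    move=> l lj; rewrite -mulr_sumr big_ord_recl/= eqxx (negPf lj) mulr0 add0r.
    by rewrite big1 ?mulr0// => m _; rewrite mulr0.
  rewrite -mulr_sumr big_ord_recl/= !eqxx expr0 mul1r big1 ?addr0 ?mulr1// => m _.
  by rewrite mulr0.
- by rewrite exchange_big/=; apply: eq_bigr => l _; rewrite [mgf_trunc _ _ _ _ _ _]mxE mulr_sumr.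
- by rewrite exchange_big/=; apply: eq_bigr => l _; rewrite mulr_sumr.
Qed.

Lemma mgf_trunc_ge0 K z k i j : 0 <= z -> 0 <= mgf_trunc K z w k i j.
Proof.
by move=> z0; rewrite mxE sumr_ge0// => m _; rewrite mulr_ge0 ?exprn_ge0// hit_ge0.
Qed.

Lemma mgf_trunc_leK K K' z k i j : 0 <= z -> (K <= K')%N ->
  mgf_trunc K z w k i j <= mgf_trunc K' z w k i j.
Proof.
move=> z0 /subnKC <-; elim: (K' - K)%N => [|n IH]; first by rewrite addn0.
apply: (le_trans IH); rewrite !mxE addnS [leRHS]big_ord_recr lerDl.
by apply: mulr_ge0; [rewrite exprn_ge0|exact: hit_ge0].
Qed.

Lemma mgf_trunc_lez K z z' k i j : 0 <= z -> z <= z' ->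
  mgf_trunc K z w k i j <= mgf_trunc K z' w k i j.
Proof.
move=> z0 zz'; rewrite !mxE; apply: ler_sum => m _.
by rewrite ler_wpM2r ?hit_ge0// lerXn2r// nnegrE// (le_trans z0).
Qed.

Lemma mgf_truncS_ge K z k i j : 0 <= z ->
  z * (pp w k i j + \sum_l rr w k i l * mgf_trunc K z w k l j) <= mgf_trunc K.+1 z w k i j.
Proof.
move=> z0; rewrite mgf_truncS ler_wpM2l// lerDl sumr_ge0// => l _.
by rewrite mulr_ge0// sumr_ge0// => m _; rewrite mulr_ge0 ?exprn_ge0// hit_ge0.
Qed.

Lemma mgf_trunc_rowsum_ge K z k i : 0 <= z -> z * kappa <= rowsum (mgf_trunc K.+1 z w k) i.
Proof.
move=> z0; apply: (@le_trans _ _ (\sum_j z * pp w k i j)).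
  by rewrite -mulr_sumr ler_wpM2l// Omega_pp.
apply: ler_sum => j _; apply: le_trans (mgf_truncS_ge _ _ _ _ z0).
rewrite ler_wpM2l// lerDl sumr_ge0// => l _.
by rewrite mulr_ge0// mgf_trunc_ge0.
Qed.

(** [Z] is the probability that the walk, when it first leaves level [k], goes up and lands at the
    given height; ellipticity makes it at least [kappa]. Truncation loses only paths that stay on
    the level for a long time, and each stay costs a factor at most [1 - 2 kappa]. *)
Lemma mgf_trunc1_ge K k i j : kappa - (1 - (kappa + kappa)) ^+ K <= mgf_trunc K 1 w k i j.
Proof.
pose Z := invmx (1%:M - rr w k) *m pp w k.
have hZ : (1%:M - rr w k) *m Z = pp w k by rewrite /Z mulKVmx// (substochastic_unit i0 kk0 (r0 k) (Omega_rr k)).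
have Zk a b : kappa <= Z a b by case: (hw k) => _ [_ /(_ a b)[]].
have Zeq a b : Z a b = pp w k a b + \sum_l rr w k a l * Z l b.
  have := congr1 (fun M : 'M[R]_d => M a b) hZ.
  rewrite mulmxBl mul1mx => <-; rewrite [X in X + _]mxE [X in _ + X + _]mxE.
  by rewrite [X in _ - X]mxE subrK.
have Z1 a b : Z a b <= 1.
  rewrite -subr_ge0; move: a; apply: (minimum_principle i0 kk0 (r0 k) (Omega_rr k)) => a.
  under eq_bigr do rewrite mulrBr mulr1.
  rewrite sumrB (Zeq a b) -[X in _ <= X - _](Omega_sum k a).
  have : pp w k a b <= \sum_j pp w k a j by rewrite (bigD1 b)//= lerDl sumr_ge0.
  have : 0 <= \sum_j qq w k a j by exact: sumr_ge0.
  lra.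
suff h a : Z a j - mgf_trunc K 1 w k a j <= (1 - (kappa + kappa)) ^+ K.
  by have := h i; have := Zk i j; lra.
elim: K a => [|K IH] a; first by rewrite mgf_trunc0 subr0 expr0.
have := @mgf_truncS_ge K 1 k a j ler01; rewrite mul1r Zeq => h.
have kk1 : 0 <= 1 - (kappa + kappa) by rewrite subr_ge0 kappa_half.
have : \sum_l rr w k a l * Z l j - \sum_l rr w k a l * mgf_trunc K 1 w k l j
    <= (1 - (kappa + kappa)) ^+ K.+1.
  rewrite -sumrB exprS; apply: (@le_trans _ _ (\sum_l rr w k a l * (1 - (kappa + kappa)) ^+ K)).
    by apply: ler_sum => l _; rewrite -mulrBr ler_wpM2l.
  by rewrite -mulr_suml ler_wpM2r ?exprn_ge0// Omega_rr.
lra.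
Qed.

(** By time [K0] half of the mass [kappa] has been collected, and each weight [z ^+ m] with
    [m <= K0] is at least [min 1 (z ^+ K0)]. The bound does not depend on [K]. *)
Lemma mgf_trunc_ge K0 K z k i j : (1 - (kappa + kappa)) ^+ K0 <= kappa / 2 ->
  (K0 <= K)%N -> 0 <= z -> kappa / 2 * Num.min 1 (z ^+ K0) <= mgf_trunc K z w k i j.
Proof.
move=> hK0 K0K z0; apply: le_trans (mgf_trunc_leK k i j z0 K0K).
apply: (@le_trans _ _ (mgf_trunc K0 1 w k i j * Num.min 1 (z ^+ K0))).
  rewrite ler_wpM2r ?le_min ?ler01 ?exprn_ge0//.
  by have := mgf_trunc1_ge K0 k i j; lra.
rewrite !mxE mulr_suml; apply: ler_sum => m _.
rewrite expr1n mul1r mulrC ler_wpM2r ?hit_ge0//.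
case: (leP 1 z) => z1.
  by rewrite ge_min exprn_ege1.
rewrite ge_min; apply/orP; right.
have mK : (m <= K0)%N by rewrite -ltnS.
have -> : z ^+ K0 = z ^+ m * z ^+ (K0 - m) by rewrite -exprD subnKC.
by rewrite ler_piMr ?exprn_ge0// exprn_ile1// ltW.
Qed.

Lemma mgf_trunc_le K z k i j : 0 <= z ->
  mgf_trunc K z w k i j <= \sum_(m < K.+1) z ^+ m.
Proof.
move=> z0; rewrite mxE; apply: ler_sum => m _.
by rewrite ler_piMr ?exprn_ge0// (hit_le1 Omega_Sigma).
Qed.

Lemma mgf_trunc_le1 K z k i j : 0 <= z -> z <= 1 -> mgf_trunc K z w k i j <= 1.
Proof.
move=> z0 z1; apply: le_trans (hit_sum_le1 Omega_Sigma (k + 1) K.+1 k i).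
rewrite mxE; apply: ler_sum => m _.
apply: (@le_trans _ _ (hit w (k + 1) m k i j)).
  by rewrite ler_piMl ?hit_ge0// exprn_ile1.
by rewrite (bigD1 j)//= lerDl sumr_ge0// => l _; exact: hit_ge0.
Qed.

(** Two crossings of at most [K] steps each form a climb of two levels of at most [K + K] steps; the
    proof compares polynomial coefficients through the Markov property. *)
Lemma mgf_trunc_two_steps K z k i j : 0 <= z ->
  \sum_l mgf_trunc K z w (k - 1) i l * mgf_trunc K z w k l j <=
  \sum_(m < (K + K).+1) z ^+ m * hit w (k + 1) m (k - 1) i j.
Proof.
move=> z0.
pose p l : {poly R} := \poly_(m < K.+1) hit w (k - 1 + 1) m (k - 1) i l.
pose q l : {poly R} := \poly_(m < K.+1) hit w (k + 1) m k l j.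
have -> : \sum_l mgf_trunc K z w (k - 1) i l * mgf_trunc K z w k l j =
    (\sum_l p l * q l).[z].
  rewrite horner_sum; apply: eq_bigr => l _; rewrite hornerM !horner_poly !mxE.
  by congr (_ * _); apply: eq_bigr => m _; rewrite mulrC.
rewrite (@horner_coef_wide _ (K + K).+1); last first.
  apply: (leq_trans (size_sum _ _ _)); apply/bigmax_leqP => l _.
  apply: (leq_trans (size_mul_leq _ _)).
  have h1 : (size (p l) <= K.+1)%N by rewrite size_poly.
  have h2 : (size (q l) <= K.+1)%N by rewrite size_poly.
  rewrite -subn1 leq_subLR.
  have -> : (1 + (K + K).+1 = K.+1 + K.+1)%N by lia.
  exact: leq_add.
apply: ler_sum => m _; rewrite mulrC ler_wpM2l ?exprn_ge0//.
rewrite (@hit_markov _ _ _ _ _ (k - 1 + 1)); try lia.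
rewrite coef_sum; under eq_bigr do rewrite coefM.
rewrite exchange_big/=; apply: ler_sum => s _; apply: ler_sum => l _.
rewrite !coef_poly; apply: ler_pM; try by [case: ifP => // _; exact: hit_ge0].
rewrite (_ : k - 1 + 1 = k); last by lia.
by case: ifP => // _; exact: hit_ge0.
Qed.

(** Climbing back and then up takes at most [K + K] steps after the first one, and [1 <= z] allows
    the weight of the first step to be dropped. *)
Lemma mgf_trunc_renewal K z k i j : 1 <= z ->
  pp w k i j + \sum_l rr w k i l * mgf_trunc K z w k l j +
   \sum_l qq w k i l * \sum_l' mgf_trunc K z w (k - 1) l l' * mgf_trunc K z w k l' j
  <= mgf_trunc (K + K).+1 z w k i j.
Proof.
move=> z1; have z0 : 0 <= z by exact: le_trans z1.
rewrite mgf_truncS; apply: (@le_trans _ _ (1 * (pp w k i j + \sum_l rr w k i l * mgf_trunc (K + K) z w k l j +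
   \sum_l qq w k i l * \sum_l' mgf_trunc K z w (k - 1) l l' * mgf_trunc K z w k l' j))).
  rewrite mul1r lerD// lerD//; apply: ler_sum => l _; rewrite ler_wpM2l//.
  by apply: mgf_trunc_leK => //; rewrite leq_addr.
apply: ler_pM => //.
  rewrite !addr_ge0 ?sumr_ge0// => l _; rewrite mulr_ge0 ?mgf_trunc_ge0//.
  by rewrite sumr_ge0// => l' _; rewrite mulr_ge0 ?mgf_trunc_ge0.
rewrite lerD//; apply: ler_sum => l _; rewrite ler_wpM2l//.
exact: mgf_trunc_two_steps.
Qed.

End Omega.

(** * Measurability *)

Section LimMeasurable.
Context (dd : measure_display) (T : measurableType dd) (R : realType).

Lemma cvg_limn_esup_einf (u : nat -> \bar R) : limn_esup u = limn_einf u ->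
  u @ \oo --> limn_esup u.
Proof.
move=> e; apply: (@squeeze_cvge _ _ _ _ (einfs u) _ (esups u)).
- apply: nearW => n; apply/andP; split.
    by apply: ereal_inf_lbound; exists n => /=.
  by apply: ereal_sup_ubound; exists n => /=.
- by rewrite e limn_einf_lim; exact: is_cvg_einfs.
- by rewrite limn_esup_lim; exact: is_cvg_esups.
Qed.

(** [limn] returns the default [point] where the sequence diverges. Raw environments may have
    arbitrary entries, so measurability has to cover those points too: split according to whether
    limsup and liminf agree. *)
Lemma measurable_limn_ereal (u : nat -> T -> \bar R) :
  (forall n, measurable_fun setT (u n)) ->
  measurable_fun setT (fun x => limn (u ^~ x)).
Proof.
move=> mu; have E x : limn (u ^~ x) =
    if limn_esup (u ^~ x) == limn_einf (u ^~ x) then limn_esup (u ^~ x) else point.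
  case: eqP => [e|ne]; first by apply/cvg_lim => //; exact: cvg_limn_esup_einf.
  by apply: dvgP => /cvg_ex[l /cvg_limn_einf_sup[e1 e2]]; apply: ne; rewrite e1 e2.
under eq_fun do rewrite E.
apply: measurable_fun_ifT; [|exact: measurable_fun_limn_esup|exact: measurable_cst].
apply: measurable_fun_eqe; first exact: measurable_fun_limn_esup.
under eq_fun do rewrite /limn_einf.
apply: measurableT_comp => //; apply: measurable_fun_limn_esup => n.
exact: measurableT_comp.
Qed.

Lemma measurable_limn_real (u : nat -> T -> R) :
  (forall n, measurable_fun setT (u n)) ->
  measurable_fun setT (fun x => limn (u ^~ x)).
Proof.
move=> mu; pose v n x := (u n x)%:E; have E x : limn (u ^~ x) =
    if (limn_esup (v ^~ x) == limn_einf (v ^~ x)) && (limn_esup (v ^~ x) \is a fin_num)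
    then fine (limn_esup (v ^~ x)) else point.
  case: ifP => [/andP[/eqP e fn]|ne].
    apply/cvg_lim => //; have := cvg_limn_esup_einf e.
    by rewrite -{1}(fineK fn) => /fine_cvg.
  apply: dvgP => /cvg_ex[l hl]; move/negP: ne; apply.
  have : v ^~ x @ \oo --> l%:E by exact: cvg_EFin_tmp hl || (apply: cvg_EFin => //; exact: nearW).
  by move=> /cvg_limn_einf_sup[-> ->]; rewrite eqxx.
have mv n : measurable_fun setT (v n) by exact/measurable_EFinP.
have ms : measurable_fun setT (fun x => limn_esup (v ^~ x)) by exact: measurable_fun_limn_esup.
under eq_fun do rewrite E.
apply: measurable_fun_ifT; [|exact: measurableT_comp|exact: measurable_cst].
apply: measurable_and.
  apply: measurable_fun_eqe => //.
  under eq_fun do rewrite /limn_einf.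
  apply: measurableT_comp => //; apply: measurable_fun_limn_esup => n.
  exact: measurableT_comp.
apply: (measurable_fun_bool true).
have -> : (fun x => limn_esup (v ^~ x) \is a fin_num) @^-1` [set true] =
    [set x | limn_esup (v ^~ x) \is a fin_num] by apply/seteqP; split => x.
exact: emeasurable_fin_num.
Qed.

End LimMeasurable.

Section EnvMeasurable.
Context (R : realType) (d : nat).
Implicit Types (w : env R d).

Lemma measurable_coord k c (i j : 'I_d) : measurable_fun setT (fun w : env R d => w k c i j).
Proof.
move=> _ B mB; rewrite setTI; apply: sub_sigma_algebra.
by exists k, c, i, j, B.
Qed.

Lemma measurable_shift : measurable_fun setT (@Defs.shift R d).
Proof.
apply: (@measurability _ _ (env R d) (env R d) setT (@Defs.shift R d) (@env_cyl R d)) => //.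
move=> _ [_ [k [c [i [j [B [mB ->]]]]]] <-]; rewrite setTI.
have := @measurable_coord (k + 1) c i j measurableT B mB; by rewrite setTI.
Qed.

Lemma measurable_hit n m x i j : measurable_fun setT (fun w : env R d => hit w n m x i j).
Proof.
elim: m x i => [|m IH] x i /=; case: eqP => _; try exact: measurable_cst.
apply: measurable_sum => l; repeat apply: measurable_funD; apply: measurable_funM => //;
  by under eq_fun do rewrite mxE; exact: measurable_coord.
Qed.

Lemma measurable_mgf_trunc K z k i j :
  measurable_fun setT (fun w : env R d => mgf_trunc K z w k i j).
Proof.
under eq_fun do rewrite mxE; apply: measurable_sum => m.
by apply: measurable_funM; [exact: measurable_cst|exact: measurable_hit].
Qed.

Lemma PhiE w lam k i j : Phi w lam k i j =
  limn (fun n => (\sum_(m < n) expR lam ^+ m * hit w (k + 1) m k i j)%:E).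
Proof.
apply: (congr1 (fun u : nat -> \bar R => limn u)); apply/funext => n.
rewrite big_mkord sumEFin; congr EFin; apply: eq_bigr => m _.
by rewrite expRM_natr.
Qed.

Lemma measurable_Phi lam k i j : measurable_fun setT (fun w : env R d => Phi w lam k i j).
Proof.
under eq_fun do rewrite PhiE; apply: measurable_limn_ereal => n.
apply/measurable_EFinP; apply: measurable_sum => m.
by apply: measurable_funM; [exact: measurable_cst|exact: measurable_hit].
Qed.

Lemma measurable_det n (A : env R d -> 'M[R]_n) :
  (forall i j, measurable_fun setT (fun w => A w i j)) ->
  measurable_fun setT (fun w => \det (A w)).
Proof.
move=> mA; rewrite /determinant; apply: measurable_sum => s.
apply: measurable_funM; first exact: measurable_cst.
by apply: measurable_prod => i _.
Qed.

(** Where [f] is nonzero the inverse is expressed by [expR] and [ln] on each sign; where it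
    vanishes, the convention is [0^-1 = 0]. *)
Lemma measurable_inv (f : env R d -> R) : measurable_fun setT f ->
  measurable_fun setT (fun w => (f w)^-1).
Proof.
move=> mf; have E w : (f w)^-1 = if 0 < f w then expR (- ln (f w)) else
    if 0 < - f w then - expR (- ln (- f w)) else 0.
  case: ltrP => [f0|f0]; first by rewrite expRN lnK// posrE.
  case: ltrP => [f1|f1]; first by rewrite expRN lnK// ?posrE// invrN opprK.
  have -> : f w = 0 by apply/eqP; rewrite eq_le f0 -oppr_le0 f1.
  by rewrite invr0.
under eq_fun do rewrite E.
have mexp g : measurable_fun setT g -> measurable_fun setT (fun w : env R d => expR (- ln (g w) : R)).
  move=> mg; apply: measurableT_comp; first exact: measurable_expR.
  by apply: measurable_funN; apply: measurableT_comp => //; exact: measurable_ln.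
apply: measurable_fun_ifT; [exact: measurable_fun_ltr|exact: mexp|].
apply: measurable_fun_ifT; last exact: measurable_cst.
  by apply: measurable_fun_ltr => //; exact: measurable_funN.
by apply: measurable_funN; apply: mexp; exact: measurable_funN.
Qed.

(** Cofactor formula where the determinant is nonzero; elsewhere [invmx] returns its argument. *)
Lemma measurable_invmx n (A : env R d -> 'M[R]_n) i j :
  (forall i j, measurable_fun setT (fun w => A w i j)) ->
  measurable_fun setT (fun w => invmx (A w) i j).
Proof.
move=> mA; have E w : invmx (A w) i j = if \det (A w) == 0 then A w i j else
    (\det (A w))^-1 * ((-1) ^+ (j + i) * \det (row' j (col' i (A w)))).
  rewrite /invmx unitmxE unitfE; case: eqP => //= _.
  by rewrite !mxE.
under eq_fun do rewrite E.
apply: measurable_fun_ifT => //.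
  by apply: measurable_fun_eqr; [exact: measurable_det|exact: measurable_cst].
apply: measurable_funM; first by apply: measurable_inv; exact: measurable_det.
apply: measurable_funM; first exact: measurable_cst.
apply: measurable_det => a b; under eq_fun do rewrite !mxE; exact: mA.
Qed.

Lemma measurable_invmx_mul k c c' i j : measurable_fun setT (fun w : env R d =>
  (invmx (1%:M - \matrix_(i, j) w k c i j) *m (\matrix_(i, j) w k c' i j)) i j).
Proof.
under eq_fun do rewrite mxE; apply: measurable_sum => l; apply: measurable_funM.
  apply: measurable_invmx => a b; under eq_fun do rewrite !mxE.
  by apply: measurable_funB; [exact: measurable_cst|exact: measurable_coord].
by under eq_fun do rewrite mxE; exact: measurable_coord.
Qed.

Lemma measurable_setall (I : countType) (A : I -> set (env R d)) :
  (forall i, measurable (A i)) -> measurable [set w | forall i, A i w].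
Proof.
move=> mA; rewrite (_ : [set w | _] = \bigcap_n
    (if unpickle n is Some i then A i else setT)); last first.
  apply/seteqP; split => w h.
    by move=> n _; case: (unpickle n).
  by move=> i; have := h (pickle i) Logic.I; rewrite pickleK.
by apply: bigcapT_measurable => n; case: (unpickle n).
Qed.

Lemma measurable_le_set (f g : env R d -> R) : measurable_fun setT f ->
  measurable_fun setT g -> measurable [set w | f w <= g w].
Proof.
move=> mf mg; have := @measurable_fun_ler _ _ _ setT f g mf mg measurableT [set true].
rewrite setTI; move=> /(_ _); have -> : [set w | f w <= g w] = (fun w => f w <= g w) @^-1` [set true].
  by apply/seteqP; split => w.
by apply.
Qed.

Lemma measurable_eq_set (f g : env R d -> R) : measurable_fun setT f ->
  measurable_fun setT g -> measurable [set w | f w = g w].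
Proof.
move=> mf mg; rewrite (_ : [set w | _] = [set w | f w <= g w] `&` [set w | g w <= f w]).
  by apply: measurableI; exact: measurable_le_set.
apply/seteqP; split => w /=; first by move=> ->.
by move=> [h1 h2]; apply/eqP; rewrite eq_le h1.
Qed.

Lemma measurable_Omega_kappa kappa : measurable (Omega_kappa kappa : set (env R d)).
Proof.
have mq k c i j : measurable_fun setT (fun w : env R d =>
    (\matrix_(i, j) w k c i j : 'M[R]_d) i j).
  by under eq_fun do rewrite mxE; exact: measurable_coord.
apply: measurable_setall => k; apply: measurableI; first apply: measurableI.
- apply: measurable_setall => i; apply: measurable_setall => j.
  by apply: measurableI; last apply: measurableI;
    apply: measurable_le_set => //; exact: mq.
- apply: measurable_setall => i; apply: measurable_eq_set => //.
  by apply: measurable_sum => j; repeat apply: measurable_funD; exact: mq.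
apply: measurableI.
- apply: measurable_setall => i; apply: measurableI;
  by apply: measurable_le_set => //; apply: measurable_sum => j; exact: mq.
- apply: measurable_setall => i; apply: measurable_setall => j; apply: measurableI;
  by apply: measurable_le_set => //; exact: measurable_invmx_mul.
Qed.

End EnvMeasurable.

(** * The moment generating matrices *)

Section PhiOmega.
Context (R : realType) (d : nat) (i0 : 'I_d) (kappa : R) (w : env R d).
Hypothesis kappa0 : 0 < kappa.
Hypothesis hw : Omega_kappa kappa w.

Let hS := Omega_Sigma hw.

Let PhiT lam k (i j : 'I_d) (n : nat) : \bar R :=
  (\sum_(m < n) expR lam ^+ m * hit w (k + 1) m k i j)%:E.

Let PhiT_mono lam k i j : {homo PhiT lam k i j : n m / (n <= m)%N >-> (n <= m)%E}.
Proof.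
move=> n m /subnKC <-; elim: (m - n)%N => [|a IH]; first by rewrite addn0.
apply: (le_trans IH); rewrite /PhiT lee_fin addnS [leRHS]big_ord_recr lerDl.
by apply: mulr_ge0; [rewrite exprn_ge0// expR_ge0|exact: (hit_ge0 hS)].
Qed.

Let PhiT_cvg lam k i j : PhiT lam k i j @ \oo --> Phi w lam k i j.
Proof.
have h := ereal_nondecreasing_cvgn (@PhiT_mono lam k i j).
by rewrite PhiE; move/cvg_lim: (h) => /(_ (@ereal_hausdorff _)) ->.
Qed.

Lemma mgf_trunc_le_Phi K lam k i j : ((mgf_trunc K (expR lam) w k i j)%:E <= Phi w lam k i j)%E.
Proof.
have h := ereal_nondecreasing_cvgn (@PhiT_mono lam k i j).
rewrite (cvg_unique (@ereal_hausdorff _) (@PhiT_cvg lam k i j) h).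
by apply: ereal_sup_ubound; exists K.+1 => //; rewrite /PhiT mxE.
Qed.

Lemma Phi_le lam k i j (C : R) : (forall K, mgf_trunc K (expR lam) w k i j <= C) ->
  (Phi w lam k i j <= C%:E)%E.
Proof.
move=> hC; have h := ereal_nondecreasing_cvgn (@PhiT_mono lam k i j).
rewrite (cvg_unique (@ereal_hausdorff _) (@PhiT_cvg lam k i j) h).
apply: ge_ereal_sup => _ [n _ <-].
apply: (@le_trans _ _ (PhiT lam k i j n.+1)); first by apply: PhiT_mono.
by have := hC n; rewrite /PhiT lee_fin mxE.
Qed.

Lemma Phi_ge0 lam k i j : (0 <= Phi w lam k i j)%E.
Proof.
apply: le_trans (mgf_trunc_le_Phi 0 lam k i j).
by rewrite lee_fin (mgf_trunc_ge0 hw)// expR_ge0.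
Qed.

Lemma Phi_fin lam k i j : (Phi w lam k i j < +oo)%E -> (fine (Phi w lam k i j))%:E = Phi w lam k i j.
Proof. by move=> h; rewrite fineK// ge0_fin_numE// Phi_ge0. Qed.

Lemma mgf_trunc_cvg lam k i j : (Phi w lam k i j < +oo)%E ->
  (fun K => mgf_trunc K (expR lam) w k i j) @ \oo --> fine (Phi w lam k i j).
Proof.
move=> h; have := @PhiT_cvg lam k i j; rewrite -(Phi_fin h) => /fine_cvg.
rewrite -(cvg_shiftS (fine \o PhiT lam k i j)) /=.
by apply: cvg_trans; apply: near_eq_cvg; apply: nearW => n /=; rewrite mxE.
Qed.

Lemma mgf_trunc_le_fine K lam k i j : (Phi w lam k i j < +oo)%E ->
  mgf_trunc K (expR lam) w k i j <= fine (Phi w lam k i j).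
Proof. by move=> h; rewrite -lee_fin Phi_fin// mgf_trunc_le_Phi. Qed.

(* The walk started at level k may first step down to k - 1, then come back up to k,
   and only then go on to k + 1. *)
Lemma Phi_renewal lam : 0 <= lam -> (forall k i j, (Phi w lam k i j < +oo)%E) ->
  forall k i j,
  pp w k i j + \sum_l rr w k i l * fine (Phi w lam k l j) +
   \sum_l qq w k i l * \sum_l' fine (Phi w lam (k - 1) l l') * fine (Phi w lam k l' j)
  <= fine (Phi w lam k i j).
Proof.
move=> lam0 hfin k i j.
pose u K := pp w k i j + \sum_l rr w k i l * mgf_trunc K (expR lam) w k l j +
   \sum_l qq w k i l * \sum_l' mgf_trunc K (expR lam) w (k - 1) l l' * mgf_trunc K (expR lam) w k l' j.
apply: (@ler_cvg_to _ \oo _ _ u (fun=> fine (Phi w lam k i j))).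
- apply: cvgD; first (apply: cvgD; first exact: cvg_cst).
    by apply: cvg_sumr => l; apply: cvgMl_tmp; exact: mgf_trunc_cvg.
  apply: cvg_sumr => l; apply: cvgMl_tmp; apply: cvg_sumr => l'.
  by apply: cvgM; exact: mgf_trunc_cvg.
- exact: cvg_cst.
- apply: nearW => K; have z1 : 1 <= expR lam by rewrite -[leLHS]expR0 ler_expR.
  rewrite /u /=; apply: (le_trans (mgf_trunc_renewal kappa0 hw K k i j z1)).
  exact: mgf_trunc_le_fine.
Qed.

Lemma kappa_pow : exists K0, (1 - (kappa + kappa)) ^+ K0 <= kappa / 2.
Proof.
have h : (fun n => (1 - (kappa + kappa)) ^+ n) @ \oo --> 0.
  apply: cvg_expr; rewrite ger0_norm ?subr_ge0 ?(kappa_half i0 hw)//.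
  by rewrite ltrBlDr ltrDl addr_gt0.
have /cvgrPdist_lt/(_ (kappa / 2)) := h.
rewrite divr_gt0// => /(_ isT)[K _ /(_ K (leqnn K))].
rewrite /= sub0r normrN => hK; exists K.
by apply: (le_trans (ler_norm _)); apply: ltW.
Qed.

(** Finiteness improves itself to a universal bound. For [lam > 0], dropping [pp] from the renewal
    inequality at level [k + 1] and inverting I - r gives X_(k+1) >= N X_k X_(k+1) with all entries
    of N at least [kappa]; a positive finite entry of X_(k+1) then cancels. *)
Lemma Phi_le_kappaV lam : (forall k i j, (Phi w lam k i j < +oo)%E) ->
  forall k i j, (Phi w lam k i j <= kappa^-1%:E)%E.
Proof.
have k1 : 1 <= kappa^-1.
  by rewrite -[leLHS]invr1 lef_pV2 ?posrE//; have := kappa_half i0 hw; lra.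
move=> hfin k i j; case: (leP lam 0) => lam0.
  apply: Phi_le => K; apply: le_trans k1.
  by apply: (mgf_trunc_le1 hw); rewrite ?expR_ge0// -expR0 ler_expR.
have [K0 hK0] := kappa_pow.
pose X k := \matrix_(i, j) fine (Phi w lam k i j).
pose N := invmx (1%:M - rr w (k + 1)) *m qq w (k + 1).
have rr0 a b : 0 <= rr w (k + 1) a b by case: (hS (k + 1)) => /(_ a b)[_ []].
have pp0 a b : 0 <= pp w (k + 1) a b by case: (hS (k + 1)) => /(_ a b)[_ []].
have kk0 : 0 < kappa + kappa by rewrite addr_gt0.
have U := substochastic_unit i0 kk0 rr0 (Omega_rr hw (k + 1)).
have h a b : 0 <= (X (k + 1) - N *m (X k *m X (k + 1))) a b.
  apply: (substochastic_solve_ge0 i0 kk0 rr0 (Omega_rr hw (k + 1))) => {}a {}b.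
  rewrite mulmxBr mulmxBl mul1mx /N !mulmxA mulmxV// mul1mx.
  rewrite -[qq _ _ *m _ *m _]mulmxA !mxE.
  have := Phi_renewal (ltW lam0) hfin (k + 1) a b; rewrite addrK.
  have -> : \sum_l rr w (k + 1) a l * X (k + 1) l b =
     \sum_l rr w (k + 1) a l * fine (Phi w lam (k + 1) l b).
    by apply: eq_bigr => l _; rewrite [X _ _ _]mxE.
  have -> : \sum_l qq w (k + 1) a l * (X k *m X (k + 1)) l b =
     \sum_l qq w (k + 1) a l * \sum_l' fine (Phi w lam k l l') * fine (Phi w lam (k + 1) l' b).
    apply: eq_bigr => l _; congr (_ * _); rewrite mxE; apply: eq_bigr => l' _.
    by rewrite [X k _ _]mxE [X (k + 1) _ _]mxE.
  have := pp0 a b; lra.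
have Xpos a b : 0 < fine (Phi w lam (k + 1) a b).
  apply: lt_le_trans (mgf_trunc_le_fine K0 (hfin _ _ _)).
  apply: lt_le_trans (mgf_trunc_ge i0 kappa0 hw _ a b hK0 (leqnn _) (expR_ge0 _)).
  by rewrite mulr_gt0 ?divr_gt0// lt_min ltr01 exprn_gt0// expR_gt0.
have Xge0 c a b : 0 <= fine (Phi w lam c a b) by rewrite fine_ge0// Phi_ge0.
have Nge a b : kappa <= N a b by case: (hw (k + 1)) => _ [_ /(_ a b)[]].
(* Row [j] is chosen so that the summand with intermediate heights [i] and then [j] contains the
   very entry (j, i0) of X_(k+1) that stands on the other side. *)
have := h j i0; rewrite !mxE subr_ge0 => h1.
have h2 : kappa * (fine (Phi w lam k i j) * fine (Phi w lam (k + 1) j i0)) <=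
    fine (Phi w lam (k + 1) j i0).
  apply: le_trans h1; rewrite (bigD1 i)//= -[leLHS]addr0 lerD//.
    apply: ler_pM; rewrite ?(ltW kappa0) ?mulr_ge0//.
    rewrite mxE (bigD1 j)//= !mxE lerDl sumr_ge0// => l _.
    by rewrite !mxE mulr_ge0.
  apply: sumr_ge0 => l _; apply: mulr_ge0; first exact: (le_trans (ltW kappa0)).
  by rewrite mxE sumr_ge0// => l' _; rewrite !mxE mulr_ge0.
rewrite -(Phi_fin (hfin k i j)) lee_fin -[leRHS]mulr1 ler_pdivlMl//.
rewrite -(ler_pM2r (Xpos j i0)) mul1r -mulrA.
exact: h2.
Qed.

End PhiOmega.

(** * Covariance under the shift *)

Section Shift.
Context (R : realType) (d : nat).
Implicit Types w : env R d.

Lemma hit_shift w n m x i j : hit (Defs.shift w) n m x i j = hit w (n + 1) m (x + 1) i j.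
Proof.
elim: m x i => [|m IH] x i /=; rewrite (inj_eq (addIr 1)).
  by [].
case: eqP => // _; apply: eq_bigr => l _; rewrite !IH !mxE.
by rewrite [x - 1 + 1]addrAC.
Qed.

Lemma mgf_trunc_shift K z w k : mgf_trunc K z (Defs.shift w) k = mgf_trunc K z w (k + 1).
Proof.
by apply/matrixP => i j; rewrite !mxE; apply: eq_bigr => m _; rewrite hit_shift.
Qed.

Lemma Phi_shift w lam k i j : Phi (Defs.shift w) lam k i j = Phi w lam (k + 1) i j.
Proof.
rewrite !PhiE; apply: (congr1 (fun u : nat -> \bar R => limn u)); apply/funext => n.
by congr EFin; apply: eq_bigr => m _; rewrite hit_shift.
Qed.

Lemma Omega_shift kappa w : Omega_kappa kappa (Defs.shift w) <-> Omega_kappa kappa w.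
Proof.
have E k : in_Sigma_kappa kappa (qq (Defs.shift w) k) (rr (Defs.shift w) k) (pp (Defs.shift w) k) =
    in_Sigma_kappa kappa (qq w (k + 1)) (rr w (k + 1)) (pp w (k + 1)) by [].
by split => h k; have := h (k - 1); have := h (k + 1); rewrite ?E ?subrK//; move=> *; exact: h.
Qed.

End Shift.

(** * The critical parameter *)

Section AeProbability.
Context (dd : measure_display) (T : measurableType dd) (R : realType) (P : probability T R).

Lemma ae_full (A : set T) : measurable A -> P A = 1%E -> {ae P, forall x, A x}.
Proof.
move=> mA PA; exists (~` A); split => //; first exact: measurableC.
by rewrite probability_setC// PA subee.
Qed.

Lemma full_ae (A : set T) : measurable A -> {ae P, forall x, A x} -> P A = 1%E.
Proof.
move=> mA [N [mN PN AN]].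
have PC : P (~` A) = 0%E.
  by apply: (@subset_measure0 _ _ _ P _ N) => //; exact: measurableC.
by rewrite -[A]setCK probability_setC ?PC ?sube0//; exact: measurableC.
Qed.

(** The device behind all deterministic statements on rates: intersect the full events involved and
    compare growth in one environment. *)
Lemma ae_witness (A : T -> Prop) : {ae P, forall x, A x} -> exists x, A x.
Proof.
move=> h; apply: contrapT => nA.
have : {ae P, forall x : T, False} by apply: filterS h => x Ax; apply: nA; exists x.
move=> /(full_ae (@measurable0 _ T)); rewrite measure0 => /eqP.
by rewrite eq_sym onee_eq0.
Qed.

End AeProbability.

Section Critical.
Context (R : realType) (d : nat) (i0 : 'I_d) (eta : probability (env R d) R) (kappa : R).
Hypothesis stat : stationary eta.
Hypothesis kappa0 : 0 < kappa.
Hypothesis A2 : eta (Omega_kappa kappa) = 1%E.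
Implicit Types (w : env R d) (lam : R).

Lemma stationary_int (E : int -> set (env R d)) : (forall k, measurable (E k)) ->
  (forall k w, E k (Defs.shift w) <-> E (k + 1) w) -> forall k, eta (E k) = eta (E 0).
Proof.
move=> mE hE; have S k : eta (E (k + 1)) = eta (E k).
  rewrite -(stat (mE k)); congr (eta _); apply/seteqP.
  by split => w; rewrite /preimage /= ?hE.
case=> n; first by elim: n => [//|n IH]; rewrite -addn1 PoszD S.
rewrite NegzE; elim: n => [|n IH]; first by rewrite -(S (-1)) addNr.
by rewrite -IH -(S (- n.+2%:Z)); congr (eta (E _)); lia.
Qed.

Lemma ae_Omega : {ae eta, forall w, Omega_kappa kappa w}.
Proof. by apply: ae_full => //; exact: measurable_Omega_kappa. Qed.

Lemma measurable_ereal_le (f : env R d -> \bar R) (y : \bar R) :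
  measurable_fun setT f -> measurable [set w | (f w <= y)%E].
Proof.
move=> mf; have := @emeasurable_fun_infty_c _ (env R d) R setT f measurableT mf y.
by rewrite setTI.
Qed.

Lemma measurable_ereal_lt (f : env R d -> \bar R) (y : \bar R) :
  measurable_fun setT f -> measurable [set w | (f w < y)%E].
Proof.
move=> mf; have := @emeasurable_fun_infty_o _ (env R d) R setT f measurableT mf y.
by rewrite setTI.
Qed.

Definition fin_set lam : set (env R d) :=
  [set w | (\big[maxe/-oo]_(i < d) (\sum_(j < d) Phi w lam 0 i j) < +oo)%E].

Lemma measurable_fin_set lam : measurable (fin_set lam).
Proof.
apply: measurable_ereal_lt.
pose F i w := (\sum_(j < d) Phi w lam 0 i j)%E.
have mF i : measurable_fun setT (F i) by apply: emeasurable_sum => j; exact: measurable_Phi.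
under eq_fun do under eq_bigr => i _ do rewrite -/(F i _).
elim: (index_enum _) => [|i s IH].
  by under eq_fun do rewrite big_nil; exact: measurable_cst.
under eq_fun do rewrite big_cons; exact: measurable_maxe.
Qed.

Lemma fin_setP lam w : Omega_kappa kappa w ->
  (fin_set lam w <-> forall i j, (Phi w lam 0 i j < +oo)%E).
Proof.
move=> hw; split.
  move=> h i j; apply: le_lt_trans h.
  apply: (@le_trans _ _ (\sum_(j < d) Phi w lam 0 i j)%E); last first.
    exact: (@le_bigmax _ _ _ -oo%E (fun i => \sum_(j < d) Phi w lam 0 i j)%E i).
  rewrite (bigD1 j)//= leeDl// sume_ge0// => l _; exact: (Phi_ge0 hw).
move=> h; rewrite /fin_set /=; apply: bigmax_lt => // i _.
by apply: lte_sum_pinfty => j _.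
Qed.

(** A uniform bound at every level in place of finiteness at level 0. It is shift-invariant, and
    unlike finiteness it survives the limit from below at [lambda_crit]. *)
Definition Good lam : set (env R d) :=
  [set w | Omega_kappa kappa w /\ forall k i j, (Phi w lam k i j <= kappa^-1%:E)%E].

Lemma measurable_Good lam : measurable (Good lam).
Proof.
apply: measurableI; first exact: measurable_Omega_kappa.
apply: measurable_setall => k; apply: measurable_setall => i; apply: measurable_setall => j.
by apply: measurable_ereal_le; exact: measurable_Phi.
Qed.

Lemma Good_shift lam w : Good lam (Defs.shift w) <-> Good lam w.
Proof.
split=> -[hw h]; split; try exact/Omega_shift.
- by move=> k i j; have := h (k - 1) i j; rewrite Phi_shift subrK.
- by move=> k i j; rewrite Phi_shift.
Qed.

Lemma ae_fin_setall lam : eta (fin_set lam) = 1%E ->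
  {ae eta, forall w, forall k i j, (Phi w lam k i j < +oo)%E}.
Proof.
move=> h.
pose E k : set (env R d) := [set w | forall i j, (Phi w lam k i j < +oo)%E].
have mE k : measurable (E k).
  apply: measurable_setall => i; apply: measurable_setall => j.
  by apply: measurable_ereal_lt; exact: measurable_Phi.
have E0 : eta (E 0) = 1%E.
  apply: full_ae => //; apply: filterS2 ae_Omega (ae_full (measurable_fin_set lam) h).
  by move=> w hw /(fin_setP lam hw).
have hE k : eta (E k) = 1%E.
  rewrite -E0; apply: stationary_int => // {}k w.
  by split => H i j; have := H i j; rewrite Phi_shift.
have : {ae eta, forall w, forall n : nat, E n%:Z w /\ E (- n%:Z) w}.
  apply: ae_foralln => n; apply: filterI; exact: ae_full.
by apply: filterS => w H k i j; have := H `|k|%N; case: (intP k) => [|n|n] [h1 h2]; auto.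
Qed.

Lemma ae_Good_fin lam : eta (fin_set lam) = 1%E -> {ae eta, forall w, Good lam w}.
Proof.
move=> /ae_fin_setall; apply: filterS2 ae_Omega => w hw H.
by split => //; exact: (Phi_le_kappaV i0 kappa0 hw).
Qed.

Lemma Phi_mono w lam lam' k i j : Omega_kappa kappa w -> lam <= lam' ->
  (Phi w lam k i j <= Phi w lam' k i j)%E.
Proof.
move=> hw ll; have [->|fin] := eqVneq (Phi w lam' k i j) +oo%E; first by rewrite leey.
have f' : (Phi w lam' k i j < +oo)%E by rewrite ltey.
rewrite -(Phi_fin hw f'); apply: (Phi_le hw) => K.
apply: (le_trans _ (mgf_trunc_le_fine hw K f')).
by apply: (mgf_trunc_lez hw); rewrite ?expR_ge0// ler_expR.
Qed.

Lemma Good_mono lam lam' w : lam <= lam' -> Good lam' w -> Good lam w.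
Proof.
by move=> ll [hw h]; split => // k i j; apply: le_trans (h k i j); exact: Phi_mono.
Qed.

(* At the critical point itself the bound is recovered by continuity of the
   truncated generating functions. *)
Lemma ae_Good lam : (lam%:E <= lambda_crit eta)%E -> {ae eta, forall w, Good lam w}.
Proof.
move=> hl.
have H lam' : lam' < lam -> {ae eta, forall w, Good lam' w}.
  move=> ll; have : (lam'%:E < lambda_crit eta)%E by apply: lt_le_trans hl; rewrite lte_fin.
  move=> /ereal_sup_gt[_ [mu hmu <-]]; rewrite lte_fin => lmu.
  by apply: filterS (ae_Good_fin hmu) => w; apply: Good_mono; exact: ltW.
have : {ae eta, forall w, forall n : nat, Good (lam - n.+1%:R^-1) w}.
  apply: ae_foralln => n; apply: H; by rewrite ltrBlDr ltrDl invr_gt0.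
apply: filterS => w G; have hw : Omega_kappa kappa w by case: (G 0%N).
split => // k i j; apply: (Phi_le hw) => K.
set X := mgf_trunc _ _ _ _ _ _.
have X0 : 0 <= X by apply: (mgf_trunc_ge0 hw); exact: expR_ge0.
(* Lowering [lam] by [1/(n+1)] multiplies the term of index [m <= K] by exp(-m/(n+1)), which is at
   least 1 - K/(n+1). *)
have B n : X * (1 - K%:R * n.+1%:R^-1) <= kappa^-1.
  have h : mgf_trunc K (expR (lam - n.+1%:R^-1)) w k i j <= kappa^-1.
    by rewrite -lee_fin; apply: le_trans (mgf_trunc_le_Phi hw K _ k i j) _; case: (G n).
  apply: le_trans h; rewrite /X !mxE mulr_suml; apply: ler_sum => m _.
  rewrite mulrAC ler_wpM2r ?(hit_ge0 (Omega_Sigma hw))// expRD exprMn ler_wpM2l ?exprn_ge0 ?expR_ge0//.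
  rewrite -expRM_natr; apply: le_trans (expR_ge1Dx _).
  rewrite mulNr lerD2l lerN2 mulrC ler_wpM2r ?invr_ge0// ler_nat.
  by rewrite -ltnS.
have c : (fun n : nat => X * (1 - K%:R * n.+1%:R^-1)) @ \oo --> X * (1 - K%:R * 0).
  apply: cvgMl_tmp; apply: cvgB; first exact: cvg_cst.
  apply: cvgMl_tmp; exact: cvg_harmonic.
rewrite -[leLHS]mulr1 -[X in _ * X <= _]subr0 -(mulr0 K%:R).
by apply: (ler_cvg_to c (cvg_cst kappa^-1)); exact: nearW.
Qed.

Lemma fin_set_le0 lam : lam <= 0 -> eta (fin_set lam) = 1%E.
Proof.
move=> l0; apply: full_ae; first exact: measurable_fin_set.
apply: filterS ae_Omega => w hw; apply/(fin_setP _ hw) => i j.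
apply: (@le_lt_trans _ _ 1%:E); last exact: ltry.
apply: (Phi_le hw) => K; apply: (mgf_trunc_le1 hw); first exact: expR_ge0.
by rewrite -[leRHS]expR0 ler_expR.
Qed.

Lemma lambda_crit_ge0 : (0%:E <= lambda_crit eta)%E.
Proof. by apply: ereal_sup_ubound; exists 0 => //; exact: fin_set_le0. Qed.

(** This makes [lambda_crit] finite: an immediate step up already contributes [expR lam * kappa] to
    a row sum, and a good row sum is at most [d / kappa]. *)
Lemma expR_lambda_crit lam : (lam%:E <= lambda_crit eta)%E ->
  expR lam * kappa <= d%:R * kappa^-1.
Proof.
move=> /ae_Good/ae_witness[w [hw h]].
apply: (le_trans (mgf_trunc_rowsum_ge kappa0 hw 0 0 i0 (expR_ge0 lam))).
rewrite /rowsum mulr_natl -[X in _ *+ X]card_ord -sumr_const; apply: ler_sum => j _.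
by rewrite -lee_fin; apply: le_trans (mgf_trunc_le_Phi hw 1 _ 0 i0 j) _.
Qed.

End Critical.

(** * Comparison of growth rates *)

Section AsympLinear.
Context (R : realType).
Implicit Types (u v : nat -> R) (m a D : R).

Lemma linear_le (a D : R) : (forall n : nat, n%:R * a <= D) -> a <= 0.
Proof.
move=> h; rewrite leNgt; apply/negP => a0.
have [n hn] : exists n : nat, D / a < n%:R.
  by exists (Num.truncn (D / a)).+1; exact: truncnS_gt.
have := h n; rewrite leNgt => /negP; apply.
by rewrite -ltr_pdivrMr.
Qed.

Lemma asymp_linear_compare u v m m' a D : asymp_linear u m -> asymp_linear v m' ->
  (forall n, u n + n%:R * a <= v n + D) -> m + a <= m'.
Proof.
move=> hu hv h; rewrite leNgt; apply/negP => lt.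
pose e : R := (m + a - m') / 4.
have e0 : 0 < e by rewrite divr_gt0// subr_gt0.
have [D1 h1] := hu e e0; have [D2 h2] := hv e e0.
have : e <= 0.
  apply: (@linear_le _ ((D1 + D2 + D) / 2)) => n.
  have := h1 n; have := h2 n; have := h n; rewrite !ler_norml => k /andP[k1 k2] /andP[k3 k4].
  have E : m = m' - a + 4 * e by rewrite /e; field.
  have := congr1 (fun x => n%:R * x) E; rewrite !mulrDr mulrN => E'.
  have : n%:R * (4 * e) = 4 * (n%:R * e) by ring.
  have : e * n%:R = n%:R * e by ring.
  move: (n%:R * e) => ne; lra.
by rewrite leNgt e0.
Qed.

Lemma asymp_linearD u v m m' : asymp_linear u m -> asymp_linear v m' ->
  asymp_linear (fun n => u n + v n) (m + m').
Proof.
move=> hu hv e e0; have e2 : 0 < e / 2 by rewrite divr_gt0.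
have [D1 h1] := hu _ e2; have [D2 h2] := hv _ e2; exists (D1 + D2) => n.
have -> : u n + v n - n%:R * (m + m') = (u n - n%:R * m) + (v n - n%:R * m') by ring.
apply: (le_trans (ler_normD _ _)); apply: (le_trans (lerD (h1 n) (h2 n))).
by rewrite le_eqVlt; apply/orP; left; apply/eqP; field.
Qed.

Lemma asymp_linearZ u m c : asymp_linear u m -> asymp_linear (fun n => c * u n) (c * m).
Proof.
move=> hu e e0; have c1 : 0 < `|c| + 1 by rewrite ltr_wpDl.
have [D h] := hu (e / (`|c| + 1)) (divr_gt0 e0 c1); exists (`|c| * D) => n.
have -> : c * u n - n%:R * (c * m) = c * (u n - n%:R * m) by ring.
rewrite normrM; apply: (le_trans (ler_wpM2l (normr_ge0 c) (h n))).
rewrite mulrDr lerD2r mulrA ler_wpM2r// mulrA ler_pdivrMr// mulrC ler_wpM2l ?(ltW e0)//.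
by rewrite lerDl.
Qed.

(** Needed because [fprod_square_ge] concerns products of odd length. *)
Lemma asymp_linear_odd u m : asymp_linear u m ->
  asymp_linear (fun n => u n.*2.+1) (2 * m).
Proof.
move=> hu e e0; have e2 : 0 < e / 2 by rewrite divr_gt0.
have [D h] := hu _ e2; exists (e / 2 + D + `|m|) => n; have := h n.*2.+1.
have -> : n.*2.+1%:R = 2 * n%:R + 1 :> R by rewrite -addn1 natrD -mul2n natrM.
have h1 := ler_norm m; have h2 := ler_norm (- m); rewrite normrN in h2.
have e3 : e / 2 * (2 * n%:R + 1) = e * n%:R + e / 2 by field.
have e4 : (2 * n%:R + 1) * m = 2 * (n%:R * m) + m by ring.
have e5 : n%:R * (2 * m) = 2 * (n%:R * m) by ring.
rewrite e3 e4 e5 !ler_norml => /andP[k1 k2]; apply/andP; split; lra.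
Qed.

End AsympLinear.

Section Compare.
Context (R : realType) (d : nat).
Implicit Types (B : nat -> 'M[R]_d).

Lemma fprod_nneg B a n i j : (forall k i j, 0 <= B k i j) -> 0 <= fprod B a n i j.
Proof.
move=> B0; elim: n a i => [|n IH] a i; rewrite /= mxE ?ler0n//.
by apply: sumr_ge0 => l _; exact: mulr_ge0.
Qed.

Lemma fprod_scale B B' (s : nat -> R) : (forall k, 0 <= s k) ->
  (forall k i j, 0 <= B k i j) -> (forall k i j, s k * B k i j <= B' k i j) ->
  forall a n i j, (\prod_(k < n) s (a + k)%N) * fprod B a n i j <= fprod B' a n i j.
Proof.
move=> s0 B0 h a n; elim: n a => [|n IH] a i j; first by rewrite big_ord0 mul1r.
rewrite big_ord_recl addn0 /= !mxE mulr_sumr; apply: ler_sum => l _.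
rewrite mulrACA; apply: ler_pM => //.
- exact: mulr_ge0.
- by apply: mulr_ge0; [apply: prodr_ge0 => k _|exact: fprod_nneg].
- have := IH a.+1 l j; apply: le_trans; rewrite le_eqVlt; apply/orP; left; apply/eqP.
  by congr (_ * _); apply: eq_bigr => k _; rewrite addSnnS.
Qed.

Lemma fprod_scale_rowsum B B' (s : nat -> R) : (forall k, 0 <= s k) ->
  (forall k i j, 0 <= B k i j) -> (forall k i j, s k * B k i j <= B' k i j) ->
  forall n i, (\prod_(k < n) s k) * rowsum (fprod B 0 n) i <= rowsum (fprod B' 0 n) i.
Proof.
move=> s0 B0 h n i; rewrite /rowsum mulr_sumr; apply: ler_sum => j _.
exact: (fprod_scale s0 B0 h 0 n i j).
Qed.

Lemma fprod_rowsum_le B b n i : (forall k i j, 0 <= B k i j) -> (forall k i, rowsum (B k) i <= b) -> 0 <= b ->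
  rowsum (fprod B 0 n) i <= b ^+ n.
Proof.
move=> B0 h b0; elim: n 0%N i => [|n IH] a i; first by rewrite rowsum1 expr0.
rewrite /= rowsum_mulmx exprS; apply: (@le_trans _ _ (\sum_l B a i l * b ^+ n)).
  by apply: ler_sum => l _; rewrite ler_wpM2l.
by rewrite -mulr_suml ler_wpM2r ?exprn_ge0//; exact: h.
Qed.

Lemma fprod_rowsum_ge B b a n i : (forall k i j, 0 <= B k i j) -> (forall k i, b <= rowsum (B k) i) -> 0 <= b ->
  b ^+ n <= rowsum (fprod B a n) i.
Proof.
move=> B0 h b0; elim: n a i => [|n IH] a i; first by rewrite rowsum1 expr0.
rewrite /= rowsum_mulmx exprS; apply: (@le_trans _ _ (\sum_l B a i l * b ^+ n)).
  by rewrite -mulr_suml ler_wpM2r ?exprn_ge0//; exact: h.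
by apply: ler_sum => l _; rewrite ler_wpM2l.
Qed.

Definition mass (M : 'M[R]_d) := \sum_i rowsum M i.

(** Of each pair of levels, the first spreads weight at least [c] over all heights, so the whole
    mass of the second is collected. Hence a single large entry counts, whatever its position. *)
Lemma fprod_two_steps B c : 0 <= c -> (forall k i j, c <= B k i j) ->
  forall a n i, \prod_(k < n) (c * mass (B (a + k.*2.+1)%N)) <= rowsum (fprod B a n.*2) i.
Proof.
move=> c0 h; have B0 k i j : 0 <= B k i j by exact: (le_trans c0).
have m0 k : 0 <= mass (B k) by rewrite sumr_ge0// => i _; rewrite sumr_ge0.
move=> a n; elim: n a => [|n IH] a i; first by rewrite big_ord0 rowsum1.
rewrite big_ord_recl doubleS /= !rowsum_mulmx /=.
set x := \prod_(_ < _) _.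
have hx l : x <= rowsum (fprod B a.+2 n.*2) l.
  apply: le_trans (IH a.+2 l); rewrite le_eqVlt; apply/orP; left; apply/eqP.
  by apply: eq_bigr => k _; rewrite /bump /= add1n doubleS !addSnnS.
have x0 : 0 <= x by apply: prodr_ge0 => k _; rewrite mulr_ge0.
rewrite addn1 /mass -mulrA mulr_suml mulr_sumr; apply: ler_sum => l _.
rewrite rowsum_mulmx; apply: ler_pM => //; first by rewrite mulr_ge0// sumr_ge0.
by rewrite {1}/rowsum mulr_suml; apply: ler_sum => l' _; rewrite ler_wpM2l.
Qed.

(** [fprod_two_steps] sees every other level only, and ergodicity of the shift need not pass to its
    square. Multiplying the bounds for the two parities makes every level appear once, so the
    ordinary ergodic theorem applies. *)
Lemma fprod_square_ge (i0 : 'I_d) B c : 0 < c -> (forall k i j, c <= B k i j) ->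
  forall n i, c ^+ 2 * \prod_(k < n.*2) (c * mass (B k.+1)) <=
    rowsum (fprod B 0 n.*2.+1) i ^+ 2.
Proof.
move=> c0' h n i; have c0 := ltW c0'; have B0 k a b : 0 <= B k a b by exact: (le_trans c0).
have m0 k : 0 <= c * mass (B k).
  by rewrite mulr_ge0// sumr_ge0// => a _; rewrite sumr_ge0.
have rs k a : c <= rowsum (B k) a.
  rewrite /rowsum (bigD1 i0)//=; apply: (le_trans (h k a i0)).
  by rewrite lerDl sumr_ge0.
have E : \prod_(k < n.*2) (c * mass (B k.+1)) =
    (\prod_(k < n) (c * mass (B (0 + k.*2.+1)%N))) * (\prod_(k < n) (c * mass (B (1 + k.*2.+1)%N))).
  elim: n => [|n IH]; first by rewrite !big_ord0 mul1r.
  by rewrite doubleS !big_ord_recr/= IH; ring.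
have P0 b : 0 <= \prod_(k < n) (c * mass (B (b + k.*2.+1)%N)) by apply: prodr_ge0.
have h1 : c * \prod_(k < n) (c * mass (B (0 + k.*2.+1)%N)) <= rowsum (fprod B 0 n.*2.+1) i.
  rewrite -addn1 fprodD rowsum_mulmx mulrC.
  apply: (@le_trans _ _ (rowsum (fprod B 0 n.*2) i * c)).
    by rewrite ler_wpM2r// (fprod_two_steps c0 h).
  rewrite {1}/rowsum mulr_suml; apply: ler_sum => l _; rewrite ler_wpM2l//.
    exact: fprod_nneg.
  by rewrite /= mulmx1.
have h2 : c * \prod_(k < n) (c * mass (B (1 + k.*2.+1)%N)) <= rowsum (fprod B 0 n.*2.+1) i.
  rewrite /= rowsum_mulmx (bigD1 i0)//= -[leLHS]addr0 lerD//.
    by apply: ler_pM => //; exact: (fprod_two_steps c0 h).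
  apply: sumr_ge0 => l _; rewrite mulr_ge0//.
  by apply: le_trans (fprod_two_steps c0 h 1 n l).
rewrite E expr2 mulrACA [leRHS]expr2; apply: ler_pM => //; exact: mulr_ge0.
Qed.

End Compare.

(** * Growth rates and the function Lambda *)

Section Patched.
Context (R : realType) (d : nat).
Implicit Types (w : env R d) (G : set (env R d)) (A : int -> env R d -> 'M[R]_d).

(* The growth theorem asks for bounds valid for every environment: off the
   (shift-invariant, full) set G the cocycle is replaced by a constant. *)
Definition patched G A k w : 'M[R]_d := if w \in G then A k w else const_mx 1.

Lemma patchedE G A k w : G w -> patched G A k w = A k w.
Proof. by move=> Gw; rewrite /patched mem_set. Qed.

Lemma patched_shift G A : (forall w, G (Defs.shift w) <-> G w) ->
  (forall k w, A k (Defs.shift w) = A (k + 1) w) ->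
  forall k w, patched G A k (Defs.shift w) = patched G A (k + 1) w.
Proof.
move=> hG hA k w; rewrite /patched hA; congr (if _ then _ else _).
by apply/idP/idP => /set_mem h; apply/mem_set; apply/hG.
Qed.

Lemma measurable_patched G A : measurable G ->
  (forall k i j, measurable_fun setT (fun w => A k w i j)) ->
  forall k i j, measurable_fun setT (fun w => patched G A k w i j).
Proof.
move=> mG mA k i j.
have E w : patched G A k w i j = if w \in G then A k w i j else 1.
  by rewrite /patched; case: ifP => // _; rewrite mxE.
under eq_fun do rewrite E.
apply: measurable_fun_ifT => //; apply: (measurable_fun_bool true).
rewrite setTI (_ : _ @^-1` _ = G)//.
by apply/seteqP; split => w /=; [move/set_mem|move/mem_set].
Qed.

Lemma patched_between G A c C : c <= 1 <= C ->
  (forall k w, G w -> mx_between c C (A k w)) ->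
  forall k w, mx_between c C (patched G A k w).
Proof.
move=> cC h k w; rewrite /patched; case: ifP => [/set_mem/h//|_] i j.
by rewrite mxE.
Qed.

End Patched.

Section Growth.
Context (R : realType) (d : nat) (i0 : 'I_d) (eta : probability (env R d) R) (kappa : R).
Hypothesis stat : stationary eta.
Hypothesis erg : ergodic eta.
Hypothesis kappa0 : 0 < kappa.
Hypothesis A2 : eta (Omega_kappa kappa) = 1%E.
Variable K0 : nat.
Hypothesis hK0 : (1 - (kappa + kappa)) ^+ K0 <= kappa / 2.
Implicit Types (w : env R d) (lam : R) (K : nat).

Let z0 lam : 0 <= expR lam. Proof. exact: expR_ge0. Qed.

Lemma kappa_le1 : kappa <= 1.
Proof.
have [w hw] := ae_witness (ae_Omega A2).
by have := kappa_half i0 hw; lra.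
Qed.

(** Independent of the truncation level, which provides the domination when [K] goes to infinity. *)
Definition lbound lam : R := kappa / 2 * Num.min 1 (expR lam ^+ K0).

Lemma lbound_gt0 lam : 0 < lbound lam.
Proof. by rewrite mulr_gt0 ?divr_gt0// lt_min ltr01 exprn_gt0// expR_gt0. Qed.

Lemma lbound_le1 lam : lbound lam <= 1.
Proof.
have := kappa_le1; have : Num.min 1 (expR lam ^+ K0) <= 1 by rewrite ge_min lexx.
have : 0 <= Num.min 1 (expR lam ^+ K0) by rewrite le_min ler01 exprn_ge0.
rewrite /lbound; set x := Num.min _ _ => x0 x1 k1.
rewrite -[leRHS]mulr1; apply: ler_pM => //; first by rewrite divr_ge0// ltW.
have := kappa0; lra.
Qed.

Definition ubound K lam : R := \sum_(m < K.+1) expR lam ^+ m.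

Lemma ubound_ge1 K lam : 1 <= ubound K lam.
Proof.
by rewrite /ubound big_ord_recl expr0 lerDl sumr_ge0// => m _; rewrite exprn_ge0.
Qed.

Definition AK K lam := patched (Omega_kappa kappa) (fun k w => mgf_trunc K (expR lam) w k).

Lemma AK_between K lam : (K0 <= K)%N -> forall k w, mx_between (lbound lam) (ubound K lam) (AK K lam k w).
Proof.
move=> KK; apply: patched_between; first by rewrite lbound_le1 ubound_ge1.
move=> k w hw i j; rewrite (mgf_trunc_ge i0 kappa0 hw)//=.
exact: (mgf_trunc_le hw).
Qed.

Lemma AK_shift K lam k w : AK K lam k (Defs.shift w) = AK K lam (k + 1) w.
Proof.
apply: patched_shift; first exact: Omega_shift.
by move=> {}k {}w; exact: mgf_trunc_shift.
Qed.

Lemma measurable_AK K lam k i j : measurable_fun setT (fun w => AK K lam k w i j).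
Proof.
apply: measurable_patched; first exact: measurable_Omega_kappa.
by move=> *; exact: measurable_mgf_trunc.
Qed.

(* LK and LP are the growth rates of the products of the matrices truncated at
   time K and of the matrices Phi; LambdaE identifies LP with Lambda. *)
Definition LK K lam : R := lyap eta i0 (AK K lam).

Definition mgf_growth (B : nat -> 'M[R]_d) (m : R) :=
  forall e : R, 0 < e -> exists D : R, forall n i,
    `|ln (rowsum (fprod B 0 n) i) - n%:R * m| <= e * n%:R + D.

Lemma mgf_growth_asymp B m i : mgf_growth B m ->
  asymp_linear (fun n => ln (rowsum (fprod B 0 n) i)) m.
Proof. by move=> h e /h[D hD]; exists D => n. Qed.

Lemma ae_LK K lam : (K0 <= K)%N ->
  {ae eta, forall w, mgf_growth (fun k : nat => mgf_trunc K (expR lam) w k%:Z) (LK K lam)}.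
Proof.
move=> KK.
have := lyap_asymp i0 (@measurable_shift R d) stat erg (lbound_gt0 lam)
  (@measurable_AK K lam) (AK_shift K lam) (AK_between lam KK).
apply: filterS2 (ae_Omega A2) => w hw H e e0.
have [D hD] := H e e0; exists D => n i; have := hD n i.
by rewrite (@eq_fprod _ _ (fun k : nat => mgf_trunc K (expR lam) w k%:Z))// => k;
  rewrite /future /AK patchedE.
Qed.

Definition AP lam := patched (Good kappa lam) (fun k w => Phimx w lam k).

Lemma Good_mgf_le lam w K k i j : Good kappa lam w ->
  mgf_trunc K (expR lam) w k i j <= Phimx w lam k i j.
Proof.
move=> [hw h]; rewrite [leRHS]mxE; apply: (mgf_trunc_le_fine hw).
by apply: le_lt_trans (h k i j) _; exact: ltry.
Qed.

Lemma Good_mgf_cvg lam w k i j : Good kappa lam w ->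
  (fun K => mgf_trunc K (expR lam) w k i j) @ \oo --> Phimx w lam k i j.
Proof.
move=> [hw h]; rewrite mxE; apply: (mgf_trunc_cvg hw).
by apply: le_lt_trans (h k i j) _; exact: ltry.
Qed.

Lemma Good_Phi lam w k i j : Good kappa lam w -> (Phimx w lam k i j)%:E = Phi w lam k i j.
Proof.
move=> [hw h]; rewrite mxE (Phi_fin hw)//.
by apply: le_lt_trans (h k i j) _; exact: ltry.
Qed.

Lemma AP_between lam k w : mx_between (lbound lam) kappa^-1 (AP lam k w).
Proof.
apply: patched_between.
  by rewrite lbound_le1 -[leLHS]invr1 lef_pV2 ?posrE// kappa_le1.
move=> {}k {}w G i j; apply/andP; split.
  apply: le_trans (Good_mgf_le K0 k i j G); case: G => hw _.
  exact: (mgf_trunc_ge i0 kappa0 hw).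
by rewrite -lee_fin Good_Phi//; case: G => _; apply.
Qed.

Lemma AP_shift lam k w : AP lam k (Defs.shift w) = AP lam (k + 1) w.
Proof.
apply: patched_shift; first exact: Good_shift.
by move=> {}k {}w; apply/matrixP => i j; rewrite !mxE Phi_shift.
Qed.

Lemma measurable_AP lam k i j : measurable_fun setT (fun w => AP lam k w i j).
Proof.
apply: measurable_patched; first exact: measurable_Good.
move=> {}k {}i {}j; under eq_fun do rewrite mxE.
by apply: measurableT_comp => //; exact: measurable_Phi.
Qed.

Definition LP lam : R := lyap eta i0 (AP lam).

Lemma ae_LP lam : (lam%:E <= lambda_crit eta)%E ->
  {ae eta, forall w, mgf_growth (fun k : nat => Phimx w lam k%:Z) (LP lam)}.
Proof.
move=> hl.
have := lyap_asymp i0 (@measurable_shift R d) stat erg (lbound_gt0 lam)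
  (@measurable_AP lam) (AP_shift lam) (AP_between lam).
apply: filterS2 (ae_Good i0 stat kappa0 A2 hl) => w hw H e e0.
have [D hD] := H e e0; exists D => n i; have := hD n i.
by rewrite (@eq_fprod _ _ (fun k : nat => Phimx w lam k%:Z))// => k;
  rewrite /future /AP patchedE.
Qed.

Lemma left_dir_mu0 lam w j : Good kappa lam w -> mu0 w lam j = left_dir i0 (AP lam) w j.
Proof.
move=> G; rewrite /mu0; case: pickP => [i _|/(_ i0)//].
apply/cvg_lim => //; have := @left_dir_cvg _ _ _ _ i0 _ _ _ (lbound_gt0 lam) (AP_between lam) w i j.
have E n : bprod (past (AP lam) w) n = Phiprod w lam n.
  by elim: n => [//|n IH]; rewrite /= IH /past /AP patchedE.
by under eq_fun do rewrite E.
Qed.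

Lemma elogE (x : \bar R) : elog x = if x == +oo%E then +oo%E
  else if 0 < fine x then (ln (fine x))%:E else -oo%E.
Proof. by case: x => [r| |] //=; rewrite ltxx. Qed.

Lemma measurable_elog : measurable_fun setT (@elog R).
Proof.
have -> : @elog R = fun x => if x == +oo%E then +oo%E
  else if 0 < fine x then (ln (fine x))%:E else -oo%E by apply/funext => x; exact: elogE.
apply: measurable_fun_ifT; [|exact: measurable_cst|apply: measurable_fun_ifT].
- by apply: measurable_fun_eqe => //; exact: measurable_cst.
- by apply: measurable_fun_ltr; [exact: measurable_cst|exact: fine_measurable].
- apply/measurable_EFinP; apply: measurableT_comp; first exact: measurable_ln.
  exact: fine_measurable.
- exact: measurable_cst.
Qed.

Lemma measurable_mu0 lam j : measurable_fun setT (fun w : env R d => mu0 w lam j).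
Proof.
rewrite /mu0; case: pickP => [i _|_]; last exact: measurable_cst.
have mP n a b : measurable_fun setT (fun w : env R d => Phiprod w lam n a b).
  elim: n a b => [|n IH] a b; first exact: measurable_cst.
  under eq_fun do rewrite /= mxE; apply: measurable_sum => l; apply: measurable_funM => //.
  under eq_fun do rewrite mxE.
  by apply: measurableT_comp => //; exact: measurable_Phi.
apply: measurable_limn_real => n; apply: measurable_funM => //.
by apply: measurable_inv; apply: measurable_sum => l.
Qed.

(** On [Good] the argument of [elog] is the finite positive number [growth], so the two integrands
    agree almost everywhere. *)
Lemma LambdaE lam : (lam%:E <= lambda_crit eta)%E -> Lambda eta lam = (LP lam)%:E.
Proof.
move=> hl; rewrite /Lambda hl.
have b := bmeas_ln_growth i0 (lbound_gt0 lam) (@measurable_AP lam) (AP_between lam).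
have ib := bmeas_int eta b.
rewrite /LP lyapE /Rintegral fineK; last exact: integrable_fin_num.
apply: ae_eq_integral => //.
- apply: measurableT_comp; first exact: measurable_elog.
  apply: emeasurable_sum => i; apply: emeasurable_funM.
    by apply/measurable_EFinP; exact: measurable_mu0.
  by apply: emeasurable_sum => j; exact: measurable_Phi.
- by apply/measurable_EFinP; case: b.
apply: filterS (ae_Good i0 stat kappa0 A2 hl) => w G _ /=.
have -> : (\sum_(i < d) (mu0 w lam i)%:E * \sum_(j < d) Phi w lam 0 i j)%E =
    (growth i0 (AP lam) w)%:E.
  rewrite /growth -sumEFin; apply: eq_bigr => i _; rewrite (left_dir_mu0 _ G) EFinM.
  by congr (_ * _)%E; rewrite -sumEFin; apply: eq_bigr => j _; rewrite /AP patchedE// Good_Phi.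
rewrite /elog (growth_gt0 i0 (lbound_gt0 lam) (AP_between lam))//.
Qed.

End Growth.

(** * Properties of the truncated rates *)

Section DeterministicRates.
Context (R : realType) (d : nat) (i0 : 'I_d).

Lemma asymp_linear0 : asymp_linear (fun=> 0 : R) 0.
Proof. by move=> e e0; exists 0 => n; rewrite mulr0 subr0 normr0 addr0 mulr_ge0// ltW. Qed.

Lemma mgf_growth_compare (B B' : nat -> 'M[R]_d) m m' c : 0 < c ->
  (forall k i j, 0 <= B k i j) -> (forall n, 0 < rowsum (fprod B 0 n) i0) ->
  (forall k i j, c * B k i j <= B' k i j) ->
  mgf_growth B m -> mgf_growth B' m' -> m + ln c <= m'.
Proof.
move=> c0 B0 Bp h /(mgf_growth_asymp i0) hm /(mgf_growth_asymp i0) hm'.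
apply: (@asymp_linear_compare _ _ _ _ _ _ 0 hm hm') => n; rewrite addr0.
have := @fprod_scale_rowsum _ _ B B' (fun=> c) (fun=> ltW c0) B0 h n i0.
rewrite prodr_const card_ord => h1.
have cn : 0 < c ^+ n by rewrite exprn_gt0.
have B'p : 0 < rowsum (fprod B' 0 n) i0 by apply: lt_le_trans h1; rewrite mulr_gt0.
rewrite mulr_natl -lnXn// addrC -lnM ?posrE//.
by rewrite ler_ln ?posrE// mulr_gt0.
Qed.

(** Midpoint log-convexity through the arithmetic-geometric inequality, coefficient by coefficient.
    The weights exp(g) and exp(-g) are balanced so that both terms equal the geometric mean of the
    two values. *)
Lemma horner_expR_mid (p : {poly R}) (x y : R) : (forall m, 0 <= p`_m) ->
  0 < p.[expR x] -> 0 < p.[expR y] -> 0 < p.[expR ((x + y) / 2)] ->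
  2 * ln p.[expR ((x + y) / 2)] <= ln p.[expR x] + ln p.[expR y].
Proof.
move=> p0 px py pz.
set X := ln p.[expR x]; set Y := ln p.[expR y].
pose g := (Y - X) / 2.
have amgm (a b : R) : expR ((a + b) / 2) <= (expR a + expR b) / 2.
  have -> : expR a = expR (a / 2) ^+ 2 by rewrite -expRM_natr; congr expR; field.
  have -> : expR b = expR (b / 2) ^+ 2 by rewrite -expRM_natr; congr expR; field.
  have -> : expR ((a + b) / 2) = expR (a / 2) * expR (b / 2).
    by rewrite -expRD; congr expR; field.
  have := sqr_ge0 (expR (a / 2) - expR (b / 2)); rewrite sqrrB; move: (expR _) (expR _) => u v.
  by rewrite -mulr_natr; lra.
have h : p.[expR ((x + y) / 2)] <= (expR g * p.[expR x] + expR (- g) * p.[expR y]) / 2.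
  rewrite !horner_coef !mulr_sumr -big_split/= mulr_suml; apply: ler_sum => m _.
  have -> : (expR g * (p`_m * expR x ^+ m) + expR (- g) * (p`_m * expR y ^+ m)) / 2 =
    p`_m * ((expR (g + x * m%:R) + expR (- g + y * m%:R)) / 2).
    by rewrite !expRD !expRM_natr; ring.
  rewrite ler_wpM2l//; apply: le_trans (amgm _ _).
  by rewrite -expRM_natr ler_expR le_eqVlt; apply/orP; left; apply/eqP; field.
have E1 : expR g * p.[expR x] = expR ((X + Y) / 2).
  by rewrite -[p.[expR x]]lnK ?posrE// -/X -expRD; congr expR; rewrite /g; field.
have E2 : expR (- g) * p.[expR y] = expR ((X + Y) / 2).
  by rewrite -[p.[expR y]]lnK ?posrE// -/Y -expRD; congr expR; rewrite /g; field.
rewrite E1 E2 in h.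
have : ln p.[expR ((x + y) / 2)] <= ln (expR ((X + Y) / 2)).
  by rewrite ler_ln ?posrE ?expR_gt0//; apply: (le_trans h); lra.
by rewrite expRK; lra.
Qed.

End DeterministicRates.

Section LKProperties.
Context (R : realType) (d : nat) (i0 : 'I_d) (eta : probability (env R d) R) (kappa : R).
Hypothesis stat : stationary eta.
Hypothesis erg : ergodic eta.
Hypothesis kappa0 : 0 < kappa.
Hypothesis A2 : eta (Omega_kappa kappa) = 1%E.
Variable K0 : nat.
Hypothesis hK0 : (1 - (kappa + kappa)) ^+ K0 <= kappa / 2.
Implicit Types (w : env R d) (lam : R) (K : nat).

Local Notation LK := (LK i0 eta kappa).
Local Notation LP := (LP i0 eta kappa).
Local Notation B K lam w := (fun k : nat => mgf_trunc K (expR lam) w k%:Z).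

Let aeLK K lam (KK : (K0 <= K)%N) := ae_LK i0 stat erg kappa0 A2 hK0 lam KK.
Let aeLP lam (hl : (lam%:E <= lambda_crit eta)%E) := ae_LP i0 stat erg kappa0 A2 hK0 hl.

Lemma trunc_between K lam w : (K0 <= K)%N -> Omega_kappa kappa w ->
  forall k : nat, mx_between (lbound kappa K0 lam) (ubound K lam) (B K lam w k).
Proof.
move=> KK hw k.
by have := AK_between i0 kappa0 A2 hK0 lam KK k%:Z w; rewrite /AK patchedE.
Qed.

Lemma trunc_ge0 K lam w k i j : Omega_kappa kappa w -> 0 <= B K lam w k i j.
Proof. by move=> hw; apply: (mgf_trunc_ge0 hw); exact: expR_ge0. Qed.

Lemma trunc_rowsum_gt0 K lam w a n i : (K0 <= K)%N -> Omega_kappa kappa w ->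
  0 < rowsum (fprod (B K lam w) a n) i.
Proof.
move=> KK hw; apply: (fprod_rowsum_gt0 i0 (lbound_gt0 kappa0 K0 lam)).
exact: trunc_between.
Qed.

Lemma hit_at0 w (k : int) i j : hit w (k + 1) 0 k i j = 0.
Proof. by rewrite /=; case: eqP => // e; exfalso; lia. Qed.

(** A truncated crossing takes between 1 and [K] steps, so raising [lam] by [h] multiplies each
    matrix entry by a factor between exp(h) and exp(K h). *)
Lemma LK_incr K lam h : (K0 <= K)%N -> 0 <= h ->
  LK K lam + h <= LK K (lam + h) <= LK K lam + K%:R * h.
Proof.
move=> KK h0.
have [w [hw [H1 H2]]] := ae_witness (filterI (ae_Omega A2) (filterI (aeLK lam KK) (aeLK (lam + h) KK))).
apply/andP; split.
  rewrite -[h in X in X <= _]expRK; apply: (mgf_growth_compare (i0 := i0) (expR_gt0 h) _ _ _ H1 H2).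
  - by move=> k i j; exact: trunc_ge0.
  - by move=> n; exact: trunc_rowsum_gt0.
  - move=> k i j; rewrite !mxE mulr_sumr; apply: ler_sum => m _.
    case: m => -[|m] hm; first by rewrite hit_at0 !mulr0.
    rewrite mulrA ler_wpM2r ?(hit_ge0 (Omega_Sigma hw))//= expRD exprMn mulrC.
    rewrite ler_wpM2l ?exprn_ge0 ?expR_ge0// -expRM_natr ler_expR.
    by rewrite -[leLHS]mulr1 ler_wpM2l// ler1n.
rewrite -lerBlDr -mulrN mulrC mulNr -[- _]mulNr -[X in _ + X](expRK).
apply: (mgf_growth_compare (i0 := i0) (expR_gt0 _) _ _ _ H2 H1).
- by move=> k i j; exact: trunc_ge0.
- by move=> n; exact: trunc_rowsum_gt0.
- move=> k i j; rewrite !mxE mulr_sumr; apply: ler_sum => m _.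
  rewrite mulrA ler_wpM2r ?(hit_ge0 (Omega_Sigma hw))//= expRD exprMn mulrCA.
  rewrite ler_piMr ?exprn_ge0 ?expR_ge0// -expRM_natr -expRD -[leRHS]expR0 ler_expR.
  by rewrite mulNr addrC subr_le0 ler_wpM2l// ler_nat -ltnS.
Qed.

Lemma trunc_horner K lam w a n i : rowsum (fprod (B K lam w) a n) i =
  (rowsum (fprod (pgf K w) a n) i).[expR lam].
Proof.
by rewrite /rowsum horner_sum; apply: eq_bigr => j _; rewrite horner_fprod_pgf.
Qed.

Lemma LK_mid K x y : (K0 <= K)%N -> 2 * LK K ((x + y) / 2) <= LK K x + LK K y.
Proof.
move=> KK.
have [w [hw [H1 [H2 H3]]]] := ae_witness (filterI (ae_Omega A2)
  (filterI (aeLK x KK) (filterI (aeLK y KK) (aeLK ((x + y) / 2) KK)))).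
have h1 := asymp_linearD (mgf_growth_asymp i0 H1) (mgf_growth_asymp i0 H2).
have h2 := asymp_linearZ 2 (mgf_growth_asymp i0 H3).
rewrite -[leLHS]addr0; apply: (@asymp_linear_compare _ _ _ _ _ _ 0 h2 h1) => n.
rewrite mulr0 !addr0 !trunc_horner; apply: horner_expR_mid; rewrite -?trunc_horner;
  try exact: trunc_rowsum_gt0.
move=> m; rewrite /rowsum coef_sum sumr_ge0// => j _.
exact: (fprod_pgf_coef_ge0 (Omega_Sigma hw)).
Qed.

(** From climbing each level in one step, which costs at most the factor [kappa] in probability. *)
Lemma LK_ge K lam : (K0 <= K)%N -> (0 < K)%N -> lam + ln kappa <= LK K lam.
Proof.
move=> KK K1.
have [w [hw H]] := ae_witness (filterI (ae_Omega A2) (aeLK lam KK)).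
rewrite -[leLHS]add0r.
apply: (@asymp_linear_compare _ _ _ _ _ _ 0 (@asymp_linear0 R) (mgf_growth_asymp i0 H)) => n.
rewrite add0r addr0 -{1}[lam]expRK -lnM ?posrE ?expR_gt0// mulr_natl -lnXn ?mulr_gt0 ?expR_gt0//.
rewrite ler_ln ?posrE ?exprn_gt0 ?mulr_gt0 ?expR_gt0//; last exact: trunc_rowsum_gt0.
apply: fprod_rowsum_ge; first by move=> k i j; exact: trunc_ge0.
  move=> k i; rewrite -(prednK K1).
  by apply: (mgf_trunc_rowsum_ge kappa0 hw); exact: expR_ge0.
by rewrite mulr_ge0 ?expR_ge0// ltW.
Qed.

Lemma LK0_le0 K : (K0 <= K)%N -> LK K 0 <= 0.
Proof.
move=> KK.
have [w [hw H]] := ae_witness (filterI (ae_Omega A2) (aeLK 0 KK)).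
rewrite -[leLHS]addr0.
apply: (@asymp_linear_compare _ _ _ _ _ _ 0 (mgf_growth_asymp i0 H) (@asymp_linear0 R)) => n.
rewrite mulr0 !addr0; apply: ln_le0.
rewrite -(expr1n R n); apply: fprod_rowsum_le => //; first by move=> k i j; exact: trunc_ge0.
move=> k i; apply: le_trans (hit_sum_le1 (Omega_Sigma hw) (k%:Z + 1) K.+1 k%:Z i).
rewrite /rowsum exchange_big/=; apply: ler_sum => j _; rewrite mxE; apply: ler_sum => m _.
by rewrite expR0 expr1n mul1r.
Qed.

Lemma LK_le K lam : (K0 <= K)%N -> lam <= 0 -> LK K lam <= lam.
Proof.
move=> KK l0; have l1 : 0 <= - lam by rewrite oppr_ge0.
have /andP[h _] := LK_incr lam KK l1; rewrite addrN in h.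
by rewrite -subr_le0; exact: (le_trans h (LK0_le0 KK)).
Qed.

Lemma LK_leK K K' lam : (K0 <= K)%N -> (K <= K')%N -> LK K lam <= LK K' lam.
Proof.
move=> KK KK'; have KK2 := leq_trans KK KK'.
have [w [hw [H1 H2]]] := ae_witness (filterI (ae_Omega A2) (filterI (aeLK lam KK) (aeLK lam KK2))).
rewrite -[leLHS]addr0 -[X in _ + X](ln1 R); apply: (mgf_growth_compare (i0 := i0) ltr01 _ _ _ H1 H2).
- by move=> k i j; exact: trunc_ge0.
- by move=> n; exact: trunc_rowsum_gt0.
- by move=> k i j; rewrite mul1r; apply: (mgf_trunc_leK hw) => //; exact: expR_ge0.
Qed.

Lemma LK_leLP K lam : (K0 <= K)%N -> (lam%:E <= lambda_crit eta)%E -> LK K lam <= LP lam.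
Proof.
move=> KK hl.
have [w [hw [H1 H2]]] := ae_witness (filterI (ae_Good i0 stat kappa0 A2 hl) (filterI (aeLK lam KK) (aeLP hl))).
have hO : Omega_kappa kappa w by case: hw.
rewrite -[leLHS]addr0 -[X in _ + X](ln1 R); apply: (mgf_growth_compare (i0 := i0) ltr01 _ _ _ H1 H2).
- by move=> k i j; exact: trunc_ge0.
- by move=> n; exact: trunc_rowsum_gt0.
- by move=> k i j; rewrite mul1r; exact: (Good_mgf_le K k%:Z i j hw).
Qed.

End LKProperties.

(** * Removing the truncation *)

Section LKLimits.
Context (R : realType) (d : nat) (i0 : 'I_d) (eta : probability (env R d) R) (kappa : R).
Hypothesis stat : stationary eta.
Hypothesis erg : ergodic eta.
Hypothesis kappa0 : 0 < kappa.
Hypothesis A2 : eta (Omega_kappa kappa) = 1%E.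
Variable K0 : nat.
Hypothesis hK0 : (1 - (kappa + kappa)) ^+ K0 <= kappa / 2.
Implicit Types (w : env R d) (lam : R) (K : nat).

Local Notation LK := (LK i0 eta kappa).
Local Notation LP := (LP i0 eta kappa).
Local Notation B K lam w := (fun k : nat => mgf_trunc K (expR lam) w k%:Z).
Local Notation AK := (AK kappa).
Local Notation AP := (AP kappa).

Let aeLK K lam (KK : (K0 <= K)%N) := ae_LK i0 stat erg kappa0 A2 hK0 lam KK.
Let aeLP lam (hl : (lam%:E <= lambda_crit eta)%E) := ae_LP i0 stat erg kappa0 A2 hK0 hl.
Let bAK K lam (KK : (K0 <= K)%N) := AK_between i0 kappa0 A2 hK0 lam KK.
Let bAP lam := AP_between i0 kappa0 A2 hK0 lam.
Let c_gt0 lam := lbound_gt0 kappa0 K0 lam.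
Let birk f (bf : bmeas f) := birkhoff (@measurable_shift R d) stat erg bf.

Lemma bmeas_ln (f : env R d -> R) (c C : R) : 0 < c -> measurable_fun setT f ->
  (forall w, c <= f w <= C) -> bmeas (fun w => ln (f w)).
Proof.
move=> c0 mf h; split; first by apply: measurableT_comp => //; exact: measurable_ln.
exists (`|ln c| + `|ln C|) => w; have /andP[h1 h2] := h w.
have f0 : 0 < f w by exact: lt_le_trans h1.
have l1 : ln c <= ln (f w) by rewrite ler_ln ?posrE.
have l2 : ln (f w) <= ln C by rewrite ler_ln ?posrE// (lt_le_trans f0).
have := ler_norm (ln C); have := ler_norm (- ln c).
rewrite normrN; have := normr_ge0 (ln c); have := normr_ge0 (ln C).
move: l1 l2; set x := ln _; set y := ln _; set z := ln _.
by move=> *; rewrite ler_norml; apply/andP; split; lra.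
Qed.

(** On [Good] every summand is nonpositive, so the exponential of this sum is at most every single
    ratio of entries: a bounded measurable minorant of all the ratios that still tends to 1 with
    [K]. *)
Definition log_ratio K lam w : R :=
  \sum_i \sum_j (ln (AK K lam 0 w i j) - ln (AP lam 0 w i j)).

Lemma bmeas_log_ratio K lam : (K0 <= K)%N -> bmeas (log_ratio K lam).
Proof.
move=> KK; apply: bmeas_sum => i; apply: bmeas_sum => j; apply: bmeasD.
  apply: (bmeas_ln (c_gt0 lam)); first exact: measurable_AK.
  by move=> w; exact: (bAK lam KK).
apply: bmeasN; apply: (bmeas_ln (c_gt0 lam)); first exact: measurable_AP.
by move=> w; exact: bAP.
Qed.

Lemma iter_shiftE (A : int -> env R d -> 'M[R]_d) :
  (forall k w, A k (Defs.shift w) = A (k + 1) w) ->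
  forall k w, A 0 (iter k (@Defs.shift R d) w) = A k%:Z w.
Proof.
move=> hA k w.
suff h (z : int) : A z (iter k (@Defs.shift R d) w) = A (z + k%:Z) w by rewrite h add0r.
elim: k z => [|k IH] z; first by rewrite addr0.
by rewrite iterS hA IH; congr (A _ w); lia.
Qed.

(** Dominated convergence: the truncated entries increase to those of Phi, and both stay between
    [lbound] and [kappa^-1] whatever the truncation. *)
Lemma Rintegral_log_ratio_cvg lam : (lam%:E <= lambda_crit eta)%E ->
  (fun K => \int[eta]_w (log_ratio (K0 + K)%N lam w)) @ \oo --> (0 : R).
Proof.
move=> hl; have KK K : (K0 <= K0 + K)%N by rewrite leq_addr.
pose M : R := \sum_(i < d) \sum_(j < d) (2 * (`|ln (lbound kappa K0 lam)| + `|ln kappa^-1|)).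
have [_ _] : [/\ eta.-integrable setT (cst 0%E),
   [sequence (\int[eta]_(x in setT) `|(log_ratio (K0 + n)%N lam x)%:E - 0|)%E]_n @ \oo --> 0%E &
   [sequence (\int[eta]_(x in setT) (log_ratio (K0 + n)%N lam x)%:E)%E]_n @ \oo --> (\int[eta]_(x in setT) 0)%E].
  apply: (@dominated_convergence _ _ _ eta setT measurableT
    (fun n x => (log_ratio (K0 + n)%N lam x)%:E) (cst 0%E) (cst M%:E)).
  - by move=> n; apply/measurable_EFinP; case: (bmeas_log_ratio lam (KK n)).
  - exact: measurable_cst.
  - apply: filterS (ae_Good i0 stat kappa0 A2 hl) => w G _.
    apply: cvg_EFin; first exact: nearW.
    have -> : 0 = \sum_(i < d) \sum_(j < d) (ln (AP lam 0 w i j) - ln (AP lam 0 w i j)) :> R.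
      by rewrite big1// => i _; rewrite big1// => j _; rewrite subrr.
    rewrite /comp /=; apply: cvg_sumr => i; apply: cvg_sumr => j.
    apply: cvgB; last exact: cvg_cst.
    have p : 0 < AP lam 0 w i j.
      by apply: lt_le_trans (c_gt0 lam) _; case/andP: (bAP lam 0 w i j).
    apply: (continuous_cvg _ (continuous_ln p)).
    rewrite /AP patchedE//; under eq_fun do (rewrite /AK patchedE; last by case: G).
    have := Good_mgf_cvg (k := 0) (i := i) (j := j) G; rewrite -(cvg_shiftn K0).
    by under eq_fun do rewrite addnC.
  - exact: (bmeas_int eta (@bmeas_cst _ (env R d) R M)).
  - apply: filterS (ae_Good i0 stat kappa0 A2 hl) => w G n _.
    rewrite /cst abse_EFin lee_fin /log_ratio.
    apply: (le_trans (ler_norm_sum _ _ _)); apply: ler_sum => i _.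
    apply: (le_trans (ler_norm_sum _ _ _)); apply: ler_sum => j _.
    have /andP[a1 a2] := bAP lam 0 w i j.
    have /andP[b1 _] := bAK lam (KK n) 0 w i j.
    have b2 : AK (K0 + n)%N lam 0 w i j <= AP lam 0 w i j.
      by rewrite /AK /AP !patchedE//; [exact: (Good_mgf_le _ _ _ _ G)|case: G].
    have p1 := lt_le_trans (c_gt0 lam) a1; have p2 := lt_le_trans (c_gt0 lam) b1.
    have l1 : ln (lbound kappa K0 lam) <= ln (AK (K0 + n)%N lam 0 w i j) by rewrite ler_ln ?posrE.
    have l2 : ln (AK (K0 + n)%N lam 0 w i j) <= ln (AP lam 0 w i j) by rewrite ler_ln ?posrE.
    have l3 : ln (AP lam 0 w i j) <= ln kappa^-1 by rewrite ler_ln ?posrE ?invr_gt0.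
    move: l1 l2 l3; set x := ln (lbound _ _ _); set y := ln (AK _ _ _ _ _ _); set z := ln (AP _ _ _ _ _); set t := ln _.
    have := ler_norm (- x); rewrite normrN; have := ler_norm t; have := normr_ge0 x; have := normr_ge0 t.
    by move=> *; rewrite ler_norml; apply/andP; split; lra.
by rewrite integral0 => /fine_cvg.
Qed.

(** At each level the truncated matrix dominates Phi times exp([log_ratio]); over many levels the
    product of these factors is governed by the ergodic theorem. *)
Lemma LP_le_LK_ratio K lam : (K0 <= K)%N -> (lam%:E <= lambda_crit eta)%E ->
  LP lam + \int[eta]_w (log_ratio K lam w) <= LK K lam.
Proof.
move=> KK hl.
have [w [G [H1 [H2 H3]]]] := ae_witness (filterI (ae_Good i0 stat kappa0 A2 hl)
  (filterI (aeLK lam KK) (filterI (aeLP hl) (birk (bmeas_log_ratio lam KK))))).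
have hO : Omega_kappa kappa w by case: G.
have u := asymp_linearD (mgf_growth_asymp i0 H2) H3.
rewrite -[leLHS]addr0; apply: (@asymp_linear_compare _ _ _ _ _ _ 0 u (mgf_growth_asymp i0 H1)) => n.
rewrite mulr0 !addr0.
pose s k := expR (log_ratio K lam (iter k (@Defs.shift R d) w)).
have P0 k i j : 0 < Phimx w lam k i j.
  by have /andP[h _] := bAP lam k w i j; rewrite /AP patchedE// in h; apply: lt_le_trans h.
have T0 k i j : 0 < mgf_trunc K (expR lam) w k i j.
  by have /andP[h _] := bAK lam KK k w i j; rewrite /AK patchedE// in h; apply: lt_le_trans h.
have hs (k : nat) i j : s k * Phimx w lam k%:Z i j <= B K lam w k i j.
  rewrite -ler_pdivlMr// -(lnK (divr_gt0 (T0 k i j) (P0 k i j))) ler_expR ln_div ?posrE//.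
  have t0 (a b : 'I_d) : ln (mgf_trunc K (expR lam) w k a b) - ln (Phimx w lam k a b) <= 0.
    by rewrite subr_le0 ler_ln ?posrE//; exact: (Good_mgf_le _ _ _ _ G).
  rewrite /log_ratio (iter_shiftE (AK_shift kappa K lam)) (iter_shiftE (AP_shift kappa lam)).
  rewrite /AK /AP !patchedE// (bigD1 i)//= (bigD1 j)//= -addrA -[leRHS]addr0 lerD2l.
  rewrite -[leRHS](addr0 0) lerD ?sumr_le0// => l _; by rewrite ?sumr_le0.
have := @fprod_scale_rowsum _ _ (fun k : nat => Phimx w lam k%:Z) (B K lam w) s (fun k => expR_ge0 _)
  (fun k i j => ltW (P0 k%:Z i j)) hs n i0.
rewrite -expR_sum => h.
have p0 : 0 < rowsum (fprod (fun k : nat => Phimx w lam k%:Z) 0 n) i0.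
  apply: (fprod_rowsum_gt0 i0 (c_gt0 lam)) => k.
  have := bAP lam k%:Z w; rewrite /AP patchedE//; exact.
rewrite -[X in _ + X]expRK addrC -lnM ?posrE ?expR_gt0// ler_ln ?posrE//.
  by rewrite mulr_gt0// expR_gt0.
by apply: lt_le_trans h; rewrite mulr_gt0// expR_gt0.
Qed.

Lemma LK_to_LP lam (e : R) : (lam%:E <= lambda_crit eta)%E -> 0 < e ->
  exists K, (K0 <= K)%N /\ LP lam - e <= LK K lam.
Proof.
move=> hl e0; have /cvgrPdist_lt/(_ e e0)[n _ /(_ n (leqnn n))] := Rintegral_log_ratio_cvg hl.
rewrite /= sub0r normrN => h; exists (K0 + n)%N; split; first exact: leq_addr.
apply: le_trans (LP_le_LK_ratio (leq_addr n K0) hl).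
by rewrite lerD2l lerNl; apply: le_trans (ltW h); rewrite -normrN ler_norm.
Qed.

(** The logarithm of one factor in [fprod_square_ge]. *)
Definition log_mass K lam w : R := ln (lbound kappa K0 lam * mass (AK K lam 0 w)).

Lemma mass_between K lam k w : (K0 <= K)%N ->
  lbound kappa K0 lam <= mass (AK K lam k w) <= \sum_(i < d) \sum_(j < d) ubound K lam.
Proof.
move=> KK; have h := bAK lam KK k w.
have c0 := c_gt0 lam; apply/andP; split.
  have /andP[h1 _] := h i0 i0; apply: (le_trans h1).
  have p i j : 0 <= AK K lam k w i j.
    by have /andP[h2 _] := h i j; apply: le_trans h2; exact: ltW.
  rewrite /mass (bigD1 i0)//= {1}/rowsum (bigD1 i0)//= -addrA lerDl.
  by rewrite addr_ge0// sumr_ge0// => i _; rewrite sumr_ge0.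
by apply: ler_sum => i _; apply: ler_sum => j _; case/andP: (h i j).
Qed.

Lemma bmeas_log_mass K lam : (K0 <= K)%N -> bmeas (log_mass K lam).
Proof.
move=> KK; have c0 := c_gt0 lam.
apply: (@bmeas_ln _ (lbound kappa K0 lam * lbound kappa K0 lam)
  (lbound kappa K0 lam * \sum_(i < d) \sum_(j < d) ubound K lam)).
- exact: mulr_gt0.
- apply: measurable_funM; first exact: measurable_cst.
  by apply: measurable_sum => i; apply: measurable_sum => j; exact: measurable_AK.
- by move=> w; have /andP[h1 h2] := mass_between lam 0 w KK; rewrite !ler_wpM2l// ltW.
Qed.

Lemma LK_ge_log_mass K lam : (K0 <= K)%N ->
  \int[eta]_w (log_mass K lam w) <= 2 * LK K lam.
Proof.
move=> KK; have c0 := c_gt0 lam.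
have [w [hO [H1 H2]]] := ae_witness (filterI (ae_Omega A2)
  (filterI (aeLK lam KK) (birk (bmeas_log_mass lam KK)))).
have u := asymp_linear_odd H2.
have v := asymp_linearZ 2 (asymp_linear_odd (mgf_growth_asymp i0 H1)).
have : 2 * (\int[eta]_w (log_mass K lam w)) + 0 <= 2 * (2 * LK K lam).
  (* [fprod_square_ge] has no factor for level 0 and carries a factor c^2; both go into the
     constant. *)
  apply: (@asymp_linear_compare _ _ _ _ _ _ (log_mass K lam w - 2 * ln (lbound kappa K0 lam)) u v) => n.
  rewrite mulr0 addr0 birkhoff_sumS.
  have hB k i j : lbound kappa K0 lam <= B K lam w k i j.
    by have /andP[h _] := trunc_between i0 kappa0 A2 hK0 lam KK hO k i j.
  have := fprod_square_ge i0 c0 hB n i0.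
  have m0 k : 0 < lbound kappa K0 lam * mass (B K lam w k).
    have /andP[h _] := mass_between lam k%:Z w KK; rewrite /AK patchedE// in h.
    by rewrite mulr_gt0//; apply: lt_le_trans h.
  have pp : 0 < \prod_(k < n.*2) (lbound kappa K0 lam * mass (B K lam w k.+1)).
    by apply: prodr_gt0 => k _.
  have rp := trunc_rowsum_gt0 i0 kappa0 A2 hK0 lam 0 n.*2.+1 i0 KK hO.
  have cc : 0 < lbound kappa K0 lam ^+ 2 by rewrite exprn_gt0.
  rewrite -ler_ln ?posrE ?(mulr_gt0 cc pp) ?exprn_gt0//.
  rewrite lnM// !lnXn//.
  have -> : birkhoff_sum (@Defs.shift R d) (log_mass K lam) n.*2 (Defs.shift w) =
     ln (\prod_(k < n.*2) (lbound kappa K0 lam * mass (B K lam w k.+1))).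
    rewrite -[LHS]expRK /birkhoff_sum expR_sum; congr ln; apply: eq_bigr => k _.
    rewrite /log_mass -iterSr (iter_shiftE (AK_shift kappa K lam)) /AK patchedE// lnK//.
    by rewrite posrE; exact: (m0 k.+1).
  rewrite !mulr2n; move: (ln _) (ln _) (ln _) (log_mass _ _ _) => a b f g; lra.
by rewrite addr0 ler_pM2l.
Qed.

(** Above [lambda_crit] some entry of Phi at level 0 is infinite with positive probability. There
    [log_mass] increases to infinity with [K], so by monotone convergence its integrals cannot stay
    bounded. *)
Lemma log_mass_int_unbounded lam (b : R) : ~ (lam%:E <= lambda_crit eta)%E ->
  exists K, (K0 <= K)%N /\ b <= \int[eta]_w (log_mass K lam w).
Proof.
move=> hl; apply: contrapT => hn; have c0 := c_gt0 lam.
have KK n : (K0 <= K0 + n)%N by rewrite leq_addr.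
have hb n : \int[eta]_w (log_mass (K0 + n)%N lam w) <= b.
  by rewrite leNgt; apply/negP => h; apply: hn; exists (K0 + n)%N; split => //; exact: ltW.
(* A lower bound of [log_mass] valid for all truncations; subtracting it gives the nonnegative
   functions that monotone convergence requires. *)
pose m : R := ln (lbound kappa K0 lam * lbound kappa K0 lam).
pose f n w := (log_mass (K0 + n)%N lam w - m)%:E.
have bf n : bmeas (fun w => log_mass (K0 + n)%N lam w - m).
  by apply: bmeasD; [exact: bmeas_log_mass|exact: bmeas_cst].
have mf n : measurable_fun setT (f n) by apply/measurable_EFinP; case: (bf n).
have mass0 n w : 0 < mass (AK (K0 + n)%N lam 0 w).
  by have /andP[h _] := mass_between lam 0 w (KK n); apply: lt_le_trans h.
have cc := mulr_gt0 c0 c0.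
have cm n w := mulr_gt0 c0 (mass0 n w).
have f0 n w : setT w -> (0 <= f n w)%E.
  move=> _; rewrite lee_fin subr_ge0 ler_ln ?posrE ?cc ?cm// ler_wpM2l ?(ltW c0)//.
  by case/andP: (mass_between lam 0 w (KK n)).
have fnd w : setT w -> {homo f ^~ w : n n' / (n <= n')%N >-> (n <= n')%E}.
  move=> _ n n' nn'; rewrite lee_fin lerD2r ler_ln ?posrE ?cm// ler_wpM2l ?(ltW c0)//.
  apply: ler_sum => i _; apply: ler_sum => j _; rewrite /AK /patched.
  case: ifP => [/set_mem hw|_]; last by rewrite !mxE.
  by apply: (mgf_trunc_leK hw); rewrite ?expR_ge0// leq_add2l.
have cvgI := @cvg_monotone_convergence _ _ _ eta setT measurableT f mf f0 fnd.
have bound : (\int[eta]_(w in setT) limn (f ^~ w) <= (b - m)%:E)%E.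
  rewrite -(cvg_lim (@ereal_hausdorff _) cvgI); apply: lime_le.
    by apply/cvg_ex; eexists; exact: cvgI.
  apply: nearW => n; rewrite -(fineK (integrable_fin_num measurableT (bmeas_int eta (bf n)))).
  rewrite lee_fin -/(Rintegral eta setT (fun w => log_mass (K0 + n)%N lam w - m)).
  rewrite (RintegralDb eta (bmeas_log_mass lam (KK n)) (bmeas_cst (env R d) (- m))).
  by rewrite Rintegral_cstb lerD2r.
pose S := ~` fin_set lam `&` Omega_kappa kappa : set (env R d).
have mS : measurable S.
  apply: measurableI; last exact: measurable_Omega_kappa.
  by apply: measurableC; exact: measurable_fin_set.
have ae_compl : {ae eta, forall w, ~ S w} -> False.
  move=> h; have : {ae eta, forall w, fin_set lam w}.
    apply: filterS2 (ae_Omega A2) h => w hw nS; apply: contrapT => nf; exact: nS.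
  move=> /(full_ae (measurable_fin_set lam)) e.
  by apply: hl; apply: ereal_sup_ubound; exists lam.
have Spos : eta S != 0%E.
  apply/eqP => e; apply: ae_compl; exists S; split => //.
  by move=> w /contrapT.
have limS w : S w -> limn (f ^~ w) = +oo%E.
  move=> [nf hw]; have hc := ereal_nondecreasing_cvgn (fnd w Logic.I).
  rewrite (cvg_lim (@ereal_hausdorff _) hc); apply: eq_infty => r.
  have [i [j hij]] : exists i j, ~ (Phi w lam 0 i j < +oo)%E.
    apply: contrapT => H; apply: nf; apply/(fin_setP _ hw) => i j.
    by apply: contrapT => H'; apply: H; exists i, j.
  pose C : R := expR (r + m) / lbound kappa K0 lam.
  have [n hCn] : exists n, C < mgf_trunc n (expR lam) w 0 i j.
    apply: contrapT => H; apply: hij; apply: (@le_lt_trans _ _ C%:E); last exact: ltry.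
    by apply: (Phi_le hw) => n; rewrite leNgt; apply/negP => Hn; apply: H; exists n.
  apply: (@le_trans _ _ (f n w)); last by apply: ereal_sup_ubound; exists n.
  rewrite lee_fin lerBrDr -[leLHS]expRK ler_ln ?posrE ?expR_gt0 ?cm//.
  rewrite mulrC -ler_pdivrMr// -/C; apply: (le_trans (ltW hCn)).
  apply: (le_trans (mgf_trunc_leK hw 0 i j (expR_ge0 lam) (leq_addl K0 n))).
  have p a b' : 0 <= mgf_trunc (K0 + n) (expR lam) w 0 a b'.
    by apply: (mgf_trunc_ge0 hw); exact: expR_ge0.
  rewrite /AK patchedE// /mass (bigD1 i)//= {1}/rowsum (bigD1 j)//= -addrA lerDl.
  by rewrite addr_ge0// sumr_ge0// => a _; rewrite sumr_ge0.
have lim0 w : (0 <= limn (f ^~ w))%E.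
  apply: lime_ge; first by apply/cvg_ex; eexists; exact: (ereal_nondecreasing_cvgn (fnd w Logic.I)).
  by apply: nearW => n; exact: f0.
have : (+oo <= \int[eta]_(w in setT) limn (f ^~ w))%E.
  apply: (@le_trans _ _ (\int[eta]_(w in S) limn (f ^~ w))%E); last first.
    by apply: ge0_subset_integral => //; apply: measurable_limn_ereal.
  rewrite (@eq_integral _ _ _ _ _ (cst +oo%E)); last by move=> w /set_mem/limS.
  by rewrite integral_cst// gt0_mulye// lt0e Spos measure_ge0.
by move=> /le_trans/(_ bound); rewrite leye_eq.
Qed.

Lemma LK_to_infty lam (b : R) : ~ (lam%:E <= lambda_crit eta)%E ->
  exists K, (K0 <= K)%N /\ b <= LK K lam.
Proof.
move=> hl; have [K [KK h]] := log_mass_int_unbounded (2 * b) hl.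
by exists K; split => //; rewrite -(ler_pM2l (ltr0n _ 2)); apply: (le_trans h); exact: LK_ge_log_mass.
Qed.

End LKLimits.

(** * Choice of tilts *)

Section SlopeSelection.
Context (R : realType) (L : R -> R) (K : R).
Hypothesis L_mid : forall x y, 2 * L ((x + y) / 2) <= L x + L y.
Hypothesis L_incr : forall x h, 0 <= h -> L x + h <= L (x + h) <= L x + K * h.

Let D (x0 eta : R) (k : nat) := L (x0 + k.+1%:R * eta) - L (x0 + k%:R * eta).

Let D_le x0 eta k : 0 <= eta -> D x0 eta k <= D x0 eta k.+1.
Proof.
move=> e0; rewrite /D; have := L_mid (x0 + k%:R * eta) (x0 + k.+2%:R * eta).
have -> : (x0 + k%:R * eta + (x0 + k.+2%:R * eta)) / 2 = x0 + k.+1%:R * eta.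
  by rewrite -!natr1; field.
by move: (L _) (L _) (L _) => a b c; lra.
Qed.

Let D_mono x0 eta k n : 0 <= eta -> (k <= n)%N -> D x0 eta k <= D x0 eta n.
Proof.
move=> e0 /subnKC <-; elim: (n - k)%N => [|m IH]; first by rewrite addn0.
by apply: (le_trans IH); rewrite addnS D_le.
Qed.

Let D_range x0 eta k : 0 <= eta -> eta <= D x0 eta k <= K * eta.
Proof.
move=> e0; have := L_incr (x0 + k%:R * eta) e0.
have -> : x0 + k%:R * eta + eta = x0 + k.+1%:R * eta by rewrite -natr1; ring.
by rewrite /D; move: (L _) (L _) => a b /andP[h1 h2]; apply/andP; split; lra.
Qed.

(* The slopes over consecutive cells stay in [1, K], so they cannot jump by more than
   e at each of many grid points. *)
Let small_jump x0 eta e N : 0 < eta -> 0 < e -> K <= N%:R * e ->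
  exists2 k, (k < N)%N & D x0 eta k.+1 - D x0 eta k <= e * eta.
Proof.
move=> eta0 e0 hN; apply: contrapT => H.
have J k : (k < N)%N -> e * eta < D x0 eta k.+1 - D x0 eta k.
  by move=> kN; rewrite ltNge; apply/negP => h; apply: H; exists k.
have S n : (n <= N)%N -> n%:R * (e * eta) <= D x0 eta n - D x0 eta 0.
  elim: n => [|n IH] nN; first by rewrite mul0r subrr.
  have := IH (ltnW nN); have := J n nN; rewrite -natr1 mulrDl mul1r.
  by move: (D _ _ _) (D _ _ _) (D _ _ _) => a b c; lra.
have := S N (leqnn N); have /andP[_ h1] := D_range x0 N (ltW eta0).
have /andP[h2 _] := D_range x0 0 (ltW eta0).
have : K * eta <= N%:R * e * eta by rewrite ler_wpM2r// ltW.
rewrite mulrA; move: h1 h2; move: (D _ _ _) (D _ _ _) => a b; lra.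
Qed.

Variables (t lam0 delta e : R).
Hypothesis delta0 : 0 < delta.
Hypothesis e0 : 0 < e.
Hypothesis lam0_max : forall lam, L lam0 - L lam <= t * (lam0 - lam).

Lemma grid_exists : exists N : nat, K <= N%:R * e.
Proof.
exists (Num.truncn (K / e)).+1; rewrite -ler_pdivrMr//; exact/ltW/truncnS_gt.
Qed.

(** Among [N.+1] cells ending at [lam0], take two neighbours with almost equal slopes. By convexity
    the slope of the left one is at most that of the last cell, which is at most [t] because [lam0]
    maximises [lam * t - L lam]. *)
Lemma select_left : exists lam eta, [/\ 0 < eta, lam0 - delta <= lam <= lam0,
  L lam - L (lam - eta) <= t * eta &
  L (lam + eta) - L lam <= L lam - L (lam - eta) + e * eta].
Proof.
have [N hN] := grid_exists; pose eta := delta / N.+1%:R; pose x0 := lam0 - delta.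
have eta0 : 0 < eta by rewrite divr_gt0.
have [k kN hk] := small_jump x0 eta0 e0 hN.
have xN : x0 + N.+1%:R * eta = lam0.
  rewrite /x0 /eta [N.+1%:R * _]mulrC divfK; last by rewrite pnatr_eq0.
  by rewrite subrK.
exists (x0 + k.+1%:R * eta), eta; split => //.
- apply/andP; split; first by rewrite lerDl mulr_ge0// ltW.
  by rewrite -xN lerD2l ler_wpM2r ?(ltW eta0)// ler_nat; lia.
- have -> : x0 + k.+1%:R * eta - eta = x0 + k%:R * eta by rewrite -natr1; ring.
  apply: (@le_trans _ _ (D x0 eta N)); first exact: (D_mono _ (ltW eta0) (ltnW kN)).
  rewrite /D xN; apply: (le_trans (lam0_max _)).
  have -> : lam0 - (x0 + N%:R * eta) = eta by rewrite -xN -natr1; ring.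
  exact: lexx.
- have -> : x0 + k.+1%:R * eta - eta = x0 + k%:R * eta by rewrite -natr1; ring.
  have -> : x0 + k.+1%:R * eta + eta = x0 + k.+2%:R * eta by rewrite -[k.+2%:R]natr1; ring.
  by move: hk; rewrite /D; move: (L _) (L _) (L _) => a b c; lra.
Qed.

(** The mirror image: the grid starts at [lam0], and its first cell already has slope at least
    [t]. *)
Lemma select_right : exists lam eta, [/\ 0 < eta, lam0 <= lam <= lam0 + delta,
  t * eta <= L lam - L (lam - eta) &
  L (lam + eta) - L lam <= L lam - L (lam - eta) + e * eta].
Proof.
have [N hN] := grid_exists; pose eta := delta / N.+1%:R; pose x0 := lam0.
have eta0 : 0 < eta by rewrite divr_gt0.
have [k kN hk] := small_jump x0 eta0 e0 hN.
exists (x0 + k.+1%:R * eta), eta; split => //.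
- apply/andP; split; first by rewrite lerDl mulr_ge0// ltW.
  rewrite lerD2l -[leRHS](divfK (x := N.+1%:R)) ?pnatr_eq0// -/eta mulrC.
  by rewrite ler_wpM2l ?(ltW eta0)// ler_nat; lia.
- have -> : x0 + k.+1%:R * eta - eta = x0 + k%:R * eta by rewrite -natr1; ring.
  apply: (@le_trans _ _ (D x0 eta 0)); last exact: (D_mono _ (ltW eta0) (leq0n k)).
  rewrite /D mul0r addr0 mul1r; have := lam0_max (x0 + eta).
  rewrite /x0; have -> : t * (lam0 - (lam0 + eta)) = - (t * eta) by ring.
  by move: (L _) (L _) => a b; lra.
- have -> : x0 + k.+1%:R * eta - eta = x0 + k%:R * eta by rewrite -natr1; ring.
  have -> : x0 + k.+1%:R * eta + eta = x0 + k.+2%:R * eta by rewrite -[k.+2%:R]natr1; ring.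
  by move: hk; rewrite /D; move: (L _) (L _) (L _) => a b c; lra.
Qed.

End SlopeSelection.

(** * Tail bounds and tilting for polynomials with nonnegative coefficients *)

Section Windows.
Context (R : realType).
Implicit Types (p q f g : {poly R}) (A B x eta : R).

Definition nneg_poly p := forall m, 0 <= p`_m.

(** For a generating polynomial of a passage time, the restriction to the event that the time lies
    in [[A, B]]. *)
Definition win p A B : {poly R} :=
  \poly_(m < size p) (if A <= m%:R <= B then p`_m else 0).

Lemma coef_win p A B m : (win p A B)`_m = if A <= m%:R <= B then p`_m else 0.
Proof.
by rewrite coef_poly; case: ltnP => // h; rewrite nth_default// if_same.
Qed.

Lemma win_nneg p A B : nneg_poly p -> nneg_poly (win p A B).
Proof. by move=> h m; rewrite coef_win; case: ifP. Qed.

Lemma win_sum (I : finType) (f : I -> {poly R}) A B :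
  win (\sum_i f i) A B = \sum_i win (f i) A B.
Proof.
apply/polyP => m; rewrite coef_win !coef_sum; case: ifP => h.
  by apply: eq_bigr => i _; rewrite coef_win h.
by rewrite big1// => i _; rewrite coef_win h.
Qed.

Lemma horner_nneg_le p q z : 0 <= z -> (forall m, p`_m <= q`_m) -> p.[z] <= q.[z].
Proof.
move=> z0 h; rewrite (horner_coef_wide _ (leq_maxl (size p) (size q))).
rewrite (horner_coef_wide _ (leq_maxr (size p) (size q))).
by apply: ler_sum => m _; rewrite ler_wpM2r// exprn_ge0.
Qed.

(* Chernoff bounds for both tails. *)
Lemma win_ge p A B x eta : nneg_poly p -> 0 <= eta ->
  p.[expR x] - expR (- (eta * B)) * p.[expR (x + eta)] - expR (eta * A) * p.[expR (x - eta)]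
  <= (win p A B).[expR x].
Proof.
move=> p0 e0; rewrite !lerBlDr.
rewrite (@horner_coef_wide _ (size p) (win p A B)) ?size_poly//.
rewrite !horner_coef !mulr_sumr -!big_split/=; apply: ler_sum => m _.
rewrite coef_win.
have E y : expR (x + y) ^+ m = expR x ^+ m * expR (y * m%:R).
  by rewrite expRD exprMn expRM_natr.
have X0 : 0 <= p`_m * expR x ^+ m by rewrite mulr_ge0// exprn_ge0// expR_ge0.
have t1 : expR (- (eta * B)) * (p`_m * expR (x + eta) ^+ m) =
  p`_m * expR x ^+ m * expR (eta * (m%:R - B)).
  by rewrite E mulrBr addrC expRD; ring.
have t2 : expR (eta * A) * (p`_m * expR (x - eta) ^+ m) =
  p`_m * expR x ^+ m * expR (eta * (A - m%:R)).
  by rewrite E mulrBr expRD mulNr; ring.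
rewrite t1 t2; set X := p`_m * _ in X0 *.
have T1 := mulr_ge0 X0 (expR_ge0 (eta * (m%:R - B))).
have T2 := mulr_ge0 X0 (expR_ge0 (eta * (A - m%:R))).
case: (leP A m%:R) => h1 /=; last first.
  have : X <= X * expR (eta * (A - m%:R)).
    rewrite -[leLHS]mulr1 ler_wpM2l// -[leLHS]expR0 ler_expR mulr_ge0// subr_ge0 ltW//.
  rewrite mul0r; lra.
case: (leP m%:R B) => h2 /=; first by rewrite -/X; lra.
have : X <= X * expR (eta * (m%:R - B)).
  rewrite -[leLHS]mulr1 ler_wpM2l// -[leLHS]expR0 ler_expR mulr_ge0// subr_ge0 ltW//.
rewrite mul0r; lra.
Qed.

(** Undoing the tilts [x] and [y] on two consecutive blocks: inside the windows the tilting weight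
    is at most exp(E), and the total time stays in [[A, B]]. *)
Lemma win_mul f g A B A1 B1 A2 B2 x y E : nneg_poly f -> nneg_poly g ->
  (forall m1 m2 : R, A1 <= m1 <= B1 -> A2 <= m2 <= B2 ->
     A <= m1 + m2 <= B /\ x * m1 + y * m2 <= E) ->
  expR (- E) * ((win f A1 B1).[expR x] * (win g A2 B2).[expR y]) <= (win (f * g) A B).[1].
Proof.
move=> f0 g0 h.
have wf := win_nneg A1 B1 f0; have wg := win_nneg A2 B2 g0.
apply: (@le_trans _ _ (win f A1 B1 * win g A2 B2).[1]); last first.
  apply: horner_nneg_le => // m; rewrite coef_win !coefM.
  case: ifP => hm.
    apply: ler_sum => j _; rewrite !coef_win; apply: ler_pM; rewrite ?coef_win//;
    by case: ifP.
  rewrite le_eqVlt; apply/orP; left; apply/eqP; apply: big1 => j _.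
  rewrite !coef_win; case: ifP => h1; last by rewrite mul0r.
  case: ifP => h2; last by rewrite mulr0.
  have [] := h _ _ h1 h2; rewrite -natrD subnKC ?hm//.
  by rewrite -ltnS.
rewrite hornerM !horner_coef mulr_suml mulr_sumr [leRHS]mulr_suml; apply: ler_sum => a _.
rewrite !mulr_sumr; apply: ler_sum => b _.
have wa := wf a; have wb := wg b; rewrite !expr1n !mulr1.
rewrite [X in _ * X](_ : _ = (win f A1 B1)`_a * (win g A2 B2)`_b * expR (x * a%:R + y * b%:R)); last first.
  by rewrite expRD !expRM_natr; ring.
rewrite mulrCA -expRD; move: wa wb; rewrite !coef_win.
case: ifP => h1; last by rewrite !mul0r.
case: ifP => h2; last by rewrite mulr0 mul0r.
move=> fa gb; rewrite ler_piMr ?mulr_ge0// -[leRHS]expR0 ler_expR addrC subr_le0.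
by have [] := h _ _ h1 h2.
Qed.

End Windows.

(** * Deterministic lower bound *)

Section BlockGrowth.
Context (R : realType) (d : nat) (i0 : 'I_d).

(** The error is measured by the right end [a + l] of the block, since the ergodic theorem controls
    only products starting at 0. *)
Definition block_growth (s : nat -> nat -> 'I_d -> R) (m : R) :=
  forall e : R, 0 < e -> exists D : R, forall a l j,
    `|ln (s a l j) - l%:R * m| <= e * (a + l)%:R + D.

(** Up to a constant factor the block product is the quotient of the products over the first [a + l]
    and the first [a] levels; each of them receives half of [e]. *)
Lemma mgf_block_growth (B : nat -> 'M[R]_d) c C m : 0 < c ->
  (forall k, mx_between c C (B k)) -> mgf_growth B m ->
  block_growth (fun a l j => rowsum (fprod B a l) j) m.
Proof.
move=> c0 hB hm e e0; have cC := mx_between_leC i0 (hB 0%N).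
have C0 := lt_le_trans c0 cC.
have [D hD] := hm (e / 2) (divr_gt0 e0 (ltr0n _ 2)).
exists (2 * D + ln (C / c)) => a l j.
have p0 b n i : 0 < rowsum (fprod B b n) i by exact: (fprod_rowsum_gt0 i0 c0).
have k0 : 0 < C / c by rewrite divr_gt0.
have := fprod_rowsum_split i0 c0 0 a l i0 j hB; rewrite add0n -[c / C]invf_div.
move: (C / c) k0 => k k0 /andP[h1 h2]; have k0' : 0 < k^-1 by rewrite invr_gt0.
have l1 : ln (k^-1 * (rowsum (fprod B 0 a) i0 * rowsum (fprod B a l) j)) <=
    ln (rowsum (fprod B 0 (a + l)) i0).
  by rewrite ler_ln ?posrE//; rewrite mulr_gt0// mulr_gt0.
have l2 : ln (rowsum (fprod B 0 (a + l)) i0) <=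
    ln (k * (rowsum (fprod B 0 a) i0 * rowsum (fprod B a l) j)).
  by rewrite ler_ln ?posrE//; rewrite mulr_gt0// mulr_gt0.
rewrite !lnM ?posrE ?(mulr_gt0 (p0 _ _ _) (p0 _ _ _))// in l1 l2.
rewrite lnV ?posrE// in l1.
have := hD a i0; have := hD (a + l)%N i0; rewrite !ler_norml natrD.
move: l1 l2; move: (ln (rowsum _ _)) (ln (rowsum _ _)) (ln (rowsum _ _)) (ln _) => x y z t.
rewrite mulrDl; move=> l1 l2 /andP[h3 h4] /andP[h5 h6].
have ea : 0 <= e * l%:R by rewrite mulr_ge0// ltW.
have E1 : e / 2 * (a%:R + l%:R) = (e * a%:R) / 2 + (e * l%:R) / 2 by ring.
have E2 : e / 2 * a%:R = (e * a%:R) / 2 by ring.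
have E3 : e * (a%:R + l%:R) = e * a%:R + e * l%:R by ring.
rewrite E3; rewrite E1 in h3 h4; rewrite E2 in h5 h6.
by apply/andP; split; lra.
Qed.

End BlockGrowth.

Section LowerBound.
Context (R : realType) (d : nat).
Variable U : nat -> 'M[{poly R}]_d.
Hypothesis U0 : forall a n i j, nneg_poly (fprod U a n i j).
Hypothesis Upos : forall a n i x, 0 < (rowsum (fprod U a n) i).[expR x].

Definition polyrate x (m : R) :=
  block_growth (fun a l j => (rowsum (fprod U a l) j).[expR x]) m.

Lemma rowsum_nneg a n i : nneg_poly (rowsum (fprod U a n) i).
Proof. by move=> m; rewrite /rowsum coef_sum sumr_ge0// => j _; exact: U0. Qed.

Lemma large_nat (e D : R) : 0 < e -> exists N : nat, forall n : nat, (N <= n)%N -> D <= e * n%:R.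
Proof.
move=> e0; exists (Num.truncn (D / e)).+1 => n hn.
rewrite mulrC -ler_pdivrMr//; apply: le_trans (ltW (truncnS_gt _)) _.
by rewrite ler_nat.
Qed.

(** Chernoff bounds with the parameters [x + eta] and [x - eta]: each tail is smaller than the whole
    by about exp(- n eta e0), so most of the tilted mass lies between the two difference quotients.
    The margin is [n * e0], not [l * e0], so that short blocks are covered as well. *)
Lemma concentration x eta Lm L0 Lp e0 dl : 0 < eta -> 0 < e0 -> 0 < dl ->
  polyrate (x - eta) Lm -> polyrate x L0 -> polyrate (x + eta) Lp ->
  exists N : nat, forall n a l j, (N <= n)%N -> (a + l <= n)%N ->
    expR (l%:R * L0 - dl * n%:R) <=
    (win (rowsum (fprod U a l) j) (l%:R * ((L0 - Lm) / eta) - n%:R * e0)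
       (l%:R * ((Lp - L0) / eta) + n%:R * e0)).[expR x].
Proof.
move=> eta0 e00 dl0 hm h0 hp.
(* The first bound keeps the errors of the rates below the Chernoff gain [eta * e0], the second
   below the allowed loss [dl]. *)
pose e := Num.min (eta * e0 / 4) (dl / 2).
have e_gt0 : 0 < e by rewrite lt_min !divr_gt0// mulr_gt0.
have e1 : 4 * e <= eta * e0.
  have : e <= eta * e0 / 4 by rewrite ge_min lexx.
  lra.
have e2 : 2 * e <= dl.
  have : e <= dl / 2 by rewrite ge_min lexx orbT.
  lra.
have [D1 H1] := hm e e_gt0; have [D2 H2] := h0 e e_gt0; have [D3 H3] := hp e e_gt0.
pose D := `|D1| + `|D2| + `|D3|.
(* Beyond the additive constants a surplus of 3 is kept: each tail is then at most exp(-3) <= 1/4 of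
   the total, leaving half. *)
have [N hN] := large_nat (2 * D + 3) e_gt0.
exists N => n a l j Nn aln.
have en := hN n Nn.
have D1D : D1 <= D by rewrite /D; have := ler_norm D1; have := normr_ge0 D2; have := normr_ge0 D3; lra.
have D2D : D2 <= D by rewrite /D; have := ler_norm D2; have := normr_ge0 D1; have := normr_ge0 D3; lra.
have D3D : D3 <= D by rewrite /D; have := ler_norm D3; have := normr_ge0 D2; have := normr_ge0 D1; lra.
have D0 : 0 <= D by rewrite /D !addr_ge0.
have aln' : e * (a + l)%:R <= e * n%:R by rewrite ler_wpM2l ?(ltW e_gt0)// ler_nat.
set p := rowsum _ j.
set A := _ - n%:R * e0; set B := _ + n%:R * e0.
have p0 : nneg_poly p by exact: rowsum_nneg.
have := @win_ge R p A B x eta p0 (ltW eta0).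
have P0 : 0 < p.[expR x] by exact: Upos.
have Pp : 0 < p.[expR (x + eta)] by exact: Upos.
have Pm : 0 < p.[expR (x - eta)] by exact: Upos.
have := H1 a l j; have := H2 a l j; have := H3 a l j; rewrite -/p !ler_norml.
move=> /andP[_ K3] /andP[K2 _] /andP[_ K1].
have expn3 : expR (- 3) <= 1 / 4 :> R.
  rewrite expRN mul1r lef_pV2 ?posrE ?expR_gt0//.
  by apply: le_trans (expR_ge1Dx 3); lra.
have expn1 : expR (- 1) <= 1 / 2 :> R.
  rewrite expRN mul1r lef_pV2 ?posrE ?expR_gt0//.
  by apply: le_trans (expR_ge1Dx 1); lra.
have net : n%:R * (eta * e0) >= 4 * (e * n%:R).
  have : n%:R * (4 * e) <= n%:R * (eta * e0) by rewrite ler_wpM2l.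
  by have -> : n%:R * (4 * e) = 4 * (e * n%:R) by ring.
have etaN : eta != 0 by rewrite gt_eqF.
have tail (y q : R) : 0 < q -> y + ln q <= l%:R * L0 - n%:R * (eta * e0) + e * n%:R + D ->
    expR y * q <= p.[expR x] / 4.
  move=> q0 hy; rewrite -[q in X in X <= _](lnK (x := q)) ?posrE// -expRD.
  apply: (@le_trans _ _ (p.[expR x] * expR (- 3))); last by rewrite ler_wpM2l ?(ltW P0)//; lra.
  rewrite -[p.[_]](lnK (x := p.[expR x])) ?posrE// -expRD ler_expR.
  by move: K2 hy net; move: (ln _) (ln _) (n%:R * (eta * e0)) => u v z; lra.
have T1 : expR (- (eta * B)) * p.[expR (x + eta)] <= p.[expR x] / 4.
  apply: tail => //; have -> : eta * B = l%:R * Lp - l%:R * L0 + n%:R * (eta * e0).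
    by rewrite /B; field.
  by move: K3; move: (ln _) (n%:R * (eta * e0)) => u z; lra.
have T2 : expR (eta * A) * p.[expR (x - eta)] <= p.[expR x] / 4.
  apply: tail => //; have -> : eta * A = l%:R * L0 - l%:R * Lm - n%:R * (eta * e0).
    by rewrite /A; field.
  by move: K1; move: (ln _) (n%:R * (eta * e0)) => u z; lra.
move=> h; apply: le_trans h.
have : expR (l%:R * L0 - dl * n%:R) <= p.[expR x] / 2.
  apply: (@le_trans _ _ (p.[expR x] * expR (- 1))); last by rewrite ler_wpM2l ?(ltW P0)//; lra.
  rewrite -[p.[_]](lnK (x := p.[expR x])) ?posrE// -expRD ler_expR.
  have dn : 2 * (e * n%:R) <= dl * n%:R.
    by have := ler_wpM2r (ler0n R n) e2; rewrite mulrA.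
  by move: K2 dn; move: (ln _) (dl * n%:R) => u z; lra.
by move: T1 T2; lra.
Qed.

Variables (L : R -> R) (K : R).
Hypothesis L_incr : forall x h, 0 <= h -> L x + h <= L (x + h) <= L x + K * h.

(* Tilt by exp (lam1 T) over the first a levels and by exp (lam2 T) over the others,
   with a chosen so that the two typical passage times add up to n t. *)
Lemma two_tilts (lam0 t delta e0 dl : R) (lam1 eta1 lam2 eta2 : R) :
  0 < delta -> 0 < e0 -> 0 < dl -> 0 < eta1 -> 0 < eta2 ->
  lam0 - delta <= lam1 <= lam0 -> lam0 <= lam2 <= lam0 + delta ->
  L lam1 - L (lam1 - eta1) <= t * eta1 ->
  L (lam1 + eta1) - L lam1 <= L lam1 - L (lam1 - eta1) + e0 * eta1 ->
  t * eta2 <= L lam2 - L (lam2 - eta2) ->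
  L (lam2 + eta2) - L lam2 <= L lam2 - L (lam2 - eta2) + e0 * eta2 ->
  (forall x, x \in [:: lam1 - eta1; lam1; lam1 + eta1; lam2 - eta2; lam2; lam2 + eta2] ->
    polyrate x (L x)) ->
  exists N : nat, forall n i, (N <= n)%N ->
    expR (n%:R * (L lam0 - lam0 * t - (4 * `|lam0| * e0 + 2 * delta * (K + e0) + 2 * dl + K * delta)))
    <= (win (rowsum (fprod U 0 n) i) (n%:R * t - n%:R * (4 * e0)) (n%:R * t + n%:R * (4 * e0))).[1].
Proof.
move=> delta0 e00 dl0 eta10 eta20 hl1 hl2 hs1 hs1' hs2 hs2' hrate.
have r1 : polyrate (lam1 - eta1) (L (lam1 - eta1)) by apply: hrate; rewrite !inE eqxx ?orbT.
have r2 : polyrate lam1 (L lam1) by apply: hrate; rewrite !inE eqxx ?orbT.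
have r3 : polyrate (lam1 + eta1) (L (lam1 + eta1)) by apply: hrate; rewrite !inE eqxx ?orbT.
have r4 : polyrate (lam2 - eta2) (L (lam2 - eta2)) by apply: hrate; rewrite !inE eqxx ?orbT.
have r5 : polyrate lam2 (L lam2) by apply: hrate; rewrite !inE eqxx ?orbT.
have r6 : polyrate (lam2 + eta2) (L (lam2 + eta2)) by apply: hrate; rewrite !inE eqxx ?orbT.
have [N1 HN1] := concentration eta10 e00 dl0 r1 r2 r3.
have [N2 HN2] := concentration eta20 e00 dl0 r4 r5 r6.
have [N3 hN3] := large_nat K e00.
exists (maxn N1 (maxn N2 N3)) => n i; rewrite !geq_max => /and3P[n1 n2 n3].
pose s1 := (L lam1 - L (lam1 - eta1)) / eta1; pose s1' := (L (lam1 + eta1) - L lam1) / eta1.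
pose s2 := (L lam2 - L (lam2 - eta2)) / eta2; pose s2' := (L (lam2 + eta2) - L lam2) / eta2.
have s1t : s1 <= t by rewrite ler_pdivrMr.
have s2t : t <= s2 by rewrite ler_pdivlMr.
have s11 : s1' <= s1 + e0 by rewrite ler_pdivrMr// mulrDl divfK// gt_eqF.
have s22 : s2' <= s2 + e0 by rewrite ler_pdivrMr// mulrDl divfK// gt_eqF.
have slope (x h : R) : 0 < h -> 1 <= (L (x + h) - L x) / h <= K.
  move=> h0; have /andP[a1 a2] := L_incr x (ltW h0).
  by rewrite ler_pdivlMr// ler_pdivrMr// mul1r; move: (L _) (L _) a1 a2 => u v a1 a2;
    apply/andP; split; lra.
have s1r : 1 <= s1 <= K by have := slope (lam1 - eta1) eta1 eta10; rewrite subrK.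
have s2r : 1 <= s2 <= K by have := slope (lam2 - eta2) eta2 eta20; rewrite subrK.
have s1r' : 1 <= s1' <= K by exact: slope.
have s2r' : 1 <= s2' <= K by exact: slope.
have Kn : K <= n%:R * e0 by rewrite mulrC; exact: hN3.
(* The length [a] is [n] times the weight that averages [s1] and [s2] to [t], rounded down. Rounding
   costs at most [s2 - s1 <= K], which [n * e0] absorbs; if the slopes do not differ, both equal
   [t]. *)
have [a an ha] : exists2 a : nat, (a <= n)%N &
    n%:R * t <= a%:R * s1 + (n - a)%:R * s2 <= n%:R * t + n%:R * e0.
  case: (leP s2 s1) => s12.
    exists 0%N => //; rewrite subn0 mul0r add0r.
    have -> : s2 = t by apply/eqP; rewrite eq_le s2t (le_trans s12).
    by rewrite lexx lerDl mulr_ge0// ltW.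
  have D0 : 0 < s2 - s1 by rewrite subr_gt0.
  pose al := (s2 - t) / (s2 - s1).
  have al0 : 0 <= al by rewrite divr_ge0 ?subr_ge0// ltW.
  have al1 : al <= 1 by rewrite ler_pdivrMr// mul1r lerD2l lerN2.
  have nal : 0 <= n%:R * al by rewrite mulr_ge0.
  have alE : al * (s2 - s1) = s2 - t by rewrite divfK// gt_eqF.
  exists (Num.truncn (n%:R * al)).
    rewrite -(ler_nat R); apply: (@le_trans _ _ (n%:R * al)); first by rewrite truncn_le.
    by rewrite -[leRHS]mulr1 ler_wpM2l.
  have bn : (Num.truncn (n%:R * al) <= n)%N.
    rewrite -(ler_nat R); apply: (@le_trans _ _ (n%:R * al)); first by rewrite truncn_le.
    by rewrite -[leRHS]mulr1 ler_wpM2l.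
  have hb2 : (Num.truncn (n%:R * al))%:R <= n%:R * al by rewrite truncn_le.
  rewrite natrB//; have := truncnS_gt (n%:R * al).
  rewrite -natr1; move: (Num.truncn _)%:R hb2 => b hb2 hb1.
  have E : b * s1 + (n%:R - b) * s2 = n%:R * t + (n%:R * al - b) * (s2 - s1).
    have nE : n%:R * al * (s2 - s1) = n%:R * (s2 - t) by rewrite -mulrA alE.
    have -> : (n%:R * al - b) * (s2 - s1) = n%:R * al * (s2 - s1) - b * (s2 - s1) by ring.
    by rewrite nE; ring.
  have pos : 0 <= (n%:R * al - b) * (s2 - s1) by rewrite mulr_ge0 ?subr_ge0// ltW.
  rewrite E lerDl pos /= lerD2l.
  apply: le_trans Kn; rewrite -[leRHS]mul1r; apply: ler_pM; rewrite ?subr_ge0//.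
  - exact: ltW.
  - by rewrite lerBlDr addrC ltW.
  - by have := s1r; have := s2r; lra.
pose l := (n - a)%N; have nal : (a + l = n)%N by rewrite subnKC.
pose A1 := a%:R * s1 - n%:R * e0; pose B1 := a%:R * s1' + n%:R * e0.
pose A2 := l%:R * s2 - n%:R * e0; pose B2 := l%:R * s2' + n%:R * e0.
pose A := n%:R * t - n%:R * (4 * e0); pose B := n%:R * t + n%:R * (4 * e0).
(* A bound for the total tilting exponent: the ideal value at [lam0], the deviation of the total
   time from [n * t], and the replacement of [lam1] and [lam2] by [lam0] in the two blocks. *)
pose E := lam0 * (n%:R * t) + n%:R * (4 * `|lam0| * e0 + 2 * delta * (K + e0)).
have n0 : 0 <= n%:R :> R by [].
have a0 : 0 <= a%:R :> R by []. have l0 : 0 <= l%:R :> R by [].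
have anl : a%:R + l%:R = n%:R :> R by rewrite -natrD nal.
have ne0 : 0 <= n%:R * e0 by rewrite mulr_ge0// ltW.
have H m1 m2 : A1 <= m1 <= B1 -> A2 <= m2 <= B2 ->
    A <= m1 + m2 <= B /\ lam1 * m1 + lam2 * m2 <= E.
  move=> /andP[ma1 mb1] /andP[ma2 mb2].
  have q1 : a%:R * s1' <= a%:R * s1 + a%:R * e0 by rewrite -mulrDr ler_wpM2l.
  have q2 : l%:R * s2' <= l%:R * s2 + l%:R * e0 by rewrite -mulrDr ler_wpM2l.
  have q3 : a%:R * e0 + l%:R * e0 = n%:R * e0 by rewrite -mulrDl anl.
  have AB : A <= m1 + m2 <= B.
    rewrite /A /B mulrCA; move: ma1 mb1 ma2 mb2 ha; rewrite /A1 /B1 /A2 /B2 -/l.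
    move=> ma1 mb1 ma2 mb2 /andP[ha1 ha2].
    by move: (n%:R * e0) ne0 ma1 mb1 ma2 mb2 ha2 q3 => z ne0 ma1 mb1 ma2 mb2 ha2 q3; apply/andP; split; lra.
  split=> //.
  have bnd (b : nat) (m s s' : R) : (b <= n)%N -> 1 <= s <= K -> 1 <= s' <= K ->
      b%:R * s - n%:R * e0 <= m -> m <= b%:R * s' + n%:R * e0 -> `|m| <= n%:R * (K + e0).
    move=> bn /andP[ss1 ss2] /andP[ss3 ss4] u1 u2.
    have b0 : 0 <= b%:R :> R by [].
    have bs : 0 <= b%:R * s by rewrite mulr_ge0//; lra.
    have bs' : b%:R * s' <= n%:R * K.
      by apply: ler_pM; rewrite ?ler_nat//; lra.
    have nK : 0 <= n%:R * K by rewrite mulr_ge0//; lra.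
    rewrite mulrDr ler_norml; move: (n%:R * e0) (n%:R * K) ne0 u1 u2 bs' nK => z y *.
    by apply/andP; split; lra.
  have M1 := bnd a m1 s1 s1' an s1r s1r' ma1 mb1.
  have M2 := bnd l m2 s2 s2' (leq_subr _ _) s2r s2r' ma2 mb2.
  have D1 : (lam1 - lam0) * m1 <= delta * (n%:R * (K + e0)).
    apply: (le_trans (ler_norm _)); rewrite normrM; apply: ler_pM => //.
    by rewrite ler_norml; case/andP: hl1 => *; apply/andP; split; lra.
  have D2 : (lam2 - lam0) * m2 <= delta * (n%:R * (K + e0)).
    apply: (le_trans (ler_norm _)); rewrite normrM; apply: ler_pM => //.
    by rewrite ler_norml; case/andP: hl2 => *; apply/andP; split; lra.
  have D3 : lam0 * (m1 + m2 - n%:R * t) <= `|lam0| * (n%:R * (4 * e0)).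
    apply: (le_trans (ler_norm _)); rewrite normrM ler_wpM2l//.
    by move: AB; rewrite /A /B => /andP[v1 v2]; rewrite ler_norml; apply/andP; split; lra.
  have -> : lam1 * m1 + lam2 * m2 = lam0 * (n%:R * t) + lam0 * (m1 + m2 - n%:R * t) +
     (lam1 - lam0) * m1 + (lam2 - lam0) * m2 by ring.
  have -> : E = lam0 * (n%:R * t) + `|lam0| * (n%:R * (4 * e0)) + delta * (n%:R * (K + e0)) +
     delta * (n%:R * (K + e0)) by rewrite /E; ring.
  by rewrite !lerD.
rewrite -[in rowsum _ _]nal fprodD rowsum_mulmx win_sum horner_sum add0n.
(* Split according to the height [k] at which the second block is entered. Concentration there is
   uniform in [k], so the sum over [k] restores the row sum of the first block. *)
apply: (@le_trans _ _ (\sum_k expR (- E) * ((win (fprod U 0 a i k) A1 B1).[expR lam1] *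
    (win (rowsum (fprod U a l) k) A2 B2).[expR lam2]))); last first.
  apply: ler_sum => k _; exact: (win_mul (@U0 0%N a i k) (@rowsum_nneg a l k) H).
apply: (@le_trans _ _ (\sum_k expR (- E) * ((win (fprod U 0 a i k) A1 B1).[expR lam1] *
    expR (l%:R * L lam2 - dl * n%:R)))); last first.
  apply: ler_sum => k _; rewrite ler_wpM2l ?expR_ge0// ler_wpM2l//.
    have -> : 0 = (0 : {poly R}).[expR lam1] by rewrite horner0.
    apply: horner_nneg_le; first exact: expR_ge0.
    by move=> m; rewrite coef0; exact: (win_nneg A1 B1 (@U0 0%N a i k)).
  by apply: HN2 => //; rewrite nal.
rewrite -mulr_sumr -mulr_suml -horner_sum -win_sum.
have := HN1 n 0%N a i n1; rewrite add0n => /(_ an); rewrite -/s1 -/s1' -/A1 -/B1 => h1.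
apply: (@le_trans _ _ (expR (- E) * (expR (a%:R * L lam1 - dl * n%:R) * expR (l%:R * L lam2 - dl * n%:R)))).
  rewrite -!expRD ler_expR.
  (* [L] is increasing with slope at most [K], and both tilts are within [delta] of [lam0]. *)
  have i1 : L lam0 - K * delta <= L lam1.
    have lh : 0 <= lam0 - lam1 by case/andP: hl1 => *; lra.
    have /andP[_] := L_incr lam1 lh; rewrite (_ : lam1 + (lam0 - lam1) = lam0) => [g1|]; last by ring.
    have : K * (lam0 - lam1) <= K * delta.
      by rewrite ler_wpM2l//; [lra|case/andP: hl1 => *; lra].
    by move: (L _) (L _) (K * _) (K * _) g1 => u v z z' g1 *; lra.
  have i2 : L lam0 - K * delta <= L lam2.
    have lh : 0 <= lam2 - lam0 by case/andP: hl2 => *; lra.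
    have /andP[g1 _] := L_incr lam0 lh; move: g1; rewrite (_ : lam0 + (lam2 - lam0) = lam2); last by ring.
    have : 0 <= K * delta by rewrite mulr_ge0//; lra.
    by move: (L _) (L _) (K * _) lh => u v z lh *; lra.
  have j1 := ler_wpM2l a0 i1; have j2 := ler_wpM2l l0 i2.
  have j3 : a%:R * (L lam0 - K * delta) + l%:R * (L lam0 - K * delta) = n%:R * L lam0 - n%:R * (K * delta).
    by rewrite -mulrDl anl; ring.
  have -> : n%:R * (L lam0 - lam0 * t - (4 * `|lam0| * e0 + 2 * delta * (K + e0) + 2 * dl + K * delta)) =
     - E + (n%:R * L lam0 - n%:R * (K * delta)) - 2 * (dl * n%:R) by rewrite /E; ring.
  rewrite -j3; move: j1 j2.
  move: (a%:R * _) (a%:R * _) (l%:R * _) (l%:R * _) (dl * _) (- E) => u1 u2 u3 u4 u5 u6 v1 v2; clear -v1 v2; lra.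
by rewrite ler_wpM2l ?expR_ge0// ler_wpM2r ?expR_ge0.
Qed.

End LowerBound.

(** * The rate function *)

Section RateFunction.
Context (R : realType) (d : nat) (i0 : 'I_d) (eta : probability (env R d) R) (kappa : R).
Hypothesis stat : stationary eta.
Hypothesis erg : ergodic eta.
Hypothesis kappa0 : 0 < kappa.
Hypothesis A2 : eta (Omega_kappa kappa) = 1%E.
Variable K0 : nat.
Hypothesis hK0 : (1 - (kappa + kappa)) ^+ K0 <= kappa / 2.
Implicit Types (w : env R d) (lam t a : R) (K : nat).

Local Notation LK := (LK i0 eta kappa).
Local Notation LP := (LP i0 eta kappa).

Let incr K lam (h : R) (KK : (K0 <= K)%N) (h0 : 0 <= h) :=
  LK_incr i0 stat erg kappa0 A2 hK0 lam KK h0.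
Let mid K x y (KK : (K0 <= K)%N) := LK_mid i0 stat erg kappa0 A2 hK0 x y KK.

Lemma J_ge lam t : (lam%:E <= lambda_crit eta)%E -> ((lam * t - LP lam)%:E <= J eta t)%E.
Proof.
move=> hl; apply: ereal_sup_ubound; exists lam => //.
by rewrite (LambdaE i0 stat kappa0 A2 hK0 hl) EFinB.
Qed.

Lemma J_le t (b : \bar R) :
  (forall lam, (lam%:E <= lambda_crit eta)%E -> ((lam * t - LP lam)%:E <= b)%E) ->
  (J eta t <= b)%E.
Proof.
move=> h; apply: ge_ereal_sup => _ [lam _ <-].
case: (boolP (lam%:E <= lambda_crit eta)%E) => hl.
  by rewrite (LambdaE i0 stat kappa0 A2 hK0 hl) -EFinB; exact: h.
by rewrite /Lambda (negPf hl) /= leNye.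
Qed.

Lemma LP_le lam : (lam%:E <= lambda_crit eta)%E -> lam <= 0 -> LP lam <= lam.
Proof.
move=> hl l0; apply/ler_addgt0Pr => e e0.
have [K [KK h]] := LK_to_LP i0 stat erg kappa0 A2 hK0 hl e0.
have := LK_le i0 stat erg kappa0 A2 hK0 KK l0; rewrite -lerBlDr; exact: le_trans.
Qed.

Lemma le0_crit lam : lam <= 0 -> (lam%:E <= lambda_crit eta)%E.
Proof.
move=> l0; apply: (@le_trans _ _ 0%:E); first by rewrite lee_fin.
exact: (lambda_crit_ge0 A2).
Qed.

Lemma J_ge0 t : (0%:E <= J eta t)%E.
Proof.
apply: le_trans (J_ge t (le0_crit (lexx 0))).
by rewrite lee_fin mul0r sub0r oppr_ge0; apply: LP_le => //; exact: le0_crit.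
Qed.

(** Climbing [n] levels takes at least [n] steps, so Lambda(lam) <= lam for [lam <= 0]; let [lam] go
    to minus infinity. *)
Lemma J_lt1 t : t < 1 -> J eta t = +oo%E.
Proof.
move=> t1; apply: eq_infty => r.
pose lam : R := - (`|r| / (1 - t)).
have s0 : 0 < 1 - t by rewrite subr_gt0.
have l0 : lam <= 0 by rewrite oppr_le0 divr_ge0// ltW.
apply: le_trans (J_ge t (le0_crit l0)); rewrite lee_fin.
apply: (@le_trans _ _ (lam * t - lam)); last by rewrite lerD2l lerN2; apply: LP_le => //; exact: le0_crit.
have -> : lam * t - lam = `|r| by rewrite /lam; field; rewrite gt_eqF.
exact: ler_norm.
Qed.

Lemma crit_bound : exists2 b : R, 0 <= b & forall lam, (lam%:E <= lambda_crit eta)%E -> lam <= b.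
Proof.
have d0 : 0 < d%:R :> R by rewrite ltr0n; case: (d) i0 => [[]|].
have M0 : 0 < d%:R * kappa^-1 / kappa by rewrite divr_gt0// mulr_gt0// invr_gt0.
exists `|ln (d%:R * kappa^-1 / kappa)| => // lam hl.
have h := expR_lambda_crit i0 stat kappa0 A2 hl.
apply: le_trans (ler_norm _); rewrite -[leLHS]expRK ler_ln ?posrE ?expR_gt0//.
by rewrite ler_pdivlMr.
Qed.

(** Since the admissible [lam] are bounded above by some [b], moving [t] to the right by [s] raises
    [J] by at most [b * s]. *)
Lemma J_shift t a (e : R) : (J eta t < a%:E)%E -> 0 < e ->
  exists2 s, 0 < s < e & (J eta (t + s) < a%:E)%E.
Proof.
move=> hJ e0; have [b b0 hb] := crit_bound.
have [j hj] : exists j : R, J eta t = j%:E.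
  have := J_ge0 t; move: hJ; case: (J eta t) => [j| |] // _ _; by exists j.
have ja : j < a by rewrite hj lte_fin in hJ.
pose s := Num.min (e / 2) ((a - j) / (2 * (b + 1))).
have b1 : 0 < 2 * (b + 1) by rewrite mulr_gt0// ltr_wpDl.
have s0 : 0 < s by rewrite lt_min !divr_gt0// subr_gt0.
exists s; first by rewrite s0 /= gt_min ltr_pdivrMr// ltr_pMr// ltr1n.
have sb : s * b <= (a - j) / 2.
  have h1 : s <= (a - j) / (2 * (b + 1)) by rewrite ge_min lexx orbT.
  have h2 : s * (2 * (b + 1)) <= a - j by rewrite -ler_pdivlMr.
  have := ltW s0; lra.
apply: (@le_lt_trans _ _ ((j + (a - j) / 2)%:E)); last by rewrite lte_fin; lra.
apply: J_le => lam hl; rewrite lee_fin.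
have := J_ge t hl; rewrite hj lee_fin mulrDr.
have : lam * s <= (a - j) / 2.
  by apply: le_trans sb; rewrite mulrC ler_wpM2l ?(ltW s0)//; exact: hb.
by move: (LP lam) => l; lra.
Qed.

(** At a point [x] beyond [lambda_crit] the truncated rate exceeds [2 * x * t] once [K] is large.
    Convexity with [LK K 0 <= 0] makes the rate at least double when [lam] doubles, which carries
    the bound to all larger [lam], uniformly in [K]. *)
Lemma LK_large t : 0 <= t -> exists lams K1, [/\ 0 < lams, (K0 <= K1)%N &
  forall K, (K1 <= K)%N -> forall lam, lams <= lam -> lam * t <= LK K lam].
Proof.
move=> t0; have [b b0 hb] := crit_bound; pose x := b + 1.
have x0 : 0 < x by rewrite ltr_wpDl.
have hx : ~ (x%:E <= lambda_crit eta)%E.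
  by move=> /hb; rewrite /x gerDl; rewrite leNgt ltr01.
(* The factor 2 lets monotonicity cover the whole first dyadic interval from [x] to [2 * x]. *)
have [K1 [KK1 h1]] := LK_to_infty i0 stat erg kappa0 A2 hK0 (2 * x * t) hx.
exists x, K1; split; [exact: x0|exact: KK1|move=> K KK].
have KK0 := leq_trans KK1 KK.
have hxK : 2 * x * t <= LK K x.
  exact: le_trans h1 (LK_leK i0 stat erg kappa0 A2 hK0 x KK1 KK).
have mono y h : 0 <= h -> LK K y <= LK K (y + h).
  by move=> h0; have /andP[k1 _] := incr y KK0 h0; apply: le_trans k1; rewrite lerDl.
have dbl y : 2 * LK K y <= LK K (2 * y).
  have := mid 0 (2 * y) KK0; rewrite add0r (_ : 2 * y / 2 = y); last by field.
  by move=> h; apply: (le_trans h); rewrite gerDr (LK0_le0 i0 stat erg kappa0 A2 hK0).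
have base n lam : x <= lam -> lam <= 2 ^+ n.+1 * x -> lam * t <= LK K lam.
  elim: n lam => [|n IH] lam xl lx.
    apply: (@le_trans _ _ (2 * x * t)); first by rewrite ler_wpM2r// -[2]expr1.
    apply: (le_trans hxK); have lx0 : 0 <= lam - x by rewrite subr_ge0.
    by have := mono x _ lx0; rewrite addrC subrK.
  case: (leP lam (2 ^+ n.+1 * x)) => h; first exact: IH.
  have xl2 : x <= lam / 2.
    rewrite ler_pdivlMr//; apply: le_trans (ltW h); rewrite mulrC ler_wpM2r ?(ltW x0)//.
    by rewrite -[leLHS]expr1 ler_weXn2l// ler1n.
  have lx2 : lam / 2 <= 2 ^+ n.+1 * x by rewrite ler_pdivrMr// mulrAC -exprSr.
  have := IH (lam / 2) xl2 lx2; have := dbl (lam / 2).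
  rewrite (_ : 2 * (lam / 2) = lam); last by field.
  by move=> k1 k2; apply: le_trans k1; rewrite (_ : lam * t = 2 * (lam / 2 * t)) ?ler_pM2l//; field.
move=> lam xl.
have [n hn] : exists n : nat, lam <= 2 ^+ n.+1 * x.
  exists (Num.truncn (lam / x)); rewrite -ler_pdivrMr//; apply: (le_trans (ltW (truncnS_gt _))).
  by rewrite -natrX ler_nat ltnW// ltn_expl.
exact: base hn.
Qed.

Lemma LK_continuous K : (K0 <= K)%N -> continuous (LK K).
Proof.
move=> KK x; apply/cvgrPdist_le => e e0; near=> y.
have lip (u v : R) : u <= v -> `|LK K u - LK K v| <= K%:R * `|u - v|.
  move=> uv; have h0 : 0 <= v - u by rewrite subr_ge0.
  have := incr u KK h0; rewrite (_ : u + (v - u) = v); last by ring.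
  move=> /andP[k1 k2].
  rewrite distrC [`|u - v|]distrC !ger0_norm//; last first.
    by rewrite subr_ge0; apply: le_trans k1; rewrite lerDl.
  by rewrite lerBlDl.
have lipn (u v : R) : `|LK K u - LK K v| <= K%:R * `|u - v|.
  case: (leP u v) => [uv|/ltW vu]; first exact: (lip u v uv).
  by rewrite (distrC (LK K u)) (distrC u); exact: (lip v u vu).
apply: (le_trans (lipn x y)).
apply: (@le_trans _ _ ((K%:R + 1) * `|x - y|)); first by rewrite ler_wpM2r// lerDl.
rewrite mulrC -ler_pdivlMr ?ltr_wpDl//; near: y.
by apply: cvgr_dist_le; [exact: cvg_id|rewrite divr_gt0// ltr_wpDl].
Unshelve. all: by end_near. Qed.

(** Outside a fixed interval [lam * t - LK K lam] is nonpositive for all large [K]. On the interval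
    these continuous functions decrease with [K] and each point eventually has a value below [a], so
    by compactness one [K] serves all points. The maximiser over the interval is then global. *)
Lemma minimax t a : 1 < t -> (J eta t < a%:E)%E ->
  exists K lam0, [/\ (K0 <= K)%N, (0 < K)%N, lam0 * t - LK K lam0 < a &
    forall lam, lam * t - LK K lam <= lam0 * t - LK K lam0].
Proof.
move=> t1 hJ.
have a0 : 0 < a by have := le_lt_trans (J_ge0 t) hJ; rewrite lte_fin.
have t0 : 0 <= t by rewrite ltW// (lt_trans ltr01).
have [hi [K1 [hi0 KK1 hhi]]] := LK_large t0.
(* From [LK K lam >= lam + ln kappa], the function is at most [lam * (t - 1) - ln kappa],
   nonpositive left of [lo]; this is where [1 < t] enters. *)
pose lo := - (`|ln kappa| / (t - 1)).
have s0 : 0 < t - 1 by rewrite subr_gt0.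
have lo0 : lo <= 0 by rewrite oppr_le0 divr_ge0// ltW.
have outlo K lam : (K0 <= K)%N -> (0 < K)%N -> lam <= lo -> lam * t - LK K lam <= 0.
  move=> KK Kp ll; have h := LK_ge i0 stat erg kappa0 A2 hK0 lam KK Kp.
  have h2 : lam * (t - 1) <= - `|ln kappa|.
    apply: (le_trans (ler_wpM2r (ltW s0) ll)).
    by rewrite /lo mulNr divfK// gt_eqF.
  have := ler_norm (- ln kappa); rewrite normrN.
  by move: h h2; move: (LK K lam) (ln kappa) => u v; lra.
have cover : \forall n \near \oo, `[lo, hi]%classic `<=`
    [set lam | lam * t - LK (K1 + n)%N lam < a].
  have /compact_near_coveringP cpt := @segment_compact R lo hi.
  apply: cpt => lam _.
  have [n0 hn0] : exists n0, lam * t - LK (K1 + n0)%N lam < a.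
    case: (boolP (lam%:E <= lambda_crit eta)%E) => hl.
      have := le_lt_trans (J_ge t hl) hJ; rewrite lte_fin => h.
      pose e := (a - (lam * t - LP lam)) / 2.
      have e0 : 0 < e by rewrite divr_gt0// subr_gt0.
      have [K [KK hK]] := LK_to_LP i0 stat erg kappa0 A2 hK0 hl e0.
      exists K; have := LK_leK i0 stat erg kappa0 A2 hK0 lam KK (leq_addl K1 K).
      by move: hK h; rewrite /e; move: (LK K lam) (LP lam) (LK _ lam) => u v z; lra.
    have [K [KK hK]] := LK_to_infty i0 stat erg kappa0 A2 hK0 (lam * t - a + 1) (negP hl).
    exists K; have := LK_leK i0 stat erg kappa0 A2 hK0 lam KK (leq_addl K1 K).
    by move: hK; move: (LK K lam) (LK _ lam) => u v; lra.
  have Kn0 : (K0 <= K1 + n0)%N by rewrite (leq_trans KK1)// leq_addr.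
  have c : \forall x \near lam, x * t - LK (K1 + n0)%N x < a.
    have cc : (fun x : R => x * t - LK (K1 + n0)%N x) x @[x --> lam] --> lam * t - LK (K1 + n0)%N lam.
      by apply: cvgB; [apply: cvgMr_tmp; exact: cvg_id|exact: (LK_continuous Kn0)].
    exact: (cvgr_lt _ cc _ hn0).
  exists ([set x | x * t - LK (K1 + n0)%N x < a], [set n | (n0 <= n)%N]).
    by split => //; exists n0.
  move=> [x n] /= [hx hn]; apply: le_lt_trans hx; rewrite lerD2l lerN2.
  by apply: (LK_leK i0 stat erg kappa0 A2 hK0 x Kn0); rewrite leq_add2l.
have [n _ hn] := cover.
pose K := (K1 + n.+1)%N.
have Kp : (0 < K)%N by rewrite /K addnS.
have KK : (K0 <= K)%N by rewrite /K (leq_trans KK1)// leq_addr.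
have hK x : x \in `[lo, hi] -> x * t - LK K x < a.
  by move=> xi; apply: (hn n.+1 (leqnSn n) x); rewrite /= xi.
have lohi : lo <= hi by rewrite (le_trans lo0)// ltW.
have cont : {within `[lo, hi], continuous (fun x => x * t - LK K x)}.
  apply: continuous_subspaceT => x; apply: cvgB; first by apply: cvgMr_tmp; exact: cvg_id.
  exact: (LK_continuous KK).
have [lam0 lam0i hmax] := EVT_max lohi cont.
(* Compare with the point 0 of the interval, where [LK K 0 <= 0]; thus values outside the interval,
   being nonpositive, cannot beat the maximum. *)
have z : 0 <= lam0 * t - LK K lam0.
  apply: (@le_trans _ _ (0 * t - LK K 0)).
    by rewrite mul0r sub0r oppr_ge0; exact: (LK0_le0 i0 stat erg kappa0 A2 hK0).
  by apply: hmax; rewrite in_itv /= lo0 ltW.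
exists K, lam0; split; [exact: KK|exact: Kp|exact: hK|move=> lam].
case: (leP lam lo) => h1; first exact: le_trans (outlo K lam KK Kp h1) z.
case: (leP hi lam) => h2; last by apply: hmax; rewrite in_itv /= !ltW.
by apply: le_trans z; rewrite subr_le0; apply: hhi => //; exact: leq_addr.
Qed.

End RateFunction.

(** * Lower bound *)

Definition hitprob (R : realType) (d : nat) (w : env R d) (i : 'I_d) (n : nat) (G : set R) : \bar R :=
  (\sum_(m <oo | (m%:R / n%:R)%R \in G) (\sum_(j < d) hit w n%:Z m 0 i j)%:E)%E.

(** * Inequalities for the error budget *)

Section Arithmetic.
Context (R : realFieldType).
Implicit Types (a p q u v x y z e l : R).

Lemma quad_lt_of_le_eighth u v y : u <= v / 8 -> 0 < v -> v <= y -> 4 * u < y.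
Proof. lra. Qed.

Lemma double_le_quarter p q y : p <= q -> y = 8 * q -> 2 * p <= y / 4.
Proof. lra. Qed.

Lemma le_eighth_of_sum x y z : y = 8 * x + 8 * z -> 0 <= z -> x <= y / 8.
Proof. lra. Qed.

Lemma error_budget a e v l x y z : a - e = v - l -> 0 < e -> x <= e / 4 -> y <= e / 4 ->
  z <= e / 8 -> - a <= l - v - (x + y + 2 * (e / 8) + z).
Proof. lra. Qed.

End Arithmetic.

Section LowerAe.
Context (R : realType) (d : nat) (i0 : 'I_d) (eta : probability (env R d) R) (kappa : R).
Hypothesis stat : stationary eta.
Hypothesis erg : ergodic eta.
Hypothesis kappa0 : 0 < kappa.
Hypothesis A2 : eta (Omega_kappa kappa) = 1%E.
Variable K0 : nat.
Hypothesis hK0 : (1 - (kappa + kappa)) ^+ K0 <= kappa / 2.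
Implicit Types (w : env R d) (lam t a : R) (K : nat).

Local Notation LK := (LK i0 eta kappa).

(** The windowed coefficients are lower bounds for finitely many terms of the nonnegative series
    [hitprob]. *)
Lemma win_le_hitprob K w n i (A B b1 b2 : R) : Omega_kappa kappa w ->
  (forall m : nat, A <= m%:R <= B -> b1 < m%:R / n%:R < b2) ->
  (((win (rowsum (fprod (pgf K w) 0 n) i) A B).[1])%:E <= hitprob w i n `]b1, b2[)%E.
Proof.
move=> hw h; have hS := Omega_Sigma hw; set p := rowsum _ i.
have q0 m : 0 <= \sum_(j < d) hit w n%:Z m 0 i j.
  by rewrite sumr_ge0// => j _; exact: (hit_ge0 hS).
have := @nneseries_lim_ge R (fun m => (\sum_(j < d) hit w n%:Z m 0 i j)%:E)
  (fun m => (m%:R / n%:R)%R \in `]b1, b2[%classic) 0%N (size p).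
move=> /(_ (fun m _ _ => q0 m)); apply: le_trans.
rewrite sumEFin lee_fin (@horner_coef_wide _ (size p)) ?size_poly//.
rewrite big_mkord [leRHS]big_mkcond/=; apply: ler_sum => m _.
rewrite expr1n mulr1 coef_win; case: ifP => hm; last by case: ifP.
rewrite mem_set; last by rewrite /= in_itv /=; exact: h.
rewrite /p /rowsum coef_sum; apply: ler_sum => j _.
by have := fprod_pgf_coef_le hS K 0 n i j m; rewrite add0r.
Qed.

Lemma ae_seq (s : seq R) (Q : R -> env R d -> Prop) :
  (forall x, {ae eta, forall w, Q x w}) -> {ae eta, forall w, forall x, x \in s -> Q x w}.
Proof.
move=> h; have : {ae eta, forall w, forall n, Q (nth 0 s n) w} by apply: ae_foralln.
by apply: filterS => w H x xs; rewrite -(nth_index 0 xs).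
Qed.

Lemma lower_ae_gt1 (b1 b2 t a : R) : b1 < t < b2 -> 1 < t -> (J eta t < a%:E)%E ->
  {ae eta, forall w, exists N : nat, forall n i, (N <= n)%N ->
     ((expR (- (n%:R * a)))%:E <= hitprob w i n `]b1, b2[)%E}.
Proof.
move=> /andP[tb1 tb2] t1 hJ.
have [K [lam0 [KK Kp hlam0 hmax]]] := minimax i0 stat erg kappa0 A2 hK0 t1 hJ.
have mid x y : 2 * LK K ((x + y) / 2) <= LK K x + LK K y.
  exact: (LK_mid i0 stat erg kappa0 A2 hK0 x y KK).
have incr x h : 0 <= h -> LK K x + h <= LK K (x + h) <= LK K x + K%:R * h.
  exact: (LK_incr i0 stat erg kappa0 A2 hK0 x KK).
have hm lam : LK K lam0 - LK K lam <= t * (lam0 - lam).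
  by have := hmax lam; move: (LK K lam) (LK K lam0) => u v; lra.
pose gap := Num.min (t - b1) (b2 - t).
have gap0 : 0 < gap by rewrite lt_min !subr_gt0 tb1.
pose err := a - (lam0 * t - LK K lam0).
have err0 : 0 < err by rewrite subr_gt0.
(* The window of half-width [4 * e0] must fit into []b1, b2[], and the loss [4 * |lam0| * e0] must
   stay below a quarter of [err]. *)
pose e0 := Num.min 1 (Num.min (gap / 8) (err / (16 * (1 + `|lam0|)))).
have e00 : 0 < e0.
  by rewrite !lt_min ltr01 !divr_gt0// mulr_gt0// ltr_pwDl.
have e01 : e0 <= 1 by rewrite ge_min lexx.
have e0g : e0 <= gap / 8 by rewrite !ge_min lexx orbT.
have e0e : 4 * `|lam0| * e0 <= err / 4.
  have : e0 <= err / (16 * (1 + `|lam0|)) by rewrite !ge_min lexx !orbT.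
  rewrite ler_pdivlMr; last by rewrite mulr_gt0// ltr_pwDl.
  have := ltW e00; have : 0 <= e0 * `|lam0| by rewrite mulr_ge0// ltW.
  have -> : e0 * (16 * (1 + `|lam0|)) = 16 * e0 + 16 * (e0 * `|lam0|) by ring.
  have -> : 4 * `|lam0| * e0 = 4 * (e0 * `|lam0|) by ring.
  by move: (e0 * _) => z *; lra.
(* Then [2 * delta * (K + e0)] is at most [err / 4] and [K * delta] at most [err / 8]; with
   [dl = err / 8] the four losses total at most 7/8 of [err]. *)
pose delta := err / (8 * (K%:R + 1)).
have delta0 : 0 < delta by rewrite divr_gt0// mulr_gt0// ltr_wpDl.
have dK : delta * (8 * (K%:R + 1)) = err.
  by rewrite divfK// gt_eqF// mulr_gt0// ltr_wpDl.
have g1 : 4 * e0 < t - b1.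
  by apply: (quad_lt_of_le_eighth e0g gap0); rewrite ge_min lexx.
have g2 : 4 * e0 < b2 - t.
  by apply: (quad_lt_of_le_eighth e0g gap0); rewrite ge_min lexx orbT.
have total : - a <= LK K lam0 - lam0 * t -
    (4 * `|lam0| * e0 + 2 * delta * (K%:R + e0) + 2 * (err / 8) + K%:R * delta).
  apply: (error_budget _ err0 e0e).
  - by rewrite /err; ring.
  - have h : delta * (K%:R + e0) <= delta * (K%:R + 1) by rewrite ler_wpM2l ?(ltW delta0)// lerD2l.
    rewrite -mulrA; apply: (double_le_quarter h); rewrite -dK; ring.
  - by apply: (le_eighth_of_sum _ (ltW delta0)); rewrite -dK; ring.
have [lam1 [eta1 [eta10 hl1 hs1 hs1']]] := select_left mid incr delta0 e00 hm.
have [lam2 [eta2 [eta20 hl2 hs2 hs2']]] := select_right mid incr delta0 e00 hm.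
pose s := [:: lam1 - eta1; lam1; lam1 + eta1; lam2 - eta2; lam2; lam2 + eta2].
have H := ae_seq s (fun x => ae_LK i0 stat erg kappa0 A2 hK0 x KK).
apply: filterS2 (ae_Omega A2) H => w hw H.
have hS := Omega_Sigma hw.
have Upos b n i x : 0 < (rowsum (fprod (pgf K w) b n) i).[expR x].
  rewrite -trunc_horner; exact: (trunc_rowsum_gt0 i0 kappa0 A2 hK0 x b n i KK hw).
have rate x : x \in s -> polyrate (pgf K w) x (LK K x).
  move=> xs e ee.
  have := mgf_block_growth i0 (lbound_gt0 kappa0 K0 x)
    (trunc_between i0 kappa0 A2 hK0 x KK hw) (H x xs).
  by move=> /(_ e ee)[D hD]; exists D => b l j; rewrite -trunc_horner; exact: hD.
have dl0 : 0 < err / 8 by rewrite divr_gt0.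
have [N hN] := two_tilts (fprod_pgf_coef_ge0 hS K) Upos incr delta0 e00 dl0 eta10 eta20
  hl1 hl2 hs1 hs1' hs2 hs2' rate.
exists (maxn N 1) => n i; rewrite geq_max => /andP[nN n1].
have n0 : 0 < n%:R :> R by rewrite ltr0n.
apply: (le_trans _ (@win_le_hitprob K w n i (n%:R * t - n%:R * (4 * e0))
  (n%:R * t + n%:R * (4 * e0)) b1 b2 hw _)); last first.
  move=> m /andP[m1 m2]; rewrite ltr_pdivlMr// ltr_pdivrMr//.
  have h1 : n%:R * (4 * e0) < n%:R * (t - b1) by rewrite ltr_pM2l.
  have h2 : n%:R * (4 * e0) < n%:R * (b2 - t) by rewrite ltr_pM2l.
  rewrite mulrBr in h1 h2 *.
  rewrite [b1 * _]mulrC [b2 * _]mulrC; move: (n%:R * (4 * e0)) m1 m2 h1 h2 => z m1 m2 h1 h2.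
  by apply/andP; split; clear -m1 m2 h1 h2; lra.
rewrite lee_fin; apply: le_trans (hN n i nN); rewrite ler_expR -mulrN ler_wpM2l ?(ltW n0)//.
Qed.

Lemma lower_ae (b1 b2 t a : R) : b1 < t < b2 -> (J eta t < a%:E)%E ->
  {ae eta, forall w, exists N : nat, forall n i, (N <= n)%N ->
     ((expR (- (n%:R * a)))%:E <= hitprob w i n `]b1, b2[)%E}.
Proof.
move=> /andP[tb1 tb2] hJ.
case: (ltP t 1) => t1; first by rewrite (J_lt1 i0 stat erg kappa0 A2 hK0 t1) in hJ.
(* t = 1 is not an interior point of the domain of J: move slightly to the right. *)
have g0 : 0 < b2 - t by rewrite subr_gt0.
have [s /andP[s0 sg] hJs] := J_shift i0 stat erg kappa0 A2 hK0 hJ g0.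
by apply: (@lower_ae_gt1 b1 b2 (t + s) a) => //; [apply/andP; split|]; lra.
Qed.

End LowerAe.

(** * Upper bound *)

Section ExtendedReals.
Context (R : realType).
Implicit Types (x y : \bar R) (u : (\bar R)^nat).

Lemma ereal_rat_dense x y : (x < y)%E -> exists q : rat, (x < (ratr q)%:E < y)%E.
Proof.
have H (a b : R) : a < b -> exists q : rat, (a%:E < (ratr q)%:E < b%:E)%E.
  by move=> /rat_in_itvoo[q]; rewrite in_itv /= => h; exists q; rewrite !lte_fin.
case: x y => [a| |] [b| |] //.
- by rewrite lte_fin; exact: H.
- move=> _; have [|q /andP[h _]] := H a (a + 1); first by rewrite ltrDl.
  by exists q; rewrite h ltry.
- move=> _; have [|q /andP[_ h]] := H (b - 1) b; first by rewrite ltrBlDr ltrDl.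
  by exists q; rewrite h ltNyr.
- by move=> _; exists 0; rewrite ltNyr ltry.
Qed.

Lemma limn_esup_le_near u y : (\forall n \near \oo, (u n <= y)%E) -> (limn_esup u <= y)%E.
Proof.
move=> h; apply: (@le_trans _ _ (ereal_sup (u @` [set n | (u n <= y)%E]))).
  by apply: ereal_inf_lbound; exists [set n | (u n <= y)%E].
by apply: ge_ereal_sup => _ [n /= hn <-].
Qed.

Lemma limn_einf_ge_near u y : (\forall n \near \oo, (y <= u n)%E) -> (y <= limn_einf u)%E.
Proof.
move=> h; rewrite /limn_einf leeNr; apply: limn_esup_le_near.
by apply: filterS h => n; rewrite leeN2.
Qed.

Lemma elog_le x (r : R) : (x <= (expR r)%:E)%E -> (elog x <= r%:E)%E.
Proof.
case: x => [z| |] //=; rewrite ?leNye// lee_fin => h; case: ifPn => z0; last by rewrite leNye.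
by rewrite lee_fin -[leRHS]expRK ler_ln ?posrE ?expR_gt0.
Qed.

Lemma elog_ge x (r : R) : ((expR r)%:E <= x)%E -> (r%:E <= elog x)%E.
Proof.
case: x => [z| |] //=; rewrite ?leey// lee_fin => h.
have z0 : 0 < z by apply: lt_le_trans h; exact: expR_gt0.
by rewrite z0 lee_fin -[leLHS]expRK ler_ln ?posrE ?expR_gt0.
Qed.

End ExtendedReals.

Lemma ae_countable (dd : measure_display) (T : measurableType dd) (R : realType)
  (mu : {measure set T -> \bar R}) (I : countType) (Q : I -> T -> Prop) :
  (forall x, {ae mu, forall w, Q x w}) -> {ae mu, forall w, forall x, Q x w}.
Proof.
move=> h.
have : {ae mu, forall w, forall n, if unpickle n is Some x then Q x w else True}.
  by apply: ae_foralln => n; case: unpickle => [x|]; [exact: h|exact: aeW].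
by apply: filterS => w H x; have := H (pickle x); rewrite pickleK.
Qed.

Section HitProb.
Context (R : realType) (d : nat) (kappa : R) (w : env R d).
Hypothesis hw : Omega_kappa kappa w.
Implicit Types (i : 'I_d) (n : nat) (A B G : set R).

Lemma hit_sum_ge0 n m i : 0 <= \sum_(j < d) hit w n%:Z m 0 i j.
Proof. by rewrite sumr_ge0// => j _; exact: (hit_ge0 (Omega_Sigma hw)). Qed.

Let term n A m i : (0 <= if (m%:R / n%:R)%R \in A
  then (\sum_(j < d) hit w n%:Z m 0 i j)%:E else 0)%E.
Proof. by case: ifP; rewrite // lee_fin hit_sum_ge0. Qed.

Lemma le_hitprob i n A B : A `<=` B -> (hitprob w i n A <= hitprob w i n B)%E.
Proof.
move=> AB; rewrite /hitprob eseries_mkcond [leRHS]eseries_mkcond.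
apply: lee_nneseries => m _; first by move=> _; exact: term.
case: ifPn => [/set_mem/AB/mem_set->//|_]; exact: term.
Qed.

Lemma hitprobU i n A B : (hitprob w i n (A `|` B) <= hitprob w i n A + hitprob w i n B)%E.
Proof.
rewrite /hitprob eseries_mkcond [X in (_ <= X + _)%E]eseries_mkcond
  [X in (_ <= _ + X)%E]eseries_mkcond -nneseriesD; try by move=> *; exact: term.
apply: lee_nneseries => m _; first by move=> _; exact: term.
rewrite in_setU; case: (_ \in A) => /=; first by rewrite leeDl.
by rewrite add0e.
Qed.

Lemma hitprob0 i n : hitprob w i n set0 = 0%E.
Proof. by apply: eseries_pred0 => m; rewrite in_set0. Qed.

(** The partial sum up to time [M] is compared with the polynomials truncated at this same [M]: up
    to that degree their coefficients are the exact probabilities, and their values are dominated by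
    the products of Phi. *)
Lemma chernoff lam i n A (b : R) : Good kappa lam w ->
  (forall m : nat, A (m%:R / n%:R) -> b <= lam * m%:R) ->
  (hitprob w i n A <=
    (expR (- b) * rowsum (fprod (fun k : nat => Phimx w lam k%:Z) 0 n) i)%:E)%E.
Proof.
move=> G hb; have hS := Omega_Sigma hw.
apply: lime_le; first by apply: is_cvg_nneseries_cond => m _ _; rewrite lee_fin hit_sum_ge0.
apply: nearW => M /=; rewrite sumEFin lee_fin.
pose p := rowsum (fprod (pgf M w) 0 n) i.
have coefp m : (m <= M)%N -> p`_m = \sum_(j < d) hit w n%:Z m 0 i j.
  move=> mM; rewrite /p /rowsum coef_sum; apply: eq_bigr => j _.
  by rewrite fprod_pgf_coef_eq// add0r.
have coefp0 m : 0 <= p`_m.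
  by rewrite /p /rowsum coef_sum sumr_ge0// => j _; exact: (fprod_pgf_coef_ge0 hS).
apply: (@le_trans _ _ (expR (- b) * p.[expR lam])); last first.
  rewrite ler_wpM2l ?expR_ge0// /p -trunc_horner.
  have := @fprod_scale_rowsum R d (fun k : nat => mgf_trunc M (expR lam) w k%:Z)
    (fun k : nat => Phimx w lam k%:Z) (fun=> 1).
  move=> /(_ (fun=> ler01)) h.
  rewrite -[leLHS]mul1r -[X in X * _ <= _](@expr1n R n) -[X in _ ^+ X]card_ord -prodr_const.
  apply: h => k l j; first by apply: (mgf_trunc_ge0 hw); exact: expR_ge0.
  by rewrite mul1r; exact: (Good_mgf_le M _ l j G).
(* The polynomial is padded to length [M + size p] so that its first [M] coefficients can be split
   off; the rest is nonnegative. *)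
rewrite (@horner_coef_wide _ (M + size p)) ?leq_addl// big_split_ord/= mulrDr.
rewrite -[leLHS]addr0 lerD//; last first.
  by rewrite mulr_ge0 ?expR_ge0// sumr_ge0// => m _; rewrite mulr_ge0// exprn_ge0// expR_ge0.
rewrite big_mkord big_mkcond mulr_sumr; apply: ler_sum => m _.
rewrite coefp; last exact: ltnW.
case: ifPn => [/set_mem hm|_]; last first.
  by rewrite !mulr_ge0 ?expR_ge0 ?hit_sum_ge0// exprn_ge0 ?expR_ge0.
rewrite mulrCA -[leLHS]mulr1 ler_wpM2l ?hit_sum_ge0// -expRM_natr -expRD -[leLHS]expR0 ler_expR.
by rewrite addrC subr_ge0; exact: hb.
Qed.

End HitProb.

Section Upper.
Context (R : realType) (d : nat) (w : env R d) (kappa : R).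
Hypothesis hw : Omega_kappa kappa w.
Variable a : R.

(** The free prefactor [C] makes the property stable under finite unions, as the compactness
    argument requires. *)
Definition exp_small (A : set R) := exists (C : R) (N : nat), forall n i, (N <= n)%N ->
  (hitprob w i n A <= (C * expR (- (n%:R * a)))%:E)%E.

Lemma exp_smallS A B : A `<=` B -> exp_small B -> exp_small A.
Proof.
move=> AB [C [N h]]; exists C, N => n i nN.
by apply: le_trans (h n i nN); exact: (le_hitprob hw).
Qed.

Lemma exp_smallU A B : exp_small A -> exp_small B -> exp_small (A `|` B).
Proof.
move=> [C [N h]] [C' [N' h']]; exists (C + C'), (maxn N N') => n i.
rewrite geq_max => /andP[nN nN']; apply: (le_trans (hitprobU hw _ _ _ _)).
by rewrite mulrDl EFinD leeD ?h ?h'.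
Qed.

(* Otherwise the complements of the exponentially small subsets of F would form a
   proper filter on F with a cluster point. *)
Lemma exp_small_compact F : compact F ->
  (forall t, F t -> exists2 U, nbhs t U & exp_small U) -> exp_small F.
Proof.
move=> cF h; apply: contrapT => nF.
pose FF : set_system R := [set B | exp_small (F `\` B)].
have s0 : exp_small set0.
  by exists 0, 0%N => n i _; rewrite hitprob0 mul0r.
have FFF : Filter FF.
  split.
  - by rewrite /FF /= setDT.
  - by move=> P Q hP hQ; rewrite /FF /= setDIr; exact: exp_smallU.
  - by move=> P Q PQ; apply: exp_smallS; exact: setDS.
have FFP : ProperFilter FF.
  by apply: Build_ProperFilter_ex => P hP; apply: contrapT => nP; apply: nF;
     apply: exp_smallS hP => x Fx; split => // Px; apply: nP; exists x.
have FFin : FF F by rewrite /FF /= setDv.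
have [t [Ft ct]] := cF FF FFP FFin.
have [U Ut hU] := h t Ft.
have hC : FF (~` U).
  by apply: exp_smallS hU => x [_ /contrapT].
by have [x [nUx Ux]] := ct _ _ hC Ut.
Qed.

End Upper.

Lemma sub_slope_lt (R : realFieldType) (a x y p r : R) :
  x - y < x - p - a -> r <= p -> a < y - r.
Proof. lra. Qed.

(** * Almost sure bounds with one null set for all test sets *)

Section Final.
Context (R : realType) (d : nat) (i0 : 'I_d) (eta : probability (env R d) R) (kappa : R).
Hypothesis stat : stationary eta.
Hypothesis erg : ergodic eta.
Hypothesis kappa0 : 0 < kappa.
Hypothesis A2 : eta (Omega_kappa kappa) = 1%E.
Variable K0 : nat.
Hypothesis hK0 : (1 - (kappa + kappa)) ^+ K0 <= kappa / 2.
Implicit Types (w : env R d) (lam t a : R) (K : nat).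

Local Notation LP := (LP i0 eta kappa).

Lemma LP_mono lam lam' : lam <= lam' -> (lam'%:E <= lambda_crit eta)%E -> LP lam <= LP lam'.
Proof.
move=> ll hl'; have hl : (lam%:E <= lambda_crit eta)%E by apply: le_trans hl'; rewrite lee_fin.
apply/ler_addgt0Pr => e e0.
have [K [KK h]] := LK_to_LP i0 stat erg kappa0 A2 hK0 hl e0.
have d0 : 0 <= lam' - lam by rewrite subr_ge0.
have /andP[h1 _] := LK_incr i0 stat erg kappa0 A2 hK0 lam KK d0.
have h2 := LK_leLP i0 stat erg kappa0 A2 hK0 KK hl'.
rewrite -lerBlDr; apply: (le_trans h); apply: le_trans h2.
by move: h1; rewrite (addrC lam) subrK; apply: le_trans; rewrite lerDl.
Qed.

(** A rational slightly below a nearly optimal [lam] is still admissible, lowers [lam * t] by little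
    and does not increase Lambda. Monotonicity thus replaces continuity of Lambda. *)
Lemma J_gt_rat t a : (a%:E < J eta t)%E -> exists q : rat,
  ((ratr q)%:E <= lambda_crit eta)%E /\ a < ratr q * t - LP (ratr q).
Proof.
move=> hJ.
have [lam [hl hlam]] : exists lam, (lam%:E <= lambda_crit eta)%E /\ a < lam * t - LP lam.
  apply: contrapT => n; have : (J eta t <= a%:E)%E; last by rewrite leNgt hJ.
  apply: (@J_le _ _ i0 _ _ stat kappa0 A2 _ hK0 t a%:E) => lam hl; rewrite lee_fin leNgt; apply/negP => h.
  by apply: n; exists lam.
pose g := lam * t - LP lam - a.
have g0 : 0 < g by rewrite subr_gt0.
have t1 : 0 < `|t| + 1 by rewrite ltr_wpDl.
have [|q] := @rat_in_itvoo R (lam - g / (`|t| + 1)) lam.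
  by rewrite ltrBlDr ltrDl divr_gt0.
rewrite in_itv /= => /andP[q1 q2]; exists q; split.
  by apply: le_trans hl; rewrite lee_fin ltW.
have := LP_mono (ltW q2) hl.
have : lam * t - ratr q * t < g.
  rewrite -mulrBl; apply: (@le_lt_trans _ _ ((lam - ratr q) * `|t|)).
    by rewrite ler_wpM2l ?ler_norm// subr_ge0 ltW.
  apply: (@le_lt_trans _ _ ((lam - ratr q) * (`|t| + 1))).
    by rewrite ler_wpM2l ?lerDl// subr_ge0 ltW.
  by rewrite -ltr_pdivlMr// ltrBlDr addrC -ltrBlDr.
exact: sub_slope_lt.
Qed.

(** Half of the margin [g] pays for varying [t] in a ball, the other half for the error in the
    growth rate. *)
Lemma exp_small_nbhs w lam t a : Good kappa lam w ->
  mgf_growth (fun k : nat => Phimx w lam k%:Z) (LP lam) ->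
  a < lam * t - LP lam -> exists2 U, nbhs t U & exp_small w a U.
Proof.
move=> G H ha; have hw : Omega_kappa kappa w by case: G.
pose g := lam * t - LP lam - a.
have g0 : 0 < g by rewrite subr_gt0.
have g2 : 0 < g / 2 by rewrite divr_gt0.
pose r := g / 2 / (`|lam| + 1).
have l1 : 0 < `|lam| + 1 by rewrite ltr_wpDl.
have r0 : 0 < r by rewrite divr_gt0.
exists (ball t r); first exact: nbhsx_ballx.
have [D hD] := H _ g2; exists (expR D), 1%N => n i n1.
have n0 : 0 < n%:R :> R by rewrite ltr0n.
apply: (le_trans (@chernoff _ _ _ _ hw lam i n _ (n%:R * (lam * t - g / 2)) G _)).
  move=> m; rewrite -ball_normE /= => hm.
  have -> : lam * m%:R = n%:R * (lam * (m%:R / n%:R)) by field; rewrite gt_eqF.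
  rewrite ler_wpM2l ?(ltW n0)// lerBlDr -lerBlDl -mulrBr.
  apply: (le_trans (ler_norm _)); rewrite normrM.
  apply: (@le_trans _ _ ((`|lam| + 1) * r)); last by rewrite /r mulrC divfK// gt_eqF.
  by apply: ler_pM => //; [rewrite lerDl|rewrite ltW].
set X := rowsum _ i; have := hD n i; rewrite -/X.
rewrite ler_norml => /andP[_ hX].
rewrite lee_fin; case: (ltP 0 X) => X0; last first.
  by apply: (@le_trans _ _ 0); rewrite ?mulr_ge0 ?expR_ge0// mulr_ge0_le0 ?expR_ge0.
rewrite -[X in _ * X <= _](@lnK R) ?posrE// -!expRD ler_expR.
have -> : D - n%:R * a = - (n%:R * (lam * t - g / 2)) + (g / 2 * n%:R + D + n%:R * LP lam).
  by rewrite /g; field.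
by rewrite lerD2l -lerBlDr.
Qed.

(** Only rational [lam] are used, so the exceptional null set depends neither on [F] nor on [a]. *)
Lemma upper_ae : {ae eta, forall w a F, compact F -> (forall t, F t -> (a%:E < J eta t)%E) ->
  exp_small w a F}.
Proof.
have H : {ae eta, forall w, forall q : rat, ((ratr q)%:E <= lambda_crit eta)%E ->
    Good kappa (ratr q) w /\ mgf_growth (fun k : nat => Phimx w (ratr q) k%:Z) (LP (ratr q))}.
  apply: ae_countable => q; case: (boolP ((ratr q)%:E <= lambda_crit eta)%E) => hl; last first.
    by apply: aeW => w h.
  apply: filterS2 (ae_Good i0 stat kappa0 A2 hl) (ae_LP i0 stat erg kappa0 A2 hK0 hl).
  by move=> w ? ? _.
apply: filterS2 (ae_Omega A2) H => w hw H a F cF hF.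
apply: (exp_small_compact hw cF) => t /hF/J_gt_rat[q [hl hq]].
have [G M] := H q hl; exact: exp_small_nbhs G M hq.
Qed.

(** The almost sure statements are indexed by rational triples (left end, right end, level). The
    real point [t] occurs only in a condition not involving the environment, so it need not be
    rational. *)
Lemma lower_ae_open : {ae eta, forall w (G : set R) t a, open G -> G t -> (J eta t < a%:E)%E ->
  exists N : nat, forall n i, (N <= n)%N ->
    ((expR (- (n%:R * a)))%:E <= hitprob w i n G)%E}.
Proof.
have H : {ae eta, forall w, forall p : rat * rat * rat,
    (exists2 t, ratr p.1.1 < t < ratr p.1.2 & (J eta t < (ratr p.2)%:E)%E) ->
    exists N : nat, forall n i, (N <= n)%N ->
    ((expR (- (n%:R * ratr p.2)))%:E <= hitprob w i n `](ratr p.1.1), (ratr p.1.2)[)%E}.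
  apply: ae_countable => p.
  have [[t ht hJ]|n] := pselect (exists2 t, ratr p.1.1 < t < ratr p.1.2 & (J eta t < (ratr p.2)%:E)%E).
    have := lower_ae i0 stat erg kappa0 A2 hK0 ht hJ.
    by apply: filterS => w h _.
  by apply: aeW => w /n.
apply: filterS2 (ae_Omega A2) H => w hw H G t a oG Gt hJ.
have [x /andP[Jx xa]] := ereal_rat_dense hJ; rewrite lte_fin in xa.
have : nbhs t G by exact: open_nbhs_nbhs.
move=> /nbhs_ballP[e /= e0 he].
have [|b1] := @rat_in_itvoo R (t - e) t; first by rewrite ltrBlDr ltrDl.
rewrite in_itv /= => /andP[b1e b1t].
have [|b2] := @rat_in_itvoo R t (t + e); first by rewrite ltrDl.
rewrite in_itv /= => /andP[b2t b2e].
have [|N hN] := H (b1, b2, x); first by exists t => //=; rewrite b1t.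
exists N => n i nN; apply: (@le_trans _ _ (expR (- (n%:R * ratr x)))%:E).
  by rewrite lee_fin ler_expR lerN2 ler_wpM2l// ltW.
apply: (le_trans (hN n i nN)); apply: (le_hitprob hw) => y /=.
rewrite in_itv /= => /andP[y1 y2]; apply: he; rewrite -ball_normE /= ltr_distl.
by apply/andP; split; lra.
Qed.

End Final.

(** * Averaging over the initial height, and conclusion *)

Section ProbT.
Context (R : realType) (d : nat) (kappa : R) (w : env R d) (pi : 'I_d -> R) (r : R).
Hypothesis hw : Omega_kappa kappa w.
Hypothesis hpi : prob_vector pi.

Lemma probT_le n G : (forall i, (hitprob w i n G <= r%:E)%E) -> (probT w pi n G <= r%:E)%E.
Proof.
case: hpi => p0 p1 h; apply: (@le_trans _ _ (\sum_(i < d) (pi i * r)%:E)%E).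
  by apply: lee_sum => i _; rewrite EFinM lee_wpmul2l// ?lee_fin//; exact: h.
by rewrite sumEFin -mulr_suml p1 mul1r.
Qed.

Lemma probT_ge n G : (forall i, (r%:E <= hitprob w i n G)%E) -> (r%:E <= probT w pi n G)%E.
Proof.
case: hpi => p0 p1 h; apply: (@le_trans _ _ (\sum_(i < d) (pi i * r)%:E)%E).
  by rewrite sumEFin -mulr_suml p1 mul1r.
by apply: lee_sum => i _; rewrite EFinM lee_wpmul2l// ?lee_fin//; exact: h.
Qed.

End ProbT.

Theorem theorem1 (R : realType) (d : nat) (hd : (0 < d)%N)
  (eta : probability (env R d) R)
  (A1_stat : stationary eta) (A1_erg : ergodic eta)
  (A2 : exists kappa : R, 0 < kappa /\ eta (Omega_kappa kappa) = 1%E) :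
  {ae eta, forall w : env R d,
    forall pi : env R d -> 'I_d -> R,
      (forall i, measurable_fun setT (fun w' => pi w' i)) ->
      (forall w', prob_vector (pi w')) ->
      (forall G : set R, open G ->
         (- ereal_inf (J eta @` G) <=
          limn_einf (fun n : nat => (n%:R^-1)%:E * elog (probT w (pi w) n G)))%E) /\
      (forall F : set R, compact F ->
         (limn_esup (fun n : nat => (n%:R^-1)%:E * elog (probT w (pi w) n F)) <=
          - ereal_inf (J eta @` F))%E)}.
Proof.
have [kappa [kappa0 hk]] := A2; pose i0 : 'I_d := Ordinal hd.
have [w0 hw0] := ae_witness (ae_Omega hk).
have [K0 hK0] := kappa_pow i0 kappa0 hw0.
apply: filterS2 (lower_ae_open i0 A1_stat A1_erg kappa0 hk hK0)
  (upper_ae i0 A1_stat A1_erg kappa0 hk hK0) => w lower upper pi _ hpi; split.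
- move=> G oG; rewrite leeNl; apply: le_ereal_inf_tmp => _ [t Gt <-].
  (* If the bound failed at [t], a rational [q] would lie strictly between [J eta t] and minus the
     lower limit, contradicting the exponential lower bound with rate [q]. *)
  rewrite leNgt; apply/negP => /ereal_rat_dense[q /andP[Jq]].
  rewrite lteNr ltNge => /negP; apply.
  have [N hN] := lower G t (ratr q) oG Gt Jq.
  apply: limn_einf_ge_near; exists (maxn N 1) => // n /=; rewrite geq_max => /andP[nN n1].
  have n0 : 0 < n%:R :> R by rewrite ltr0n.
  have h : ((- (n%:R * ratr q))%:E <= elog (probT w (pi w) n G))%E.
    by apply: elog_ge; apply: probT_ge => // i; exact: hN.
  have -> : ((- ratr q)%:E = (n%:R^-1)%:E * (- (n%:R * ratr q))%:E :> \bar R)%E.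
    by rewrite -EFinM; congr _%:E; field; rewrite gt_eqF.
  by rewrite lee_wpmul2l// lee_fin invr_ge0 ltW.
- move=> F cF; rewrite leeNr leNgt; apply/negP => /ereal_rat_dense[q /andP[qL qI]].
  (* A second rational: the gap between [q] and [b] absorbs the prefactor [C] of [exp_small]. *)
  have [b /andP[qb bI]] := ereal_rat_dense qI; rewrite lte_fin in qb.
  move: qL; rewrite lteNl ltNge => /negP; apply.
  have [|C [N hN]] := upper (ratr b) F cF.
    by move=> t Ft; apply: (lt_le_trans bI); apply: ereal_inf_lbound; exists t.
  have g0 : 0 < ratr b - ratr q :> R by rewrite subr_gt0.
  (* From [N1] on, [Num.max C 1] is at most exp(n (b - q)). Being a successor, [N1] also keeps [n]
     positive, and the maximum with 1 makes the logarithm meaningful. *)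
  pose N1 := (Num.truncn (ln (Num.max C 1) / (ratr b - ratr q))).+1.
  apply: limn_esup_le_near; exists (maxn N N1) => // n /=; rewrite geq_max => /andP[nN nN1].
  have n0 : 0 < n%:R :> R by rewrite ltr0n (leq_trans _ nN1).
  have C1 : 0 < Num.max C 1 by rewrite lt_max ltr01 orbT.
  have h : (elog (probT w (pi w) n F) <= (- (n%:R * ratr q))%:E)%E.
    apply: elog_le; apply: probT_le => // i; apply: (le_trans (hN n i nN)).
    rewrite lee_fin; apply: (@le_trans _ _ (Num.max C 1 * expR (- (n%:R * ratr b)))).
      by rewrite ler_wpM2r ?expR_ge0// le_max lexx.
    rewrite -[X in X * _ <= _](@lnK R) ?posrE// -expRD ler_expR.
    rewrite lerBlDr addrC -mulrBr -ler_pdivrMr//.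
    by apply: (le_trans (ltW (truncnS_gt _))); rewrite ler_nat.
  have -> : ((- ratr q)%:E = (n%:R^-1)%:E * (- (n%:R * ratr q))%:E :> \bar R)%E.
    by rewrite -EFinM; congr _%:E; field; rewrite gt_eqF.
  by rewrite lee_wpmul2l// lee_fin invr_ge0 ltW.
Qed.
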